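(* Let $\chi=(y,u,p,\mu^+,\mu^-,\lambda)\in\mathcal{Y}$ fulfill the first-order necessary optimality conditions of the continuous problem, i.e., $$L'(\chi)(\delta y,\delta u,\delta p)=0\quad\forall(\delta y,\delta u,\delta p)\in W(0,T)\times L^2(0,T)\times W(0,T),$$ $$\mu^+\ge0,\ \ \mu^+(u-1)=0,\ \ u\le1\ \text{ a.e. in }(0,T),\qquad \mu^-\ge0,\ \ \mu^-u=0,\ \ u\ge0\ \text{ a.e. in }(0,T),$$ $$\lambda\ge0,\quad\lambda^\top(Gu-b)=0,\quad Gu\le b,$$ and let $\chi_\rho=(y_\rho,u_\rho,p_\rho,\mu_\rho^+,\mu_\rho^-,\lambda_\rho)\in\mathcal{Y}_\rho$ fulfill the first-order necessary optimality conditions of the discretized problem, i.e., $$\tilde L'(\chi_\rho)(\delta y,\delta u,\delta p)=0\quad\forall(\delta y,\delta u,\delta p)\in X_{s,h}\times Q_\rho\times X_{s,h},$$ $$\mu_\rho^+|_{J_l}\ge0,\ \ \mu_\rho^+|_{J_l}(u_\rho|_{J_l}-1)=0,\ \ u_\rho|_{J_l}\le1,\qquad \mu_\rho^-|_{J_l}\ge0,\ \ \mu_\rho^-|_{J_l}u_\rho|_{J_l}=0,\ \ u_\rho|_{J_l}\ge0\qquad\forall l=1,\dots,L,$$ $$\lambda_\rho\ge0,\quad\lambda_\rho^\top(Gu_\rho-b)=0,\quad Gu_\rho\le b.$$ Then $$\begin{aligned} J(y,u)-J(y_\rho,u_\rho)&=\tfrac12\tilde L'(\chi)(\chi-\chi_\rho)+\tfrac12\tilde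 L'(\chi_\rho)(\chi-\chi_\rho)\\ &=\tfrac12\Big(\tilde L_y'(\chi_\rho)(y-y_\rho)+\tilde L_p'(\chi_\rho)(p-p_\rho)+\tilde L_u'(\chi_\rho)(u-u_\rho)\\ &\qquad+\tilde L_{\mu^+}'(\chi)(\mu^+-\mu_\rho^+)+\tilde L_{\mu^-}'(\chi)(\mu^--\mu_\rho^-)+\tilde L_\lambda'(\chi)(\lambda-\lambda_\rho)\\ &\qquad+\tilde L_{\mu^+}'(\chi_\rho)(\mu^+-\mu_\rho^+)+\tilde L_{\mu^-}'(\chi_\rho)(\mu^--\mu_\rho^-)+\tilde L_\lambda'(\chi_\rho)(\lambda-\lambda_\rho)\Big). \end{aligned}$$
   Context: Data: $T>0$, $\Omega\subset\mathbb{R}^d$ a bounded Lipschitz domain, $Q:=\Omega\times(0,T)$, $\psi\in H^{-1}(\Omega)$, $y_0\in L^2(\Omega)$, $y_{\rm d}\in L^2(Q)$, $\alpha\ge0$, and $$J(y,u)=\tfrac12\|y-y_{\rm d}\|_{L^2(Q)}^2+\tfrac\alpha2\|u-\tfrac12\|_{L^2(0,T)}^2 .$$ $W(0,T):=H^1(0,T;H^{-1}(\Omega))\cap L^2(0,T;H_0^1(\Omega))$, which embeds continuously into $C([0,T];L^2(\Omega))$. $\Psi:L^2(0,T)\to L^2(0,T;H^{-1}(\Omega))$, $(\Psi u)(t,x)=u(t)\psi(x)$. $G:L^2(0,T)\to\mathbb{R}^k$ is the linear operator $(Gu)_\ell=a_\ell^\top\Pi_\ell(u)$, $\ell=1,\dots,k$,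 where each $\Pi_\ell(u)=\big(\tfrac1{\lambda(I_i)}\int_{I_i}u\,\mathrm{d}t\big)_{i}$ is a local averaging operator with finitely many intervals $I_i\subseteq(0,T)$ of length $\lambda(I_i)$ and $a_\ell$ is a real vector of matching dimension; $b\in\mathbb{R}^k$. Continuous problem: minimize $J(y,u)$ subject to $y$ being the weak solution of $\partial_ty-\Delta y=\Psi u$ in $Q$, $y=0$ on $\partial\Omega\times(0,T)$, $y(0)=y_0$; $u\in[0,1]$ a.e. in $(0,T)$; $Gu\le b$. Its Lagrangian on $\mathcal{Y}:=W(0,T)\times L^2(0,T)\times W(0,T)\times L^2(0,T)\times L^2(0,T)\times\mathbb{R}^k$ is $$\begin{aligned}L(y,u,p,\mu^+,\mu^-,\lambda)=\;&J(y,u)-\langle\partial_ty,p\rangle_{L^2(0,T;H^{-1}(\Omega)),L^2(0,T;H_0^1(\Omega))}-(\nabla y,\nabla p)_{L^2(0,T;L^2(\Omega))}-(y(0)-y_0,p(0))_{L^2(\Omega)}\\&+(\Psi(u),p)+(\mu^+,u-1)_{L^2(0,T)}-(\mu^-,u)_{L^2(0,T)}+\lambda^\top(Gu-b).\end{aligned}$$ Discretization: $0=t_0<t_1<\cdots<t_L=T$, $J_l=(t_{l-1},t_l]$ with length $\lambda(J_l)$. For each $l$, $V_h^l\subset H_0^1(\Omega)$ is the finite-dimensional space of continuous functions on $\overline\Omega$ vanishing on $\partial\Omega$ that are piecewise linear with respect to a partition $\mathcal{K}_h^l$ of $\Omega$. $X_{s,h}$ is the space of functions $v\in L^2(0,T;L^2(\Omega))$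 such that, for each $l$, $v|_{J_l}$ is constant in time with value in $V_h^l$. $Q_\rho:=\{w\in L^2(0,T): w|_{J_l}\text{ is constant for all }l=1,\dots,L\}$. For $v\in X_{s,h}$ (and also for $v\in W(0,T)$ and sums of such functions): $v_l^+=\lim_{t\searrow0}v(t_l+t)$, $v_l^-=\lim_{t\searrow0}v(t_l-t)$, $[v]_l=v_l^+-v_l^-$. Write $\langle\cdot,\cdot\rangle_{J_l}$ for the duality pairing of $L^2(J_l;H^{-1}(\Omega))$ and $L^2(J_l;H_0^1(\Omega))$, $(\cdot,\cdot)_{J_l}$ for the inner product of $L^2(J_l;L^2(\Omega))$, and $(\cdot,\cdot)$ for the inner product of $L^2(\Omega)$; terms $(\Psi(u),p)$ and $(\Psi(u),p)_{J_l}$ are understood as $H^{-1}(\Omega)$-$H_0^1(\Omega)$ duality pairings integrated over $(0,T)$ and $J_l$, respectively. Time derivatives are taken interval-wise on each $J_l$ (so they vanish for functions in $X_{s,h}$). Discretized problem: minimize $J(y_\rho,u_\rho)$ over $(y_\rho,u_\rho)\in X_{s,h}\times Q_\rho$ subject to $$\sum_{l=1}^L\langle\partial_ty_\rho,\varphi\rangle_{J_l}+\sum_{l=1}^L(\nabla y_\rho,\nabla\varphi)_{J_l}+\sum_{l=1}^{L-1}([y_\rho]_l,\varphi_l^+)=\sum_{l=1}^L(\Psi(u_\rho),\varphi)_{J_l}+(y_0-y_{\rho,0}^+,\varphi_0^+)\quad\forall\varphi\in X_{s,h},$$ $0\le u_\rho|_{J_l}\le1$ for all $l$, and $Gu_\rho\le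 b$. Let $\mathcal{Y}_\rho:=X_{s,h}\times Q_\rho\times X_{s,h}\times Q_\rho\times Q_\rho\times\mathbb{R}^k$. The associated Lagrangian is $$\begin{aligned}\tilde L(y,u,p,\mu^+,\mu^-,\lambda)=\;&J(y,u)-\sum_{l=1}^L\langle\partial_ty,p\rangle_{J_l}-\sum_{l=1}^L(\nabla y,\nabla p)_{J_l}-\sum_{l=1}^{L-1}([y]_l,p_l^+)-(y_0^+-y_0,p_0^+)\\&+\sum_{l=1}^L(\Psi(u),p)_{J_l}+(\mu^+,u-1)_{L^2(0,T)}-(\mu^-,u)_{L^2(0,T)}+\lambda^\top(Gu-b),\end{aligned}$$ where in the term $(y_0^+-y_0,p_0^+)$ the symbol $y_0^+$ is the right limit of the state $y$ at $t_0=0$ and $y_0$ is the given initial state. It is defined by this formula on $\mathcal{Y}_\rho$, on $\mathcal{Y}$, and on their sum $\mathcal{Y}+\mathcal{Y}_\rho$. On $\mathcal{Y}_\rho$, the terms $(\mu^+,u-1)_{L^2(0,T)}$ and $(\mu^-,u)_{L^2(0,T)}$ equal $\sum_l\lambda(J_l)\mu^+|_{J_l}(u|_{J_l}-1)$ and $\sum_l\lambda(J_l)\mu^-|_{J_l}u|_{J_l}$. Primes denote (directional) derivatives, $L'(\chi)(\delta y,\delta u,\delta p)$ and $\tilde L'(\chi_\rho)(\delta y,\delta u,\delta p)$ the derivatives with respect to $(y,u,p)$, and $\tilde L_y',\tilde L_u',\tilde L_p',\tilde L_{\mu^+}',\tilde L_{\mu^-}',\tilde L_\lambda'$ the partial derivatives.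 *)

(* Defs.v *)
From HB Require Import structures.
From mathcomp Require Import all_boot all_order all_algebra.
From mathcomp Require Import all_classical all_reals all_analysis.
Set Implicit Arguments. Unset Strict Implicit. Unset Printing Implicit Defensive.
Import Order.TTheory GRing.Theory Num.Theory numFieldNormedType.Exports.
Local Open Scope classical_set_scope.
Local Open Scope ring_scope.

(* The product sigma-algebra (= Borel sigma-algebra) on row vectors, following
   the library's instance on tuples. *)
Section measurable_rV.
Context (R : realType) (n : nat).
Let coors : 'I_n -> 'rV[R]_n -> R := fun i x => x ord0 i.

Let rV_set0 : g_sigma_preimage coors set0.
Proof. exact: sigma_algebra0. Qed.

Let rV_setC A : g_sigma_preimage coors A -> g_sigma_preimage coors (~` A).
Proof. exact: sigma_algebraC. Qed.

Let rV_bigcup (F : (set 'rV[R]_n)^nat) : (forall i, g_sigma_preimage coors (F i)) ->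
  g_sigma_preimage coors (\bigcup_i (F i)).
Proof. exact: sigma_algebra_bigcup. Qed.

HB.instance Definition _ := @isMeasurable.Build default_measure_display
  'rV[R]_n (g_sigma_preimage coors) rV_set0 rV_setC rV_bigcup.

Lemma measurable_coord (i : 'I_n) :
  measurable_fun [set: 'rV[R]_n] (fun x : 'rV[R]_n => x ord0 i).
Proof.
move=> _ Y mY; rewrite setTI; apply: sub_sigma_algebra => /=.
rewrite -bigcup_seq/=; exists i => /=; first by rewrite mem_index_enum.
by exists Y => //; rewrite setTI.
Qed.

Lemma measurable_fun_rV d (T : measurableType d) (f : T -> 'rV[R]_n) :
  (forall i, measurable_fun [set: T] (fun t => f t ord0 i)) ->
  measurable_fun [set: T] f.
Proof.
move=> mf; apply: measurability => //= A [B].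
rewrite -bigcup_seq => -[i _ [C mC <-] <-].
by rewrite !setTI; have := mf i measurableT C mC; rewrite setTI.
Qed.
End measurable_rV.

(* Lebesgue measure on R^n: iterated product of the one-dimensional Lebesgue
   measure, transported along R * R^n ~ R^(n+1). *)
Section lebesgue_measure_rV.
Context (R : realType).
Local Notation mu := (@lebesgue_measure R).

Definition rV_cons n (xv : R * 'rV[R]_n) : 'rV[R]_n.+1 :=
  \row_(i < n.+1) oapp (xv.2 ord0) xv.1 (unlift ord0 i).

Lemma measurable_rV_cons n : measurable_fun setT (@rV_cons n).
Proof.
apply: measurable_fun_rV => i.
case: (unliftP ord0 i) => [j ->|->].
  under eq_fun do rewrite mxE liftK/=.
  exact: (measurableT_comp (measurable_coord j)).
under eq_fun do rewrite mxE unlift_none/=.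
exact: measurable_fst.
Qed.

Lemma measurable_rV_uncons n :
  measurable_fun setT (fun v : 'rV[R]_n.+1 =>
    (v ord0 ord0, \row_(j < n) v ord0 (lift ord0 j))).
Proof.
apply: measurable_fun_pair; first exact: measurable_coord.
apply: measurable_fun_rV => i.
by under eq_fun do rewrite mxE; exact: measurable_coord.
Qed.

Lemma rV_consK n : cancel (@rV_cons n) (fun v : 'rV[R]_n.+1 =>
    (v ord0 ord0, \row_(j < n) v ord0 (lift ord0 j))).
Proof.
move=> [x v]; rewrite mxE unlift_none/=; congr pair.
by apply/rowP => i; rewrite !mxE liftK.
Qed.

Lemma rV_unconsK n : cancel (fun v : 'rV[R]_n.+1 =>
    (v ord0 ord0, \row_(j < n) v ord0 (lift ord0 j))) (@rV_cons n).
Proof.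
move=> v; apply/rowP => i; rewrite mxE/=.
by case: (unliftP ord0 i) => [j ->|->]/=; rewrite ?mxE.
Qed.

Section step.
Context n (nu : {sigma_finite_measure set 'rV[R]_n -> \bar R}).

Definition lebesgue_step : set 'rV[R]_n.+1 -> \bar R :=
  pushforward (mu \x nu)%E (@rV_cons n).

Let lebesgue_step0 : lebesgue_step set0 = 0%E.
Proof. by rewrite /lebesgue_step /pushforward preimage_set0 measure0. Qed.

Let lebesgue_step_ge0 A : (0 <= lebesgue_step A)%E.
Proof. by rewrite /lebesgue_step /pushforward; exact: (measure_ge0 (mu \x nu)%E). Qed.

Let lebesgue_step_additive : semi_sigma_additive lebesgue_step.
Proof.
move=> F mF tF mUF.
have mc := @measurable_rV_cons n.
have mE A : measurable A -> measurable (@rV_cons n @^-1` A).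
  by move=> mA; rewrite -[X in measurable X]setTI; exact: mc.
rewrite /lebesgue_step /pushforward preimage_bigcup.
apply: measure_semi_sigma_additive => [i||].
- exact: mE.
- apply/trivIsetP => /= i j _ _ ij; rewrite -preimage_setI.
  by move/trivIsetP : tF => /(_ _ _ _ _ ij) ->//; rewrite preimage_set0.
- by rewrite -preimage_bigcup; exact: mE.
Qed.

HB.instance Definition _ := isMeasure.Build _ _ _ lebesgue_step
  lebesgue_step0 lebesgue_step_ge0 lebesgue_step_additive.

Let lebesgue_step_sigma_finite : sigma_finite setT lebesgue_step.
Proof.
have /sigma_finiteP[F [TF ndF Foo]] := sigma_finiteT mu.
have /sigma_finiteP[G [TG ndG Goo]] := sigma_finiteT nu.
pose uncons (v : 'rV[R]_n.+1) :=
  (v ord0 ord0, \row_(j < n) v ord0 (lift ord0 j)).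
exists (fun i => uncons @^-1` (F i `*` G i)).
  rewrite -preimage_bigcup (_ : \bigcup_i _ = setT) ?preimage_setT//.
  apply/seteqP; split=> // -[x y] _.
  have [i _ Fix] : (\bigcup_i F i) x by rewrite -TF.
  have [j _ Gjy] : (\bigcup_i G i) y by rewrite -TG.
  exists (maxn i j) => //; split.
  - by move: x Fix; exact/subsetPset/ndF/leq_maxl.
  - by move: y Gjy; exact/subsetPset/ndG/leq_maxr.
move=> i; have [mFi Fioo] := Foo i; have [mGi Gioo] := Goo i.
split.
  rewrite -[X in measurable X]setTI.
  by apply: measurable_rV_uncons => //; exact: measurableX.
rewrite /lebesgue_step /pushforward -comp_preimage.
rewrite (_ : uncons \o @rV_cons n = id); last exact/funext/rV_consK.
by rewrite preimage_id product_measure1E// lte_mul_pinfty// ge0_fin_numE.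
Qed.

HB.instance Definition _ := Measure_isSigmaFinite.Build _ _ _ lebesgue_step
  lebesgue_step_sigma_finite.
End step.

Fixpoint lebesgue_rV n : {sigma_finite_measure set 'rV[R]_n -> \bar R} :=
  if n is n'.+1 then lebesgue_step (lebesgue_rV n') else \d_(0 : 'rV[R]_0).

End lebesgue_measure_rV.

(* Elements of Lebesgue, Sobolev and Bochner spaces are represented by functions,
   and membership in a space is a predicate. Functions that agree almost
   everywhere represent the same element; values outside the underlying domain
   are irrelevant. *)

Section domains.
Context (R : realType) (d : nat).
Local Notation E := 'rV[R]_d.
Implicit Types (Om : set E) (x y : E).

Definition dotv x y : R := \sum_(i < d) x ord0 i * y ord0 i.

(* Near each boundary point, in suitable orthonormal coordinates, Om is the
   strict epigraph of a Lipschitz function. The vertical axis is spanned by the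
   unit vector nu, [dotv x nu] is the height of x, and gam is only evaluated at
   projections onto the orthogonal complement of nu. *)
Definition bounded_lipschitz_domain Om : Prop :=
  [/\ open Om, connected Om, Om !=set0, bounded_set Om &
    forall x0, closure Om x0 -> ~ Om x0 ->
      exists (r : R) (nu : E) (gam : E -> R) (c : R),
        [/\ 0 < r, dotv nu nu = 1,
            forall x y, `|gam x - gam y| <= c * `|x - y| &
            forall x, `|x - x0| < r ->
              (Om x <-> gam (x - dotv x nu *: nu) < dotv x nu)] ].

(* A finite mesh of Om with open cells. *)
Definition is_mesh Om (K : set (set E)) : Prop :=
  [/\ finite_set K,
      forall c, K c -> [/\ open c, c !=set0 & c `<=` Om],
      trivIset K id &
      Om `<=` \bigcup_(c in K) closure c].

Definition affine_on (c : set E) (v : E -> R) : Prop :=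
  exists (g : E) (b : R), forall x, c x -> v x = dotv g x + b.

End domains.

Section spaces_on_Om.
Context (R : realType) (d : nat).
Local Notation E := 'rV[R]_d.
Local Notation leb := (lebesgue_rV R d).
Context (Om : set E).
Implicit Types (v w : E -> R) (f : (E -> R) -> R).

Definition L2 v : Prop :=
  measurable_fun Om v /\ leb.-integrable Om (fun x => (v x ^+ 2)%:E).

Definition ip v w : R := \int[leb]_(x in Om) (v x * w x).

Definition L2norm v : R := Num.sqrt (ip v v).

Definition partials (s : seq 'I_d) (phi : E -> R) : E -> R :=
  foldr (fun i g => 'D_(delta_mx ord0 i) g) phi s.

Definition smooth (phi : E -> R) : Prop :=
  forall s : seq 'I_d, continuous (partials s phi) /\
    forall i x, derivable (partials s phi) x (delta_mx ord0 i).

Definition test_fun (phi : E -> R) : Prop :=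
  smooth phi /\
  exists C : set E, [/\ compact C, C `<=` Om & forall x, ~ C x -> phi x = 0].

Definition is_weak_grad v (g : 'I_d -> E -> R) : Prop :=
  (forall i, L2 (g i)) /\
  forall phi, test_fun phi -> forall i,
    \int[leb]_(x in Om) (v x * 'D_(delta_mx ord0 i) phi x) =
    - \int[leb]_(x in Om) (g i x * phi x).

Definition H1 v : Prop := L2 v /\ exists g, is_weak_grad v g.

Definition grad v : 'I_d -> E -> R := xget (fun _ _ => 0) (is_weak_grad v).

Definition ip_grad v w : R := \sum_(i < d) ip (grad v i) (grad w i).

Definition H1norm v : R := Num.sqrt (ip v v + ip_grad v v).

(* H^1_0: closure of the test functions in H^1. *)
Definition H10 v : Prop :=
  H1 v /\ forall e, 0 < e -> exists2 phi, test_fun phi & H1norm (v - phi) < e.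

(* H^{-1}: bounded linear functionals on H^1_0; the duality pairing is
   application. *)
Definition Hm1 f : Prop :=
  (forall (c : R) v w, H10 v -> H10 w -> f (c *: v + w) = c * f v + f w) /\
  exists C : R, forall v, H10 v -> `|f v| <= C * H1norm v.

Definition Hm1norm f : R :=
  sup [set `|f v| | v in [set v | H10 v /\ H1norm v <= 1]].

(* Continuous piecewise affine functions on the mesh K vanishing on the
   boundary of Om. *)
Definition Vh (K : set (set E)) v : Prop :=
  [/\ H10 v, {within closure Om, continuous v},
      forall x, closure Om x -> ~ Om x -> v x = 0 &
      forall c, K c -> affine_on c v].

End spaces_on_Om.

Section bochner.
Context (R : realType).
Local Notation mu := (@lebesgue_measure R).

Definition L2t (a b : R) (u : R -> R) : Prop :=
  measurable_fun `]a, b[%classic u /\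
  mu.-integrable `]a, b[%classic (fun t => (u t ^+ 2)%:E).

(* The Bochner space L^2(a,b;X), where X is the space of members of mem with the
   norm nrm: strongly measurable functions with square integrable norm. *)
Definition simple_fun (V : Type) (mem : V -> Prop) (s : R -> V) : Prop :=
  [/\ finite_set (range s), forall t, mem (s t) &
      forall v, measurable (s @^-1` [set v])].

Definition L2B (V : zmodType) (mem : V -> Prop) (nrm : V -> R) (a b : R)
    (z : R -> V) : Prop :=
  [/\ {ae mu, forall t, a < t < b -> mem (z t)},
      (exists s : nat -> R -> V, (forall n, simple_fun mem (s n)) /\
        {ae mu, forall t, a < t < b ->
          (fun n => nrm (s n t - z t)) @ \oo --> (0 : R)}) &
      (\int[mu]_(t in `]a, b[) (nrm (z t) ^+ 2)%:E < +oo)%E].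

Definition test_fun_time (a b : R) (phi : R -> R) : Prop :=
  (forall n t, derivable (derive1n n phi) t 1) /\
  exists C : set R,
    [/\ compact C, C `<=` `]a, b[%classic & forall t, ~ C t -> phi t = 0].

End bochner.

Section spaces_in_time.
Context (R : realType) (d : nat).
Local Notation E := 'rV[R]_d.
Local Notation mu := (@lebesgue_measure R).
Context (Om : set E).
Implicit Types (z : R -> E -> R).

Definition L2_H10 (a b : R) z := L2B (H10 Om) (H1norm Om) a b z.
Definition L2_L2 (a b : R) z := L2B (L2 Om) (L2norm Om) a b z.
Definition L2_Hm1 (a b : R) (g : R -> (E -> R) -> R) :=
  L2B (Hm1 Om) (Hm1norm Om) a b g.

(* g is the distributional derivative of z on (a,b), where v in L^2 is identified
   with the functional w |-> (v,w) in H^{-1}; the identity in H^{-1} is tested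
   with the elements of H^1_0. *)
Definition is_time_deriv (a b : R) z (g : R -> (E -> R) -> R) : Prop :=
  L2_Hm1 a b g /\
  forall phi, test_fun_time a b phi -> forall v, H10 Om v ->
    \int[mu]_(t in `]a, b[) (derive1 phi t * ip Om (z t) v) =
    - \int[mu]_(t in `]a, b[) (phi t * g t v).

Definition dt (a b : R) z : R -> (E -> R) -> R :=
  xget (fun _ _ => 0) (is_time_deriv a b z).

(* W(0,T); an element is represented by its continuous representative
   [0,T] -> L^2. *)
Definition W (T : R) z : Prop :=
  [/\ L2_H10 0 T z, exists g, is_time_deriv 0 T z g,
      forall t, 0 <= t <= T -> L2 Om (z t) &
      forall t, 0 <= t <= T ->
        (fun s => L2norm Om (z s - z t)) @ within `[0, T]%classic (nbhs t)
          --> (0 : R)].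

Definition L2Q (T : R) (f : R * E -> R) : Prop :=
  measurable_fun (`]0, T[%classic `*` Om) f /\
  (mu \x lebesgue_rV R d)%E.-integrable (`]0, T[%classic `*` Om)
    (fun q => (f q ^+ 2)%:E).

(* One-sided limits in L^2(Om). *)
Definition rlim z (t : R) : E -> R :=
  xget 0 [set w | L2 Om w /\
    (fun s => L2norm Om (z (t + s) - w)) @ 0^'+ --> (0 : R)].
Definition llim z (t : R) : E -> R :=
  xget 0 [set w | L2 Om w /\
    (fun s => L2norm Om (z (t - s) - w)) @ 0^'+ --> (0 : R)].
Definition jump z (t : R) : E -> R := rlim z t - llim z t.

End spaces_in_time.

Section averages.
Context (R : realType).
Local Notation mu := (@lebesgue_measure R).

Definition averages m (I : 'I_m -> interval R) (u : R -> R) : 'cV[R]_m :=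
  \col_i ((fine (mu [set` I i]))^-1 * \int[mu]_(t in [set` I i]) u t).

Definition Gop k (m : 'I_k -> nat) (I : forall l, 'I_(m l) -> interval R)
    (a : forall l, 'cV[R]_(m l)) (u : R -> R) : 'cV[R]_k :=
  \col_l ((a l)^T *m averages (I l) u) ord0 ord0.

Definition le_vec k (v w : 'cV[R]_k) : Prop :=
  forall l, v l ord0 <= w l ord0.

End averages.

Section problem.
Context (R : realType) (d k : nat).
Local Notation E := 'rV[R]_d.
Local Notation mu := (@lebesgue_measure R).

(* (y, u, p, mu^+, mu^-, lambda) *)
Definition pdpoint : Type :=
  ((R -> E -> R) * (R -> R) * (R -> E -> R) * (R -> R) * (R -> R)
   * 'cV[R]_k)%type.
Definition dir_y (dy : R -> E -> R) : pdpoint := (dy, 0, 0, 0, 0, 0).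
Definition dir_u (du : R -> R) : pdpoint := (0, du, 0, 0, 0, 0).
Definition dir_p (dp : R -> E -> R) : pdpoint := (0, 0, dp, 0, 0, 0).
Definition dir_mup (dm : R -> R) : pdpoint := (0, 0, 0, dm, 0, 0).
Definition dir_mum (dm : R -> R) : pdpoint := (0, 0, 0, 0, dm, 0).
Definition dir_lam (dl : 'cV[R]_k) : pdpoint := (0, 0, 0, 0, 0, dl).

Definition dderiv (F : pdpoint -> R) (chi delta : pdpoint) : R :=
  derive1 (fun s : R => F (chi + s *: delta)) 0.

Context (Om : set E) (T : R) (psi : (E -> R) -> R) (y0 : E -> R)
  (yd : R * E -> R) (alpha : R) (G : (R -> R) -> 'cV[R]_k) (b : 'cV[R]_k).

(* The integral of |y - yd|^2 over Q is computed as an iterated integral. *)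
Definition J (y : R -> E -> R) (u : R -> R) : R :=
  2^-1 * \int[mu]_(t in `]0, T[)
           \int[lebesgue_rV R d]_(x in Om) ((y t x - yd (t, x)) ^+ 2)
  + alpha / 2 * \int[mu]_(t in `]0, T[) ((u t - 2^-1) ^+ 2).

Definition Psi (u : R -> R) : R -> (E -> R) -> R := fun t => u t *: psi.

(* L^2(0,T;H^{-1}) - L^2(0,T;H^1_0) pairing over D *)
Definition pair_on (D : set R) (g : R -> (E -> R) -> R) (p : R -> E -> R) : R :=
  \int[mu]_(t in D) g t (p t).

Definition ip_grad_on (D : set R) (y p : R -> E -> R) : R :=
  \int[mu]_(t in D) ip_grad Om (y t) (p t).

Definition multiplier_terms (u mup mum : R -> R) (lam : 'cV[R]_k) : R :=
  \int[mu]_(t in `]0, T[) (mup t * (u t - 1))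
  - \int[mu]_(t in `]0, T[) (mum t * u t)
  + (lam^T *m (G u - b)) ord0 ord0.

Definition Lagr (chi : pdpoint) : R :=
  let '(y, u, p, mup, mum, lam) := chi in
  J y u - pair_on `]0, T[ (dt Om 0 T y) p - ip_grad_on `]0, T[ y p
  - ip Om (y 0 - y0) (p 0) + pair_on `]0, T[ (Psi u) p
  + multiplier_terms u mup mum lam.

(* Time grid 0 = tau 0 < ... < tau N = T; the cell number l (from 0) is
   (tau l, tau l.+1]. *)
Context (N : nat) (tau : nat -> R) (mesh : nat -> set (set E)).

Definition cell l : set R := `]tau l, tau l.+1]%classic.

Definition Xsh (v : R -> E -> R) : Prop :=
  L2_L2 Om 0 T v /\
  forall l, (l < N)%N ->
    exists2 w, Vh Om (mesh l) w & forall t, cell l t -> v t = w.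

Definition Qrho (w : R -> R) : Prop :=
  L2t 0 T w /\
  forall l, (l < N)%N -> exists c : R, forall t, cell l t -> w t = c.

Definition Lagr_t (chi : pdpoint) : R :=
  let '(y, u, p, mup, mum, lam) := chi in
  J y u
  - \sum_(0 <= l < N) pair_on (cell l) (dt Om (tau l) (tau l.+1) y) p
  - \sum_(0 <= l < N) ip_grad_on (cell l) y p
  - \sum_(1 <= l < N) ip Om (jump Om y (tau l)) (rlim Om p (tau l))
  - ip Om (rlim Om y 0 - y0) (rlim Om p 0)
  + \sum_(0 <= l < N) pair_on (cell l) (Psi u) p
  + multiplier_terms u mup mum lam.

End problem.

(* Main.v *)
(** The discrete Lagrangian is a quadratic functional on a space that contains
    the continuous and the discrete functions, so the trapezoidal rule evaluates
    its increments exactly. Its values at chi and chi_rho are the costs, because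
    the state equations and complementarity annihilate all other terms; on
    W(0,T) the jumps vanish and the two Lagrangians agree.

    For the second equality it remains to see that the derivative of the
    discrete Lagrangian at chi vanishes in the direction (y_rho, u_rho, p_rho),
    although X_(s,h) is not contained in W(0,T). Testing the continuous
    equations with theta_n(t) w, where w is in H^1_0 and the smooth functions
    theta_n converge to the indicator function of (c,T), gives these equations
    integrated over (c,T) and hence over each cell; the boundary values at the
    grid points are exactly what the jump terms collect. *)

Require Import Defs.
From HB Require Import structures.
From mathcomp Require Import all_boot all_order all_algebra.
From mathcomp Require Import all_classical all_reals all_analysis.
From mathcomp Require Import measurable_realfun ring lra.
Import Order.TTheory GRing.Theory Num.Theory numFieldNormedType.Exports.
Local Open Scope classical_set_scope.
Local Open Scope ring_scope.

Set Implicit Arguments. Unset Strict Implicit. Unset Printing Implicit Defensive.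

(** * Integrals up to null sets *)

(** Gradients, time derivatives and one-sided limits are choices among representatives that agree
    almost everywhere. That they act linearly on members of the spaces, and hence that the discrete
    Lagrangian is quadratic at all, rests on uniqueness statements. For the derivatives these need
    the fundamental lemma of the calculus of variations, in space and in time, and therefore a
    supply of test functions.

    The two equations respond differently to the cut-off tests. In the state equation the time
    derivative falls on y, so the limit yields only vanishing integrals over cells and the initial
    condition. In the adjoint equation it falls on the test function, and the derivatives of the
    cut-offs concentrate at c; since p is continuous with values in L^2, they pick up (w, p(c)).
    This replaces integration by parts between two elements of W(0,T), and the terminal condition
    p(T) = 0 is never stated: it is implicit in the formula for the integral over (c,T). *)

Section ae_integrable.
Context d (T : measurableType d) (R : realType).
Context (mu : {measure set T -> \bar R}) (D : set T).
Implicit Types (f g h : T -> R).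

(** The sigma-algebras in use are Borel and not completed, so a function that equals a measurable
    one off a null set need not be measurable. Integrands built from Bochner functions and from
    chosen representatives are known only up to null sets. *)
Definition aemeas f : Prop :=
  exists2 g, measurable_fun D g & {ae mu, forall x, D x -> f x = g x}.
Definition aeint f : Prop :=
  exists2 g, mu.-integrable D (EFin \o g) &
    {ae mu, forall x, D x -> f x = g x}.

Section nonneg.
Local Open Scope ereal_scope.
Import HBNNSimple.

Let ge0_ae_integral_le (f g : T -> \bar R) : measurable D ->
  (forall x, D x -> 0 <= f x) -> (forall x, D x -> 0 <= g x) ->
  {ae mu, forall x, D x -> f x = g x} ->
  \int[mu]_(x in D) f x <= \int[mu]_(x in D) g x.
Proof.
move=> mD f0 g0 [N [mN N0 fgN]].
rewrite ge0_integralE// [leRHS]ge0_integralE//.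
apply/ge_ereal_sup => /= _ [h /= hf <-].
(* Setting the simple function to zero on the null set [N] keeps its integral, and off [N] a
   minorant of [f] is a minorant of [g]. *)
pose h' := proj_nnsfun h (measurableC mN).
have h'E x : h' x = (h \_ (~` N)) x by rewrite mrestrict//; exact: measurableC.
have hh' : sintegral mu h = sintegral mu h'.
  have i2 (k : {nnsfun T >-> R}) : sintegral mu k = \int[mu]_x (k x)%:E.
    by rewrite integral_nnsfun// patch_setT.
  rewrite !i2.
  rewrite [LHS](ge0_negligible_integral mN)//; last 2 first.
  - exact/measurable_EFinP.
  - by move=> x _; rewrite lee_fin.
  rewrite [RHS](ge0_negligible_integral mN)//; last 2 first.
  - exact/measurable_EFinP.
  - by move=> x _; rewrite lee_fin.
  apply: eq_integral => x; rewrite in_setD => /andP[_ xN].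
  by have /= -> := h'E x; rewrite patchE in_setC xN.
rewrite hh'; apply: ereal_sup_ubound; exists h' => // x.
have /= -> := h'E x; rewrite patchE in_setC; case: ifPn => [xN|_]; last first.
  by rewrite patchE; case: ifPn => // xD; apply: g0; exact: set_mem.
apply: le_trans (hf x) _; rewrite !patchE; case: ifPn => // xD.
have -> // : f x = g x.
apply: contrapT => fg; move/negP: xN; apply; apply/mem_set/fgN => /=.
by move/(_ (set_mem xD)).
Qed.

Let ge0_ae_integral (f g : T -> \bar R) : measurable D ->
  (forall x, D x -> 0 <= f x) -> (forall x, D x -> 0 <= g x) ->
  {ae mu, forall x, D x -> f x = g x} ->
  \int[mu]_(x in D) f x = \int[mu]_(x in D) g x.
Proof.
move=> mD f0 g0 fg; apply/eqP; rewrite eq_le !ge0_ae_integral_le//.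
by apply: filterS fg => x /[apply].
Qed.

(* Unlike [ae_eq_integral], no measurability is assumed: the integral is a
   supremum over measurable simple functions, which ignore null sets. *)
Lemma ae_integral (f g : T -> \bar R) : measurable D ->
  {ae mu, forall x, D x -> f x = g x} ->
  \int[mu]_(x in D) f x = \int[mu]_(x in D) g x.
Proof.
move=> mD fg; rewrite integralE [RHS]integralE.
by congr (_ - _); apply: ge0_ae_integral => //; apply: filterS fg => x /[apply];
  rewrite !(funeposE, funenegE) => ->.
Qed.
End nonneg.

Lemma ae_Rintegral f g : measurable D ->
  {ae mu, forall x, D x -> f x = g x} ->
  \int[mu]_(x in D) f x = \int[mu]_(x in D) g x.
Proof.
move=> mD fg; rewrite /Rintegral; congr fine; apply: ae_integral => //.
by apply: filterS fg => x /[apply] ->.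
Qed.

Lemma aemeas_ae f g : {ae mu, forall x, D x -> f x = g x} ->
  aemeas g -> aemeas f.
Proof.
move=> fg [h mh gh]; exists h => //.
by apply: filterS2 fg gh => x + + Dx => -> // ->.
Qed.

Lemma measurable_aemeas f : measurable_fun D f -> aemeas f.
Proof. by move=> mf; exists f => //; exact: aeW. Qed.

Lemma aemeas_comp2 (op : R -> R -> R) f g :
  (forall f g, measurable_fun D f -> measurable_fun D g ->
    measurable_fun D (fun x => op (f x) (g x))) ->
  aemeas f -> aemeas g -> aemeas (fun x => op (f x) (g x)).
Proof.
move=> mop [f' mf' ff'] [g' mg' gg'].
exists (fun x => op (f' x) (g' x)); first exact: mop.
by apply: filterS2 ff' gg' => x + + Dx => -> // ->.
Qed.

Lemma aemeasD f g : aemeas f -> aemeas g -> aemeas (fun x => f x + g x).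
Proof. by apply: (@aemeas_comp2 +%R) => *; exact: measurable_funD. Qed.

Lemma aemeasM f g : aemeas f -> aemeas g -> aemeas (fun x => f x * g x).
Proof. by apply: (@aemeas_comp2 *%R) => *; exact: measurable_funM. Qed.

Lemma aemeas_cvg (f_ : nat -> T -> R) f : measurable D ->
  (forall n, aemeas (f_ n)) ->
  {ae mu, forall x, D x -> f_ ^~ x @ \oo --> f x} -> aemeas f.
Proof.
move=> mD /(_ _)/cid2 mf_ f_f.
pose g_ n := projT1 (mf_ n).
have mg_ n : measurable_fun D (g_ n) by rewrite /g_; case: (mf_ n).
have fg : {ae mu, forall x n, D x -> f_ n x = g_ n x}.
  by apply: ae_foralln => n; rewrite /g_; case: (mf_ n).
have [N [mN N0 NP]] : {ae mu, forall x, D x -> g_ ^~ x @ \oo --> f x}.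
  apply: filterS2 f_f fg => x + fg Dx => /(_ Dx); apply: cvg_trans.
  rewrite (_ : g_^~ x = f_ ^~ x)//.
  by apply/funext => n; rewrite fg.
have mDN : measurable (D `\` N) by exact: measurableD.
(* [f] is cut to zero on [N], where the representatives may fail to converge to it; cut in the same
   way, they converge everywhere on [D]. *)
exists (f \_ (D `\` N)).
  apply: (measurable_fun_cvg (h := fun n => g_ n \_ (D `\` N))) => [n|x Dx].
    apply: (measurable_restrict _ mDN mD).1; apply: measurable_funS (mg_ n) => //.
  rewrite patchE; case: ifPn => [xDN|xDN].
    rewrite (_ : (fun n => _) = g_ ^~ x); last first.
      by apply/funext => n; rewrite patchE xDN.
    apply: contrapT => fx; move: xDN; rewrite in_setD => /andP[_] /negP; apply.
    by apply/mem_set/NP => /= /(_ Dx).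
  rewrite (_ : (fun n => _) = (fun=> 0)); first exact: cvg_cst.
  by apply/funext => n; rewrite patchE (negbTE xDN).
exists N; split => // x /= fx; apply: contrapT => Nx; apply: fx => Dx.
by rewrite patchE mem_set.
Qed.

Lemma aeint_meas f : aeint f -> aemeas f.
Proof.
move=> [g ig fg]; exists g => //.
exact/measurable_EFinP/(measurable_int mu ig).
Qed.

Lemma aeint_ae f g : {ae mu, forall x, D x -> f x = g x} ->
  aeint g -> aeint f.
Proof.
move=> fg [h mh gh]; exists h => //.
by apply: filterS2 fg gh => x + + Dx => -> // ->.
Qed.

Lemma integrable_aeint f : mu.-integrable D (EFin \o f) -> aeint f.
Proof. by move=> mf; exists f => //; exact: aeW. Qed.

Hypothesis mD : measurable D.

Lemma aeintD f g : aeint f -> aeint g -> aeint (fun x => f x + g x).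
Proof.
move=> [f' if' ff'] [g' ig' gg']; exists (fun x => f' x + g' x).
  by have := integrableD mD if' ig'; apply: eq_integrable.
by apply: filterS2 ff' gg' => x + + Dx => -> // ->.
Qed.

Lemma aeintZ (c : R) f : aeint f -> aeint (fun x => c * f x).
Proof.
move=> [f' if' ff']; exists (fun x => c * f' x).
  by have := integrableZl mD c if'; apply: eq_integrable.
by apply: filterS ff' => x + Dx => ->.
Qed.

Lemma aeintN f : aeint f -> aeint (fun x => - f x).
Proof.
by move=> /(aeintZ (-1)); under eq_fun do rewrite mulN1r.
Qed.

Lemma aeintB f g : aeint f -> aeint g -> aeint (fun x => f x - g x).
Proof. by move=> fi gi; apply: aeintD => //; exact: aeintN. Qed.

Lemma aeint_norm f : aeint f -> aeint (fun x => `|f x|).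
Proof.
move=> [f' if' ff']; exists (fun x => `|f' x|); first exact: integrable_norm.
by apply: filterS ff' => x + Dx => ->.
Qed.

Lemma aeint_dom f h : aemeas f -> {ae mu, forall x, D x -> `|f x| <= h x} ->
  aeint h -> aeint f.
Proof.
move=> [g mg fg] fh [k ik hk]; exists g => //.
apply/integrableP; split; first exact/measurable_EFinP.
move/integrableP : (ik) => [mk]; apply: le_lt_trans.
apply: ae_ge0_le_integral => //.
- by apply: measurableT_comp => //; exact/measurable_EFinP.
- by apply: measurableT_comp.
apply: filterS3 fg fh hk => x + + + Dx => /(_ Dx) fg /(_ Dx) fh /(_ Dx) hk.
by rewrite /= lee_fin -fg (le_trans fh)// hk ler_norm.
Qed.

Lemma aeRintegralD f g : aeint f -> aeint g ->
  \int[mu]_(x in D) (f x + g x) =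
  \int[mu]_(x in D) f x + \int[mu]_(x in D) g x.
Proof.
move=> [f' if' ff'] [g' ig' gg'].
rewrite (ae_Rintegral mD ff') (ae_Rintegral mD gg') -RintegralD//.
by apply: ae_Rintegral => //; apply: filterS2 ff' gg' => x + + Dx => -> // ->.
Qed.

Lemma aeRintegralZ (c : R) f : aeint f ->
  \int[mu]_(x in D) (c * f x) = c * \int[mu]_(x in D) f x.
Proof.
move=> [f' if' ff']; rewrite (ae_Rintegral mD ff') -RintegralZl//.
by apply: ae_Rintegral => //; apply: filterS ff' => x + Dx => ->.
Qed.

Lemma aeRintegralB f g : aeint f -> aeint g ->
  \int[mu]_(x in D) (f x - g x) =
  \int[mu]_(x in D) f x - \int[mu]_(x in D) g x.
Proof.
move=> fi gi; rewrite aeRintegralD//; last exact: aeintN.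
by under [X in _ + X = _]eq_Rintegral do rewrite -mulN1r;
  rewrite aeRintegralZ// mulN1r.
Qed.

Lemma ae_le_Rintegral f g : aeint f -> aeint g ->
  {ae mu, forall x, D x -> f x <= g x} ->
  \int[mu]_(x in D) f x <= \int[mu]_(x in D) g x.
Proof.
move=> fi gi fg; rewrite -subr_ge0 -aeRintegralB//.
(* Positivity of the integral is available for pointwise nonnegative functions, so the difference is
   replaced by its positive part, which agrees with it almost everywhere. *)
rewrite (@ae_Rintegral _ (fun x => Num.max 0 (g x - f x)))//.
  by apply: Rintegral_ge0 => x Dx; rewrite le_max lexx.
by apply: filterS fg => x + Dx => /(_ Dx) fg; rewrite max_r// subr_ge0.
Qed.

Lemma ler_norm_aeRintegral f : aeint f ->
  `|\int[mu]_(x in D) f x| <= \int[mu]_(x in D) `|f x|.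
Proof.
move=> fi; have nfi := aeint_norm fi.
rewrite ler_norml; apply/andP; split; last first.
  by apply: ae_le_Rintegral => //; apply: aeW => x _; exact: ler_norm.
rewrite -mulN1r -aeRintegralZ//; apply: ae_le_Rintegral => //.
  exact: aeintZ.
by apply: aeW => x _; rewrite mulN1r lerNl -normrN ler_norm.
Qed.

Lemma aeRintegral_cvg (f_ : nat -> T -> R) f h :
  (forall n, aemeas (f_ n)) ->
  {ae mu, forall x, D x -> f_ ^~ x @ \oo --> f x} ->
  (forall n, {ae mu, forall x, D x -> `|f_ n x| <= h x}) -> aeint h ->
  (fun n => \int[mu]_(x in D) f_ n x) @ \oo --> \int[mu]_(x in D) f x.
Proof.
move=> mf_ f_f f_h hi.
have [g mg fg] := aemeas_cvg mD mf_ f_f.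
have [k ik hk] := hi.
move: mf_ => /(_ _)/cid2 mf_.
pose g_ n := projT1 (mf_ n).
have mg_ n : measurable_fun D (g_ n) by rewrite /g_; case: (mf_ n).
have fg_ n : {ae mu, forall x, D x -> f_ n x = g_ n x}.
  by rewrite /g_; case: (mf_ n).
have [] := @dominated_convergence _ _ _ mu D mD (fun n => EFin \o g_ n)
  (EFin \o g) (EFin \o k).
- by move=> n; exact/measurable_EFinP.
- exact/measurable_EFinP.
- apply: filterS3 f_f fg (ae_foralln fg_) => x + + fgx Dx => /(_ Dx) + /(_ Dx) fgE.
  rewrite /= -fgE => fx; apply: cvg_EFin; first exact: nearW.
  by rewrite (_ : fine \o _ = f_ ^~ x)//; apply/funext => n /=; rewrite fgx.
- exact: ik.
- apply: filterS3 (ae_foralln f_h) hk (ae_foralln fg_) => x fh + fgx n Dx.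
  by move=> /(_ Dx) hE; rewrite /= lee_fin -hE -fgx// fh.
move=> ig _ /= cvg.
rewrite (ae_Rintegral mD fg) (_ : (fun n => _) = fun n => \int[mu]_(x in D) g_ n x).
  by apply: fine_cvg; rewrite fineK//; exact: integrable_fin_num.
by apply/funext => n; exact: ae_Rintegral.
Qed.

End ae_integrable.

Section ae_integrable_more.
Context d (T : measurableType d) (R : realType).
Context (mu : {measure set T -> \bar R}).
Implicit Types (f g h : T -> R).

Lemma aemeasS (D E : set T) f : measurable D -> measurable E -> E `<=` D ->
  aemeas mu D f -> aemeas mu E f.
Proof.
move=> mD mE ED [g mg fg]; exists g; first exact: measurable_funS mg.
by apply: filterS fg => x + /ED.
Qed.

Lemma aeintS (D E : set T) f : measurable D -> measurable E -> E `<=` D ->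
  aeint mu D f -> aeint mu E f.
Proof.
move=> mD mE ED [g ig fg]; exists g; first exact: integrableS ig.
by apply: filterS fg => x + /ED.
Qed.

Lemma aeRintegral_setU (A B : set T) f : measurable A -> measurable B ->
  aeint mu (A `|` B) f -> [disjoint A & B] ->
  \int[mu]_(x in A `|` B) f x = \int[mu]_(x in A) f x + \int[mu]_(x in B) f x.
Proof.
move=> mA mB [g ig fg] AB.
rewrite (ae_Rintegral (measurableU _ _ mA mB) fg) Rintegral_setU//.
by congr (_ + _); apply: ae_Rintegral => //; apply: filterS fg => x gE Dx;
  rewrite gE//; [left|right].
Qed.

Lemma aeint_lty (D : set T) f : measurable D -> aeint mu D f ->
  (\int[mu]_(x in D) (f x)%:E < +oo)%E.
Proof.
move=> mD [g ig fg]; rewrite (@ae_integral _ _ _ _ _ _ (EFin \o g))//.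
  by rewrite ltey_eq integrable_fin_num.
by apply: filterS fg => x + Dx => /= ->.
Qed.

Lemma lty_aeint (D : set T) f : measurable D -> aemeas mu D f ->
  (forall x, D x -> 0 <= f x) ->
  (\int[mu]_(x in D) (f x)%:E < +oo)%E -> aeint mu D f.
Proof.
move=> mD [g mg fg] f0 If; exists g => //; apply/integrableP; split.
  exact/measurable_EFinP.
rewrite (@ae_integral _ _ _ _ _ _ (fun x => (f x)%:E))//.
by apply: filterS fg => x + Dx => /(_ Dx) fgx /=; rewrite -fgx ger0_norm ?f0.
Qed.

End ae_integrable_more.

(** * Bump functions and the fundamental lemma of the calculus of variations *)

Section flat_function.
Context (R : realType).
Implicit Types (P : {poly R}) (x : R).

(* P(1/x) e^(-1/x) for x > 0; this family of functions is closed under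
   differentiation, and [flat 1] is the usual smooth cut-off. *)
Definition flat P x : R := if 0 < x then P.[x^-1] * expR (- x^-1) else 0.

(** For [n > 0], [e^(t/n) >= 1 + t/n >= t/n] gives [e^t >= (t/n)^n]. The crude constant suffices,
    since only the decay matters. *)
Lemma exprn_expRN_le n (t : R) : 0 < t -> t ^+ n * expR (- t) <= n%:R ^+ n.
Proof.
move=> t0; case: n => [|n].
  by rewrite expr0 mul1r expr0 -expR0 ler_expR oppr_le0 ltW.
rewrite expRN ler_pdivrMr ?expR_gt0//.
have -> : expR t = expR (t / n.+1%:R) ^+ n.+1.
  by rewrite -expRM_natl mulrC divfK// pnatr_eq0.
rewrite -exprMn ler_pXn2r ?nnegrE ?mulr_ge0 ?expR_ge0//; last exact: ltW.
have := @expR_ge1Dx _ (t / n.+1%:R).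
rewrite addrC; move/(le_trans _) => /(_ (t / n.+1%:R)).
rewrite lerDl ler01 => /(_ isT); rewrite -(ler_pM2l (ltr0Sn R n)).
by rewrite mulrC divfK// pnatr_eq0.
Qed.

(** With [n] the number of coefficients, [P(1/x)] is at most [S x^-n] for [x < 1], and
    [x^-(n+2) e^(-1/x)] is bounded. The two spare powers of [x] make the difference quotient at 0
    tend to 0. *)
Lemma flat_le_sqr P : exists2 K : R, 0 <= K &
  forall x, 0 < x < 1 -> `|flat P x| <= K * x ^+ 2.
Proof.
pose n := size P; pose S := \sum_(i < n) `|P`_i|.
have S0 : 0 <= S by apply: sumr_ge0.
exists (S * n.+2%:R ^+ n.+2); first by rewrite mulr_ge0 ?exprn_ge0.
move=> x /andP[x0 x1]; rewrite /flat x0 normrM (ger0_norm (expR_ge0 _)).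
have x10 : 0 < x^-1 by rewrite invr_gt0.
have Px : `|P.[x^-1]| <= S * x^-1 ^+ n.
  rewrite horner_coef mulr_suml (le_trans (ler_norm_sum _ _ _))//.
  apply: ler_sum => i _; rewrite normrM ler_wpM2l// normrX gtr0_norm//.
  apply: ler_weXn2l; last by apply: ltnW; exact: ltn_ord.
  by rewrite invf_ge1// ltW.
have -> : S * n.+2%:R ^+ n.+2 * x ^+ 2 = (S * x^-1 ^+ n) * (n.+2%:R ^+ n.+2 * x ^+ n.+2).
  move: (n.+2%:R ^+ n.+2 : R) => c; rewrite -(addn2 n) [in RHS]exprD exprVn.
  rewrite -!mulrA; congr (S * _); rewrite [RHS]mulrCA; congr (c * _).
  by rewrite mulrA mulVf ?mul1r// expf_neq0 ?gt_eqF.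
apply: ler_pM; rewrite ?expR_ge0//.
by rewrite -ler_pdivrMr ?exprn_gt0// mulrC -exprVn exprn_expRN_le.
Qed.

(** With [s = 1/x], d/dx is [- s^2] times d/ds, which maps [P(s) e^(-s)] to
    [s^2 (P - P')(s) e^(-s)]. At 0 the quadratic bound gives the derivative 0. *)
Lemma is_derive_flat P x :
  is_derive x 1 (flat P) (flat ('X^2 * (P - P^`())) x).
Proof.
have [x0|x0|->] := ltgtP x 0.
- rewrite [flat _ x]/flat ltNge (ltW x0)/=.
  apply: (near_eq_is_derive (f := cst 0)) => //.
  have := lt_nbhsl x0; apply: filterS => y y0.
  by rewrite /flat ltNge (ltW y0).
- have xn0 : x != 0 by rewrite gt_eqF.
  rewrite [flat _ x]/flat x0.
  apply: (near_eq_is_derive (f := fun x => P.[x^-1] * expR (- x^-1))).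
    have := lt_nbhsr x0; apply: filterS => y y0.
    by rewrite /flat y0.
  have dV : is_derive x (1 : R) (fun y : R => y^-1) (- x ^- 2).
    apply: DeriveDef; first by apply: derivableV => //; exact: derivable_id.
    by rewrite deriveV ?derive_id ?scaler1//; exact: derivable_id.
  have dP : is_derive x (1 : R) (fun y : R => P.[y^-1]) (P^`().[x^-1] * - x ^- 2).
    exact: (@is_derive1_comp R (horner P)).
  have dE : is_derive x (1 : R) (fun y : R => expR (- y^-1))
      (expR (- x^-1) * - - x ^- 2).
    by apply: (@is_derive1_comp R expR); exact: is_deriveN.
  have dM := is_deriveM dP dE.
  refine (is_derive_eq dM _).
  rewrite opprK /GRing.scale/= !(hornerE, hornerXn) exprVn.
  move: P.[x^-1] P^`().[x^-1] (expR _) (x ^- 2) => p q e t.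
  by rewrite [LHS](_ : _ = p * e * t + e * q * - t)//; ring.
- rewrite [flat _ 0]/flat ltxx.
  have [K K0 HK] := flat_le_sqr P.
  have f0 : flat P 0 = 0 by rewrite /flat ltxx.
  have cv0 : (fun h : R => h^-1 *: ((flat P \o shift 0) (h *: 1) - flat P 0)) @ 0^'
      --> (0 : R).
    apply/cvgrPdist_lt => e e0; near=> h.
    rewrite sub0r normrN /= addr0 f0 subr0 /GRing.scale/= mulr1.
    have [h0|h0] := ltP 0 h; last by rewrite {1}/flat (ltNge 0) h0/= mulr0 normr0.
    have h1 : h < 1.
      apply: le_lt_trans (ler_norm h) _; near: h.
      by apply: dnbhs0_lt.
    rewrite normrM normfV (gtr0_norm h0) (@le_lt_trans _ _ (K * h))//.
      by rewrite ler_pdivrMl// mulrCA -expr2 HK// h0.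
    rewrite (@le_lt_trans _ _ ((K + 1) * h))// ?ler_wpM2r ?lerDl// 1?ltW//.
    rewrite mulrC -ltr_pdivlMr ?ltr_wpDl//.
    apply: le_lt_trans (ler_norm h) _; near: h.
    by apply: dnbhs0_lt; rewrite divr_gt0// ltr_wpDl.
  apply: DeriveDef; last exact: (cvg_lim _ cv0).
  by apply/cvg_ex; exists 0.
Unshelve. all: by end_near. Qed.

Lemma derive1_flat P : derive1 (flat P) = flat ('X^2 * (P - P^`())).
Proof. by apply/funext => x; rewrite derive1E; case: (is_derive_flat P x). Qed.

Lemma differentiable_flat P x : differentiable (flat P) x.
Proof. by apply/derivable1_diffP; case: (is_derive_flat P x). Qed.

End flat_function.

Section smooth_functions.
Context (R : realType) (V : normedModType R).

(** A syntactic class closed under directional derivatives, so that smoothness of all orders follows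
    by induction and iterated derivatives are never computed. The second premise of [smooth_flat]
    makes the derivatives of [l] independent of the point, as for affine [l]. *)
Inductive smoothF : (V -> R) -> Prop :=
| smooth_flat P (l dl : V -> R) :
    (forall x, differentiable l x) -> (forall x v, 'D_v l x = dl v) ->
    smoothF (fun x => flat P (l x))
| smooth_cst c : smoothF (fun=> c)
| smoothD f g : smoothF f -> smoothF g -> smoothF (f + g)
| smoothM f g : smoothF f -> smoothF g -> smoothF (f * g).

Lemma smoothF_diff f : smoothF f -> (forall x, differentiable f x) /\
  forall v, smoothF ('D_v f).
Proof.
elim=> [P l dl cl lE|c|{}f g _ [df Df] _ [dg Dg]|{}f g sf [df Df] sg [dg Dg]].
- have de (x : V) : differentiable (fun x => flat P (l x)) x.
    by apply: (@differentiable_comp _ _ _ _ l (flat P)) => //;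
      exact: differentiable_flat.
  split=> // v.
  rewrite (_ : 'D_v _ = (fun x => flat ('X^2 * (P - P^`())) (l x)) *
      (fun=> dl v)).
    by apply: smoothM; [exact: (smooth_flat _ cl lE)|exact: smooth_cst].
  apply/funext => x; rewrite deriveE//.
  rewrite (@diff_comp _ _ _ _ l (flat P))//=; last exact: differentiable_flat.
  rewrite deriv1E; last by case: (is_derive_flat P (l x)).
  by rewrite derive1_flat /= /GRing.scale/= mulrC -deriveE// lE.
- split=> // v; rewrite (_ : 'D_v _ = fun=> 0); first exact: smooth_cst.
  by apply/funext => x; rewrite derive_cst.
- split=> [x|v]; first exact: differentiableD.
  rewrite (_ : 'D_v _ = 'D_v f + 'D_v g); first exact: smoothD.
  by apply/funext => x; rewrite deriveD//; exact: diff_derivable.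
- split=> [x|v]; first exact: differentiableM.
  rewrite (_ : 'D_v _ = f * 'D_v g + g * 'D_v f).
    by apply: smoothD; apply: smoothM.
  by apply/funext => x; rewrite deriveM//; exact: diff_derivable.
Qed.

Lemma smoothF_prod (I : Type) (r : seq I) (f : I -> V -> R) :
  (forall i, smoothF (f i)) -> smoothF (fun x => \prod_(i <- r) f i x).
Proof.
move=> sf; elim: r => [|i r IH].
  by under eq_fun do rewrite big_nil; exact: smooth_cst.
by under eq_fun do rewrite big_cons; exact: (smoothM (sf i) IH).
Qed.

Lemma derive_affine (l : V -> R) (dl : V -> R) (x v : V) :
  (forall (h : R) x v, l (h *: v + x) = h * dl v + l x) -> 'D_v l x = dl v.
Proof.
move=> lE; apply: (cvg_lim (@Rhausdorff R)).
apply: cvg_near_cst; near=> h.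
rewrite /= lE addrK /GRing.scale/= mulKf//; near: h.
exact: nbhs_dnbhs_neq.
Unshelve. all: by end_near. Qed.

End smooth_functions.

Section bumps.
Context (R : realType).

Lemma flat1_ge0 (x : R) : 0 <= flat 1 x <= 1.
Proof.
rewrite /flat; case: ltP => x0; rewrite ?lexx ?ler01//.
by rewrite hornerC mul1r expR_ge0/= -expR0 ler_expR oppr_le0 invr_ge0 ltW.
Qed.

Lemma flat1_neg (x : R) : x <= 0 -> flat 1 x = 0.
Proof. by rewrite /flat leNgt; case: ltP. Qed.

(** [flat 1] vanishes for nonpositive arguments and tends to 1 at infinity, so its dilations
    converge to the indicator of the open half-line, also at 0. *)
Lemma flat1_cvg (x : R) :
  (fun n : nat => flat 1 (n%:R * x)) @ \oo --> ((0 < x)%R%:R : R).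
Proof.
have [x0|x0] := ltP 0 x; last first.
  rewrite (_ : (fun n => _) = fun=> 0); first exact: cvg_cst.
  by apply/funext => n; rewrite flat1_neg// mulr_ge0_le0.
have e1 : (fun n : nat => expR (- (n%:R * x)^-1)) @ \oo --> (1 : R).
  have n1 : (fun n : nat => (n%:R : R)^-1) @ \oo --> (0 : R).
    apply/gtr0_cvgV0; last exact: cvgr_idn.
    by near=> n; rewrite ltr0n; near: n; exists 1%N.
  have n2 : (fun n : nat => - ((n%:R : R)^-1 * x^-1)) @ \oo --> (- (0 * x^-1) : R).
    by apply: cvgN; apply: cvgM n1 _; exact: cvg_cst.
  rewrite mul0r oppr0 in n2.
  have n3 : (fun n : nat => expR (- ((n%:R : R)^-1 * x^-1))) @ \oo --> (expR 0 : R).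
    exact: (cvg_comp _ _ n2 (@continuous_expR R 0)).
  rewrite expR0 in n3.
  apply: cvg_trans n3; apply: near_eq_cvg; near=> n.
  by rewrite /= invfM.
apply: cvg_trans e1; apply: near_eq_cvg; near=> n.
have n0 : (0 < n)%N by near: n; exists 1%N.
by rewrite /flat mulr_gt0 ?ltr0n//= hornerC mul1r.
Unshelve. all: by end_near. Qed.

Lemma smooth_bump (n a : R) : @smoothF R R (fun x => flat 1 (n * (x - a))).
Proof.
apply: (@smooth_flat R R 1 (fun x => n * (x - a)) (fun v => n * v)) => [x|x v].
  exact: differentiableM.
by apply: (@derive_affine _ _ _ (fun v => n * v)) => h {}x {}v; rewrite /GRing.scale/=; ring.
Qed.

Lemma smooth_bump_rV d (n a : R) (i : 'I_d) :
  @smoothF R 'rV[R]_d (fun x => flat 1 (n * (x ord0 i - a))).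
Proof.
apply: (@smooth_flat R 'rV[R]_d 1 (fun x => n * (x ord0 i - a))
  (fun v => n * v ord0 i)) => [x|x v].
  apply: differentiableM => //; apply: differentiableB => //.
  exact: differentiable_coord.
by apply: (@derive_affine _ _ _ (fun v : 'rV_d => n * v ord0 i)) => h {}x {}v; rewrite !mxE; ring.
Qed.

End bumps.

Section vanishing.
Context d (T : measurableType d) (R : realType).
Context (mu : {measure set T -> \bar R}) (D : set T).
Hypothesis mD : measurable D.

Lemma aeint_restrict (A : set T) (f : T -> R) : measurable A ->
  aeint mu D f -> aeint mu D (f \_ A).
Proof.
move=> mA fi; apply: (@aeint_dom _ _ _ _ _ mD _ (fun x => `|f x|)); last exact: aeint_norm.
  have -> : f \_ A = fun x => f x * \1_A x.
    by apply/funext => x; rewrite patchE indicE; case: ifP; rewrite ?mulr1 ?mulr0.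
  apply: aemeasM; first exact: aeint_meas fi.
  by apply: measurable_aemeas; exact: measurable_indic.
by apply: aeW => x _; rewrite patchE; case: ifP; rewrite ?normr0.
Qed.

(** The measurable sets whose intersection with [D] carries a zero integral of [f] form a
    lambda-system, so by the pi-lambda theorem they are all measurable sets. The integral over [D]
    itself is a separate premise because [G] need not contain the whole space. *)
Lemma pi_system_ae_eq0 (G : set (set T)) (f : T -> R) :
  setI_closed G -> measurable `<=` <<s G >> -> G `<=` measurable ->
  mu.-integrable D (EFin \o f) -> \int[mu]_(x in D) f x = 0 ->
  (forall A, G A -> \int[mu]_(x in D `&` A) f x = 0) ->
  {ae mu, forall x, D x -> f x = 0}.
Proof.
move=> GI sG mG fi If0 IfG.
pose H := [set A | measurable A /\ \int[mu]_(x in D `&` A) f x = 0].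
have fa := integrable_aeint fi.
have GH : measurable `<=` H.
  apply: subset_trans sG _; apply: lambda_system_subset => //; last first.
    by move=> A GA; split; [exact: mG|exact: IfG].
  split => //.
  - by split => //; rewrite setIT.
  - move=> A B BA [mA IA] [mB IB]; split; first exact: measurableD.
    have := @aeRintegral_setU _ _ _ mu (D `&` B) (D `&` (A `\` B)) f.
    rewrite -setIUr setDUK// IA IB add0r => <- //.
    + exact: measurableI.
    + by apply: measurableI => //; exact: measurableD.
    + by apply: (aeintS mD _ _ fa); [exact: measurableI|exact: subIsetl].
    + by apply/disj_setPS => x [[_ Bx] [_ []]].
  - move=> F ndF HF.
    have mF i : measurable (F i) by case: (HF i).
    split; first exact: bigcupT_measurable.
    rewrite Rintegral_mkcondr.
    have : (fun n => \int[mu]_(x in D) (f \_ (F n)) x) @ \oo -->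
        \int[mu]_(x in D) (f \_ (\bigcup_i F i)) x.
      apply: (@aeRintegral_cvg _ _ _ _ _ mD _ _ (fun x => `|f x|)); last exact: aeint_norm.
      + by move=> n; exact/(aeint_meas (aeint_restrict _ fa)).
      + apply: aeW => x _; apply: cvg_near_cst; rewrite patchE.
        case: ifPn => [|/negP UFx]; last first.
          near=> n; rewrite patchE ifF//; apply/negP => Fx; apply: UFx.
          by apply/mem_set; exists n => //; exact: set_mem.
        rewrite inE => -[k _ Fkx]; near=> n; rewrite patchE mem_set//.
        suff /subsetPset : (F k <= F n)%O by apply.
        by apply: ndF; near: n; exists k.
      + by move=> n; apply: aeW => x _; rewrite patchE; case: ifP; rewrite ?normr0.
    rewrite (_ : (fun n => _) = fun=> 0) => [/cvg_lim <-//|].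
      exact: lim_cst.
    by apply/funext => n; rewrite -Rintegral_mkcondr; case: (HF n).
have := @integral_ae_eq _ _ _ mu D mD (cst 0%E) (EFin \o f) fi.
move=> /(_ _ _)[]//.
  move=> E ED mE; rewrite integral0 -[LHS]fineK.
    by rewrite -/(Rintegral _ _ _) -(setIidr ED) (GH _ mE).2.
  by apply: integrable_fin_num => //; exact: integrableS fi.
by move=> N [mN N0 NP]; exists N; split=> // x /= fx; apply: NP => /= fx0;
  apply: fx => /fx0[].
Unshelve. all: by end_near. Qed.

End vanishing.

Lemma cvg_prod_seq (R : realType) (I : Type) (r : seq I) (f : I -> nat -> R)
    (l : I -> R) : (forall i, f i @ \oo --> l i) ->
  (fun n => \prod_(i <- r) f i n) @ \oo --> \prod_(i <- r) l i.
Proof.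
move=> fl; elim: r => [|i r IH].
  by rewrite big_nil; under eq_fun do rewrite big_nil; exact: cvg_cst.
by rewrite big_cons; under eq_fun do rewrite big_cons; exact: cvgM.
Qed.

(** * Boxes and Borel sets in R^d *)

Section rV_borel.
Context (R : realType) (d : nat).
Local Notation E := 'rV[R]_d.
Implicit Types (a b : 'I_d -> R) (U : set E).

Definition obox a b : set E := [set x | forall i, a i < x ord0 i < b i].
Definition cbox a b : set E := [set x | forall i, a i <= x ord0 i <= b i].
Definition orthant a : set E := [set x | forall i, a i < x ord0 i].

Lemma coord_set_measurable (P : 'I_d -> set R) : (forall i, measurable (P i)) ->
  measurable [set x : E | forall i, P i (x ord0 i)].
Proof.
move=> mP.
have -> : [set x : E | forall i, P i (x ord0 i)] =
    \big[setI/setT]_(i < d) ((fun x : E => x ord0 i) @^-1` (P i)).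
  apply/seteqP; split=> x; rewrite -bigcap_seq/=.
    by move=> Px i _; exact: Px.
  by move=> Px i; apply: Px; exact: mem_index_enum.
apply: big_ind => // [|i _]; first exact: measurableI.
by rewrite -[X in measurable X]setTI; exact: measurable_coord.
Qed.

Lemma measurable_obox a b : measurable (obox a b).
Proof.
have -> : obox a b = [set x | forall i, `]a i, b i[%classic (x ord0 i)].
  by apply/seteqP; split=> x /= xab i; have := xab i; rewrite in_itv.
by apply: (coord_set_measurable (P := fun i => `]a i, b i[%classic)).
Qed.

Lemma measurable_orthant a : measurable (orthant a).
Proof.
have -> : orthant a = [set x | forall i, `]a i, +oo[%classic (x ord0 i)].
  by apply/seteqP; split=> x /= xab i; have := xab i; rewrite in_itv/= andbT.
by apply: (coord_set_measurable (P := fun i => `]a i, +oo[%classic)).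
Qed.

Lemma cbox_compact a b : compact (cbox a b).
Proof.
have -> : cbox a b = [set x | forall i, `[a i, b i]%classic (x ord0 i)].
  by apply/seteqP; split=> x /= xab i; have := xab i; rewrite in_itv.
by apply: (@rV_compact R d (fun i => `[a i, b i]%classic)) => i;
  exact: segment_compact.
Qed.

Lemma measurable_sub_orthant :
  measurable `<=` <<s [set A | exists a, A = orthant a] >>.
Proof.
set G := [set A | exists a, A = orthant a].
apply: smallest_sub; first exact: smallest_sigma_algebra.
move=> A; rewrite -bigcup_seq => -[i _ [B mB <-]].
rewrite setTI.
suff : measurable_fun setT (fun x : g_sigma_algebraType G => (x : E) ord0 i).
  by move=> /(_ measurableT B mB); rewrite setTI.
apply: (measurability _ (RGenOInfty.measurableE R)) => _ [_ [c ->] <-].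
rewrite setTI.
(* The half-space where coordinate [i] exceeds [c] is the union over [n] of the orthants whose other
   corner coordinates are [-n]. *)
pose an n (j : 'I_d) : R := if j == i then c else - n%:R.
rewrite (_ : _ @^-1` _ = \bigcup_n orthant (an n)).
  apply: bigcupT_measurable => n; apply: sub_sigma_algebra.
  by exists (an n).
apply/seteqP; split=> x /=.
  rewrite in_itv/= andbT => cx.
  pose M := \sum_j `|x ord0 j|.
  exists (Num.truncn M).+1 => // j; rewrite /an; case: eqP => [->//|_].
  rewrite ltrNl (@le_lt_trans _ _ M) ?truncnS_gt//.
  rewrite (@le_trans _ _ `|x ord0 j|)//.
    by rewrite -normrN ler_norm.
  by rewrite /M (bigD1 j)//= lerDl sumr_ge0.
by move=> [n _ /(_ i)]; rewrite /an eqxx in_itv/= andbT.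
Qed.

(** The closed box has to lie in [U] so that bumps on the open box have compact support in [U];
    rational corners leave only countably many boxes. *)
Lemma box_nbhs U (x : E) : open U -> U x -> exists a b : 'rV[rat]_d,
  obox (fun i => ratr (a ord0 i)) (fun i => ratr (b ord0 i)) x /\
  cbox (fun i => ratr (a ord0 i)) (fun i => ratr (b ord0 i)) `<=` U.
Proof.
rewrite openE => oU /oU; rewrite /interior => /nbhs_ballP[e /= e0 xeU].
have [a aP] : exists a : 'rV[rat]_d, forall i,
    x ord0 i - e < ratr (a ord0 i) < x ord0 i.
  have ex (i : 'I_d) : exists q : rat, x ord0 i - e < ratr q < x ord0 i.
    have [|q] := @rat_in_itvoo R (x ord0 i - e) (x ord0 i).
      by rewrite ltrBlDr ltrDl.
    by rewrite in_itv/= => ?; exists q.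
  have [f fP] := choice ex.
  by exists (\row_i f i) => i; rewrite mxE.
have [b bP] : exists b : 'rV[rat]_d, forall i,
    x ord0 i < ratr (b ord0 i) < x ord0 i + e.
  have ex (i : 'I_d) : exists q : rat, x ord0 i < ratr q < x ord0 i + e.
    have [|q] := @rat_in_itvoo R (x ord0 i) (x ord0 i + e).
      by rewrite ltrDl.
    by rewrite in_itv/= => ?; exists q.
  have [f fP] := choice ex.
  by exists (\row_i f i) => i; rewrite mxE.
exists a, b; split.
  by move=> i; have /andP[_ ->] := aP i; have /andP[-> _] := bP i.
move=> y yab; apply: xeU; split=> // i j; rewrite (ord1 i).
rewrite /ball/= ltr_distlC.
have /andP[a1 _] := aP j; have /andP[_ b1] := bP j; have /andP[a2 b2] := yab j.
by rewrite (lt_le_trans a1)// (le_lt_trans b2).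
Qed.

Definition rat_boxes U := [set ab : 'rV[rat]_d * 'rV[rat]_d |
  cbox (fun i => ratr (ab.1 ord0 i)) (fun i => ratr (ab.2 ord0 i)) `<=` U].

Lemma open_bigcup_box U : open U -> U = \bigcup_(ab in rat_boxes U)
  obox (fun i => ratr (ab.1 ord0 i)) (fun i => ratr (ab.2 ord0 i)).
Proof.
move=> oU; apply/seteqP; split=> [x /(box_nbhs oU)[a [b [xab abU]]]|].
  by exists (a, b).
move=> x [ab abU xab]; apply: abU => i.
by have /andP[/ltW -> /ltW ->] := xab i.
Qed.

Lemma open_measurable_rV U : open U -> measurable U.
Proof.
move=> oU; rewrite (open_bigcup_box oU) bigcup_mkcond.
apply: countable_bigcupT_measurable => // ab.
by case: ifP => // _; exact: measurable_obox.
Qed.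

Lemma continuous_measurable_rV (f : E -> R) : continuous f ->
  measurable_fun setT f.
Proof.
move=> /continuousP cf.
apply: (measurability _ (RGenOInfty.measurableE R)) => _ [_ [c ->] <-].
by rewrite setTI; apply: open_measurable_rV; apply: cf; exact: interval_open.
Qed.

Lemma smoothF_smooth (f : E -> R) : smoothF f -> smooth f.
Proof.
move=> sf s.
have {sf} : smoothF (partials s f).
  by elim: s => //= i s IH; exact: (smoothF_diff IH).2.
move=> /smoothF_diff[df _]; split=> [x|i x]; first exact: differentiable_continuous.
exact: diff_derivable.
Qed.

End rV_borel.

Section fundamental_lemma_rV.
Context (R : realType) (d : nat).
Local Notation E := 'rV[R]_d.
Local Notation leb := (lebesgue_rV R d).
Context (Om : set E).
Hypothesis oOm : open Om.
Implicit Types (a b : 'I_d -> R) (f : E -> R).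

Definition box_bump a b (n : nat) (x : E) : R :=
  \prod_(i < d) (flat 1 (n%:R * (x ord0 i - a i)) *
                 flat 1 (- n%:R * (x ord0 i - b i))).

Lemma smooth_box_bump a b n : smoothF (box_bump a b n).
Proof.
apply: (@smoothF_prod R E _ _ (fun (i : 'I_d) (x : E) => flat 1 (n%:R * (x ord0 i - a i)) *
                 flat 1 (- n%:R * (x ord0 i - b i)))) => i.
exact: (smoothM (smooth_bump_rV _ _ _) (smooth_bump_rV _ _ _)).
Qed.

Lemma box_bump_bound a b n x : 0 <= box_bump a b n x <= 1.
Proof.
apply: (big_ind (fun y => 0 <= y <= 1)) => [|y z|i _]; first by rewrite ler01 lexx.
  move=> /andP[y0 y1] /andP[z0 z1].
  by rewrite mulr_ge0//= mulr_ile1.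
have /andP[y0 y1] := flat1_ge0 (n%:R * (x ord0 i - a i)).
have /andP[z0 z1] := flat1_ge0 (- n%:R * (x ord0 i - b i)).
by rewrite mulr_ge0//= mulr_ile1.
Qed.

Lemma box_bump_cvg a b x : box_bump a b ^~ x @ \oo --> (\1_(obox a b) x : R).
Proof.
have -> : \1_(obox a b) x = \prod_(i < d) (((0 < x ord0 i - a i)%R%:R : R) *
    (0 < b i - x ord0 i)%R%:R).
  rewrite indicE; have [|] := boolP (x \in obox a b).
    rewrite inE => xab; rewrite big1// => i _.
    by have := xab i; rewrite !subr_gt0 => /andP[-> ->]; rewrite mulr1.
  rewrite notin_setE => /existsNP[i /negP]; rewrite negb_and => xab.
  rewrite (bigD1 i)//= !subr_gt0.
  by case/orP: xab => /negbTE ->; rewrite ?mul0r ?mulr0 ?mul0r.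
apply: cvg_prod_seq => i; apply: cvgM; first exact: flat1_cvg.
under eq_fun do rewrite mulNr -mulrN opprB.
exact: flat1_cvg.
Qed.

Lemma box_bump_test a b n : (0 < n)%N -> cbox a b `<=` Om ->
  test_fun Om (box_bump a b n).
Proof.
move=> n0 abOm; split; first exact/smoothF_smooth/smooth_box_bump.
exists (cbox a b); split=> // [|x xab]; first exact: cbox_compact.
move: xab => /existsNP[i /negP]; rewrite negb_and -!ltNge => xi.
rewrite /box_bump (bigD1 i)//=; case/orP: xi => xi.
  by rewrite (flat1_neg (x := n%:R * _)) ?mul0r// mulr_ge0_le0// subr_le0 ltW.
rewrite (flat1_neg (x := - n%:R * _)) ?mulr0 ?mul0r//.
by rewrite mulNr oppr_le0 mulr_ge0// subr_ge0 ltW.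
Qed.

Lemma smoothF_continuous (V : normedModType R) (f : V -> R) : smoothF f -> continuous f.
Proof.
by move=> /smoothF_diff[df _] x; exact: differentiable_continuous.
Qed.

(** Products with bumps converge to the restriction of [f] to a box, so [f] has zero integral over
    every open box whose closed box lies in [Om]. A box meets an orthant in a box, hence the
    pi-lambda argument applies on each of them, and countably many rational boxes cover [Om]. *)
Lemma fundamental_lemma_rV f : leb.-integrable Om (EFin \o f) ->
  (forall phi, test_fun Om phi -> \int[leb]_(x in Om) (f x * phi x) = 0) ->
  {ae leb, forall x, Om x -> f x = 0}.
Proof.
move=> fi fphi; have mOm := open_measurable_rV oOm.
have fa := integrable_aeint fi.
have box0 a b : cbox a b `<=` Om -> \int[leb]_(x in obox a b) f x = 0.
  move=> abOm.
  have sub : obox a b `<=` Om.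
    by move=> x xab; apply: abOm => i; have /andP[/ltW -> /ltW ->] := xab i.
  rewrite -(setIidr sub) Rintegral_mkcondr.
  have : (fun n => \int[leb]_(x in Om) (f x * box_bump a b n.+1 x)) @ \oo -->
      \int[leb]_(x in Om) (f \_ (obox a b)) x.
    apply: (@aeRintegral_cvg _ _ _ _ _ mOm _ _ (fun x => `|f x|)).
    - move=> n; apply: aemeasM; first exact: aeint_meas fa.
      apply: measurable_aemeas; apply: measurable_funTS.
      apply: continuous_measurable_rV.
      exact/smoothF_continuous/smooth_box_bump.
    - apply: aeW => x _.
      have -> : (f \_ (obox a b)) x = f x * \1_(obox a b) x.
        by rewrite patchE indicE; case: ifP; rewrite ?mulr1 ?mulr0.
      apply: cvgM; first exact: cvg_cst.
      have := @box_bump_cvg a b x; rewrite -(cvg_shiftS (box_bump a b ^~ x)); exact.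
    - move=> n; apply: aeW => x _; rewrite normrM ler_piMr//.
      by have /andP[? ?] := box_bump_bound a b n.+1 x; rewrite ger0_norm.
    - exact: aeint_norm.
  rewrite (_ : (fun n => _) = fun=> 0) => [/cvg_lim <-//|]; first exact: lim_cst.
  by apply/funext => n; apply: fphi; exact: box_bump_test.
have key a b : cbox a b `<=` Om -> {ae leb, forall x, obox a b x -> f x = 0}.
  move=> abOm; have mab := measurable_obox a b.
  have sub : obox a b `<=` Om.
    by move=> x xab; apply: abOm => i; have /andP[/ltW -> /ltW ->] := xab i.
  apply: (pi_system_ae_eq0 mab (G := [set A | exists c, A = orthant c])).
  - move=> _ _ [c ->] [e ->]; exists (fun i => Num.max (c i) (e i)).
    apply/seteqP; split=> x /=; first by move=> [xc xe] i; rewrite gt_max xc xe.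
    by move=> xce; split=> i; have := xce i; rewrite gt_max => /andP[].
  - exact: measurable_sub_orthant.
  - by move=> _ [c ->]; exact: measurable_orthant.
  - exact: integrableS fi.
  - exact: box0.
  - move=> _ [c ->].
    have -> : obox a b `&` orthant c = obox (fun i => Num.max (a i) (c i)) b.
      apply/seteqP; split=> x /=.
        by move=> [xab xc] i; rewrite gt_max xc; have /andP[-> ->] := xab i.
      by move=> xab; split=> i; have := xab i; rewrite gt_max => /andP[/andP[p q] r]; rewrite ?p.
    apply: box0 => x xab; apply: abOm => i.
    by have := xab i; rewrite ge_max => /andP[/andP[-> _] ->].
(* Pairs of rational corners are enumerated by [unpickle], so that the exceptional null sets are
   indexed by naturals; a number that encodes no pair gives the premise [False]. *)
have all n : {ae leb, forall x, oapp (fun ab => rat_boxes Om ab /\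
    obox (fun i => ratr (ab.1 ord0 i)) (fun i => ratr (ab.2 ord0 i)) x) False
    (unpickle n) -> f x = 0}.
  case: unpickle => [ab|] /=; last by apply: aeW.
  have [/key|nab] := pselect (rat_boxes Om ab).
    by apply: filterS => x + [_]; apply.
  by apply: aeW => x [].
apply: filterS (ae_foralln all) => x fx0 Ox.
have [a [b [xab abOm]]] := box_nbhs oOm Ox.
by apply: (fx0 (pickle (a, b))); rewrite pickleK.
Qed.

End fundamental_lemma_rV.

Section fundamental_lemma_time.
Context (R : realType).
Local Notation mu := (@lebesgue_measure R).
Implicit Types (a b : R) (f : R -> R).

Lemma smoothF_derive1n (f : R -> R) n : smoothF f -> smoothF (derive1n n f).
Proof.
move=> sf; elim: n => [|n IH]; first by rewrite derive1n0.
rewrite derive1nS (_ : derive1 _ = 'D_1 (derive1n n f)).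
  exact: (smoothF_diff IH).2.
by apply/funext => t; rewrite derive1E.
Qed.

Definition itv_bump a b (n : nat) (t : R) : R :=
  flat 1 (n%:R * (t - a)) * flat 1 (- n%:R * (t - b)).

Lemma smooth_itv_bump a b n : smoothF (itv_bump a b n).
Proof. exact: (smoothM (smooth_bump _ _) (smooth_bump _ _)). Qed.

Lemma itv_bump_bound a b n t : 0 <= itv_bump a b n t <= 1.
Proof.
have /andP[y0 y1] := flat1_ge0 (n%:R * (t - a)).
have /andP[z0 z1] := flat1_ge0 (- n%:R * (t - b)).
by rewrite mulr_ge0//= mulr_ile1.
Qed.

Lemma itv_bump_cvg a b t : itv_bump a b ^~ t @ \oo --> (\1_`]a, b[%classic t : R).
Proof.
have -> : \1_`]a, b[%classic t = (0 < t - a)%R%:R * (0 < b - t)%R%:R :> R.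
  by rewrite indicE !subr_gt0 mem_setE in_itv/=; case: (a < t); case: (t < b);
    rewrite ?mul0r ?mulr0 ?mulr1.
apply: cvgM; first exact: flat1_cvg.
under eq_fun do rewrite mulNr -mulrN opprB.
exact: flat1_cvg.
Qed.

Lemma itv_bump_test a b a' b' n : (0 < n)%N -> a < a' -> b' < b ->
  test_fun_time a b (itv_bump a' b' n).
Proof.
move=> n0 aa' bb'; split.
  move=> m t; apply: diff_derivable.
  exact: (smoothF_diff (smoothF_derive1n m (smooth_itv_bump _ _ _))).1.
exists `[a', b']%classic; split; first exact: segment_compact.
  move=> t /=; rewrite !in_itv/= => /andP[at' tb'].
  by rewrite (lt_le_trans aa')// (le_lt_trans tb').
move=> t /negP; rewrite in_itv/= negb_and -!ltNge /itv_bump => /orP[] tt.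
  by rewrite (flat1_neg (x := n%:R * _)) ?mul0r// mulr_ge0_le0// subr_le0 ltW.
rewrite (flat1_neg (x := - n%:R * _)) ?mulr0 ?mul0r//.
by rewrite mulNr oppr_le0 mulr_ge0// subr_ge0 ltW.
Qed.

Lemma fundamental_lemma_time a b f : mu.-integrable `]a, b[%classic (EFin \o f) ->
  (forall phi, test_fun_time a b phi ->
    \int[mu]_(t in `]a, b[) (phi t * f t) = 0) ->
  {ae mu, forall t, a < t < b -> f t = 0}.
Proof.
move=> fi fphi; have fa := integrable_aeint fi.
have mI a' b' : measurable (`]a', b'[%classic : set R) by exact: measurable_itv.
have sub a' b' : a < a' -> b' < b -> `]a', b'[%classic `<=` `]a, b[%classic.
  move=> aa' bb' t /=; rewrite !in_itv/= => /andP[at' tb'].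
  by rewrite (lt_trans aa')// (lt_trans tb').
have itv0 a' b' : a < a' -> b' < b -> \int[mu]_(t in `]a', b'[) f t = 0.
  move=> aa' bb'; rewrite -(setIidr (sub _ _ aa' bb')) Rintegral_mkcondr.
  have : (fun n => \int[mu]_(t in `]a, b[) (itv_bump a' b' n.+1 t * f t)) @ \oo -->
      \int[mu]_(t in `]a, b[) (f \_ `]a', b'[%classic) t.
    apply: (@aeRintegral_cvg _ _ _ mu _ (mI a b) _ _ (fun x => `|f x|)).
    - move=> n; apply: aemeasM; last exact: aeint_meas fa.
      apply: measurable_aemeas; apply: measurable_funTS.
      apply: continuous_measurable_fun.
      exact/smoothF_continuous/smooth_itv_bump.
    - apply: aeW => x _.
      have -> : (f \_ `]a', b'[%classic) x = \1_`]a', b'[%classic x * f x.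
        by rewrite patchE indicE; case: ifP; rewrite ?mul1r ?mul0r.
      apply: cvgM; last exact: cvg_cst.
      have := @itv_bump_cvg a' b' x; rewrite -(cvg_shiftS (itv_bump a' b' ^~ x)); exact.
    - move=> n; apply: aeW => x _; rewrite normrM ler_piMl//.
      by have /andP[? ?] := itv_bump_bound a' b' n.+1 x; rewrite ger0_norm.
    - exact: aeint_norm.
  rewrite (_ : (fun n => _) = fun=> 0) => [/cvg_lim <-//|]; first exact: lim_cst.
  by apply/funext => n; apply: fphi; exact: itv_bump_test.
have key a' b' : a < a' -> b' < b ->
    {ae mu, forall t, `]a', b'[%classic t -> f t = 0}.
  move=> aa' bb'.
  apply: (@pi_system_ae_eq0 _ _ _ mu _ (mI a' b') (@RGenOInfty.G R)).
  - move=> _ _ [c ->] [e ->]; exists (Num.max c e).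
    by apply/seteqP; split=> x /=; rewrite !in_itv/= !andbT gt_max => /andP.
  - move=> A mA; change ((@RGenOInfty.G R).-sigma.-measurable A).
    by rewrite -RGenOInfty.measurableE.
  - by move=> _ [c ->]; exact: measurable_itv.
  - by apply: integrableS fi => //; exact: sub.
  - exact: itv0.
  - move=> _ [c ->].
    have -> : `]a', b'[%classic `&` `]c, +oo[%classic = `]Num.max a' c, b'[%classic.
      by apply/seteqP; split=> x /=; rewrite !in_itv/= gt_max andbT;
        [move=> [/andP[-> ->] ->]|move=> /andP[/andP[-> ->] ->]].
    by apply: itv0 => //; rewrite lt_max aa'.
(* Bumps are test functions only on intervals that stay away from [a] and [b], so the interval is
   exhausted from inside. *)
have all n : {ae mu, forall t, `]a + n.+1%:R^-1, b - n.+1%:R^-1[%classic t -> f t = 0}.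
  by apply: key; rewrite ?ltrDl ?gtrDl ?oppr_lt0 invr_gt0.
apply: filterS (ae_foralln all) => t ft /andP[at' tb].
pose e := Num.min (t - a) (b - t).
have e0 : 0 < e by rewrite lt_min !subr_gt0 at'.
apply: (ft (Num.truncn e^-1)).
have : (Num.truncn e^-1).+1%:R^-1 < e.
  by rewrite invf_plt ?posrE// truncnS_gt.
move: (_.+1%:R^-1) => c; rewrite lt_min /= in_itv/= => /andP[h1 h2].
by apply/andP; split; lra.
Qed.

End fundamental_lemma_time.

(** * Integrals of partial derivatives of compactly supported functions *)

Lemma continuous_is_derive_FTC (R : realType) (a b : R) (f F : R -> R) : a < b ->
  continuous f -> (forall t : R, is_derive t (1 : R) F (f t)) ->
  (\int[lebesgue_measure]_(t in `[a, b]) (f t)%:E)%E = (F b - F a)%:E.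
Proof.
move=> ab cf dF.
have cF t : F x @[x --> t] --> F t.
  apply: (@differentiable_continuous _ _ _ t F).
  by apply/derivable1_diffP; case: (dF t).
rewrite (continuous_FTC2 ab (F := F))//.
- exact: continuous_subspaceT.
- split=> [t _||]; first by case: (dF t).
  + exact: cvg_at_right_filter (cF a).
  + exact: cvg_at_left_filter (cF b).
- by move=> t _; rewrite derive1E; case: (dF t).
Qed.

(** Along an affine slice [r] the difference quotients of [f \o r] and of [f] are the same
    expression, so no chain rule is involved. *)
Lemma is_derive_pullback (R : realType) (V W : normedModType R) (r : V -> W)
    (v x : V) (w : W) (f : W -> R) (df : R) :
  (forall h : R, r (h *: v + x) = h *: w + r x) ->
  is_derive (r x) w f df -> is_derive x v (f \o r) df.
Proof.
move=> rE [fw fdf].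
have E : (fun h : R => h^-1 *: (((f \o r) \o shift x) (h *: v) - (f \o r) x)) =
    (fun h : R => h^-1 *: ((f \o shift (r x)) (h *: w) - f (r x))).
  by apply/funext => h /=; rewrite rE.
by apply: DeriveDef; rewrite ?/derivable ?/derive E.
Qed.

Lemma measurable_cbox (R : realType) d (a b : 'I_d -> R) : measurable (cbox a b).
Proof.
have -> : cbox a b = [set x | forall i, `[a i, b i]%classic (x ord0 i)].
  by apply/seteqP; split=> x /= xab i; have := xab i; rewrite in_itv.
by apply: (coord_set_measurable (P := fun i => `[a i, b i]%classic)).
Qed.

Section integral_partial.
Context (R : realType).
Local Notation mu := (@lebesgue_measure R).
Local Notation leb := (lebesgue_rV R).

Lemma rV_cons_continuousl n (v : 'rV[R]_n) : continuous (fun x => rV_cons (x, v)).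
Proof.
move=> x; apply/cvg_ballP => e e0; near=> z.
have xz : ball x e z by near: z; exact: (nbhsx_ballx x e e0).
split=> // i j; rewrite (ord1 i) !mxE /=.
by case: (unlift ord0 j) => [k|//] /=; exact: ballxx.
Unshelve. all: by end_near. Qed.

Lemma rV_cons_continuousr n (x : R) : continuous (fun v : 'rV[R]_n => rV_cons (x, v)).
Proof.
move=> v A /nbhs_ballP[e /= e0 eA].
apply: filterS (nbhsx_ballx (v : 'rV[R]_n) e e0) => z [_ xz]; apply: eA.
split=> // i j; rewrite (ord1 i) !mxE /=.
by case: (unlift ord0 j) => [k|] /=; [exact: xz|exact: ballxx].
Qed.

Lemma rV_cons_shift0 n (h x : R) (v : 'rV[R]_n) :
  rV_cons (h + x, v) = h *: delta_mx ord0 ord0 + rV_cons (x, v).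
Proof.
apply/rowP => i; rewrite !mxE /=.
by case: unliftP => [j ->|->] /=; rewrite ?mulr1 ?mulr0 ?add0r.
Qed.

Lemma rV_cons_shift n (h x : R) (v : 'rV[R]_n) (j : 'I_n) :
  rV_cons (x, h *: delta_mx ord0 j + v) =
  h *: delta_mx ord0 (lift ord0 j) + rV_cons (x, v).
Proof.
apply/rowP => i; rewrite !mxE /=.
case: unliftP => [k ->|->] /=.
  by rewrite !mxE (inj_eq lift_inj).
by rewrite mulr0 add0r.
Qed.

Definition cube n (M : R) : set 'rV[R]_n := cbox (fun=> - M) (fun=> M).

Lemma cube_finite n M : (leb n (@cube n M) < +oo)%E.
Proof.
elim: n => [|n IH] /=.
  by rewrite diracE; case: (_ \in _); rewrite ltry.
rewrite /lebesgue_step /pushforward.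
have -> : @rV_cons R n @^-1` @cube n.+1 M = `[- M, M]%classic `*` @cube n M.
  apply/seteqP; split=> -[x v] /=.
    move=> xv; split=> [|i] /=.
      by have := xv ord0; rewrite mxE unlift_none/= in_itv.
    by have := xv (lift ord0 i); rewrite mxE liftK.
  move=> [xM vM] i; rewrite mxE; case: unliftP => [j _|_] /=.
    exact: vM.
  by move: xM; rewrite in_itv.
rewrite product_measure1E//; last exact: measurable_cbox.
have mM : (mu (`[(- M)%R, M%R]%classic : set R) < +oo)%E.
  by rewrite lebesgue_measure_itv/=; case: ifP; rewrite ?ltry.
apply: lte_mul_pinfty => //.
rewrite ge0_fin_numE; last exact: measure_ge0.
exact: mM.
Qed.

Lemma bounded_cube_integrable n M (psi : 'rV[R]_n -> R) : continuous psi ->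
  (forall x, ~ @cube n M x -> psi x = 0) -> (leb n).-integrable setT (EFin \o psi).
Proof.
move=> cpsi psi0.
have mc : measurable (@cube n M) by exact: measurable_cbox.
have -> : EFin \o psi = (EFin \o psi) \_ (@cube n M).
  apply/funext => x; rewrite patchE; case: ifPn => //.
  by rewrite notin_setE => /psi0 /= ->.
apply/(integrable_restrict _ mc) => //; rewrite setTI.
apply: measurable_bounded_integrable => //.
- exact: cube_finite.
- by apply: measurable_funTS; exact: continuous_measurable_rV.
have : compact (psi @` @cube n M).
  apply: continuous_compact; first exact: continuous_subspaceT.
  exact: cbox_compact.
move=> /compact_bounded[K [Kr HK]]; exists K; split=> // N KN x xc /=.
by apply: HK => //; exists x.
Qed.

Definition prod_leb n : {measure set (measurableTypeR R * 'rV[R]_n)%type -> \bar R} :=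
  (mu \x leb n)%E.

Lemma integral_rV_cons n (f : 'rV[R]_n.+1 -> \bar R) :
  measurable_fun setT f ->
  (mu \x leb n)%E.-integrable setT (f \o @rV_cons R n) ->
  (\int[leb n.+1]_x f x = \int[mu \x leb n]_z f (rV_cons z))%E.
Proof.
move=> mf fi.
have := @integral_pushforward _ _ (measurableTypeR R * 'rV[R]_n)%type _ R
  _ (@measurable_rV_cons R n) (prod_leb n) setT _ mf.
by rewrite preimage_setT; apply.
Qed.

(** Induction on the dimension with Fubini's theorem: along the first coordinate the fundamental
    theorem leaves boundary values of [phi], which vanish; a derivative in another coordinate is one
    within the slice. The derivative is a function [psi] of its own so that all premises pass to
    slices. *)
Lemma integral_partial0 n M (phi psi : 'rV[R]_n -> R) (i : 'I_n) :
  continuous psi -> (forall x, is_derive x (delta_mx ord0 i) phi (psi x)) ->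
  (forall x, ~ @cube n M x -> phi x = 0) ->
  (forall x, ~ @cube n M x -> psi x = 0) ->
  (\int[leb n]_x (psi x)%:E = 0)%E.
Proof.
elim: n => [|n IH] in phi psi i *; first by case: i.
move=> cpsi dphi phi0 psi0.
have mpsi : measurable_fun setT (EFin \o psi).
  by apply/measurable_EFinP; exact: continuous_measurable_rV.
have ci : (mu \x leb n)%E.-integrable setT ((EFin \o psi) \o @rV_cons R n).
  have := bounded_cube_integrable cpsi psi0.
  move=> /integrableP[_ /= fi]; apply/integrableP; split.
    by apply: measurableT_comp => //; exact: measurable_rV_cons.
  move: fi; rewrite -[X in (X < _)%E]/(integral (pushforward (mu \x leb n)%E
    (@rV_cons R n)) setT (fun x => `|(psi x)%:E|%E)).
  have := @ge0_integral_pushforward _ _ (measurableTypeR R * 'rV[R]_n)%type _ R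
    _ (@measurable_rV_cons R n) (prod_leb n) setT _ measurableT (measurableT_comp
      (@abse_measurable R setT) mpsi).
  rewrite preimage_setT => <-; last by move=> x _; exact: abse_ge0.
  by [].
rewrite integral_rV_cons//.
case: (unliftP ord0 i) dphi => [j ->|->] dphi.
- rewrite -(integral12_prod_meas1 ci) integral0_eq// => x _.
  rewrite /fubini_F /=; apply: (IH (phi \o (fun v => rV_cons (x, v)))
    (psi \o (fun v => rV_cons (x, v))) j).
  + move=> v; apply: (@continuous_comp _ _ _ (fun v => rV_cons (x, v)) psi);
      last exact: cpsi.
    exact: rV_cons_continuousr.
  + move=> v; apply: (is_derive_pullback (r := fun v => rV_cons (x, v))) => //.
    by move=> h; rewrite rV_cons_shift.
  + move=> v vM /=; apply: phi0 => xM; apply: vM => k.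
    by have := xM (lift ord0 k); rewrite mxE liftK.
  + move=> v vM /=; apply: psi0 => xM; apply: vM => k.
    by have := xM (lift ord0 k); rewrite mxE liftK.
- rewrite -(integral21_prod_meas1 ci) integral0_eq// => v _.
  (* [K] is positive and exceeds [M], so [phi] vanishes at both ends of [[-K, K]] and [psi] outside
     of it. *)
  rewrite /fubini_G /=; pose K : R := `|M| + 1.
  have KM : M < K by rewrite (le_lt_trans (ler_norm _))// ltrDl.
  have K0 : - K < K by rewrite gt0_cp// ltr_wpDl.
  have out x : M < `|x| -> ~ cube (n := n.+1) M (rV_cons (x, v)).
    move=> Mx /(_ ord0); rewrite mxE unlift_none/=.
    by rewrite -ler_norml leNgt Mx.
  have -> : (\int[mu]_x (psi (rV_cons (x, v)))%:E =
      \int[mu]_(x in `[(- K)%R, K%R]) (psi (rV_cons (x, v)))%:E)%E.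
    rewrite [RHS]integral_mkcond; apply: eq_integral => x _.
    rewrite patchE; case: ifPn => //; rewrite mem_setE in_itv/= -ler_norml -ltNge.
    by move=> Kx; rewrite psi0//; apply: out; exact: lt_trans Kx.
  have out' x : `|x| = K -> phi (rV_cons (x, v)) = 0.
    by move=> xK; apply: phi0; apply: out; rewrite xK.
  have K00 : 0 <= K by rewrite addr_ge0.
  have cs : continuous (fun x : R => psi (rV_cons (x, v))).
    move=> x; apply: (@continuous_comp _ _ _ (fun x => rV_cons (x, v)) psi);
      last exact: cpsi.
    exact: rV_cons_continuousl.
  have ds (x : R) : is_derive x (1 : R) (fun x => phi (rV_cons (x, v)))
      (psi (rV_cons (x, v))).
    apply: (is_derive_pullback (r := fun x => rV_cons (x, v))
      (w := delta_mx ord0 ord0)) => //.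
    by move=> h; rewrite -rV_cons_shift0 /GRing.scale/= mulr1.
  rewrite (continuous_is_derive_FTC K0 cs ds) !out' ?subrr// ?normrN ger0_norm//.
Qed.

End integral_partial.

(** * Seminormed spaces and square integrable functions *)

Section semi_inner_product.
Context (R : realType) (V : lmodType R).

(** Spaces are predicates on a type of functions, so the axioms bind members only. Functions that
    agree almost everywhere are at distance 0, which is why a seminorm is the right notion. *)
Record seminormed (P : V -> Prop) (nrm : V -> R) : Prop := Seminormed {
  smD : forall v w, P v -> P w -> P (v + w);
  smZ : forall c v, P v -> P (c *: v);
  sm_ge0 : forall v, P v -> 0 <= nrm v;
  sm_nrmD : forall v w, P v -> P w -> nrm (v + w) <= nrm v + nrm w;
  sm_nrmZ : forall c v, P v -> nrm (c *: v) = `|c| * nrm v }.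

Section seminormed_theory.
Context (P : V -> Prop) (nrm : V -> R).
Hypothesis sm : seminormed P nrm.

Lemma smN v : P v -> P (- v).
Proof. by move=> Pv; rewrite -scaleN1r; exact: (smZ sm). Qed.

Lemma smB v w : P v -> P w -> P (v - w).
Proof. by move=> Pv Pw; apply: (smD sm) => //; exact: smN. Qed.

Lemma sm_nrmN v : P v -> nrm (- v) = nrm v.
Proof. by move=> Pv; rewrite -scaleN1r (sm_nrmZ sm)// normrN1 mul1r. Qed.

Lemma sm_nrmB v w : P v -> P w -> nrm (v - w) <= nrm v + nrm w.
Proof.
move=> Pv Pw; rewrite -(sm_nrmN Pw); apply: (sm_nrmD sm) => //; exact: smN.
Qed.

Lemma sm_nrmC v w : P v -> P w -> nrm (v - w) = nrm (w - v).
Proof. by move=> Pv Pw; rewrite -opprB sm_nrmN//; exact: smB. Qed.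

Lemma sm_nrmBB v w : P v -> P w -> `|nrm v - nrm w| <= nrm (v - w).
Proof.
move=> Pv Pw; have h1 : nrm v <= nrm (v - w) + nrm w.
  by rewrite -{1}(subrK w v); apply: (sm_nrmD sm) => //; exact: smB.
have h2 : nrm w <= nrm (v - w) + nrm v.
  rewrite -{1}(subrK v w) (sm_nrmC Pv Pw); apply: (sm_nrmD sm) => //; exact: smB.
by rewrite ler_norml; apply/andP; split; lra.
Qed.

End seminormed_theory.

Record semi_ip (P : V -> Prop) (B : V -> V -> R) : Prop := SemiIp {
  sipPD : forall v w, P v -> P w -> P (v + w);
  sipPZ : forall c v, P v -> P (c *: v);
  sipC : forall v w, B v w = B w v;
  sipD : forall u v w, P u -> P v -> P w -> B (u + v) w = B u w + B v w;
  sipZ : forall c v w, P v -> P w -> B (c *: v) w = c * B v w;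
  sip_ge0 : forall v, P v -> 0 <= B v v }.

Section semi_ip_theory.
Context (P : V -> Prop) (B : V -> V -> R).
Hypothesis sip : semi_ip P B.

Let PD := sipPD sip.
Let PZ := sipPZ sip.

Lemma sip_quad a b v w : P v -> P w ->
  B (a *: v + b *: w) (a *: v + b *: w) =
  a ^+ 2 * B v v + 2 * a * b * B v w + b ^+ 2 * B w w.
Proof.
move=> Pv Pw; rewrite (sipD sip) ?(sipC sip _ (_ + _)) ?(sipD sip); try by auto.
rewrite !(sipZ sip, sipC sip _ (_ *: _)); try by auto.
by rewrite (sipC sip w v); ring.
Qed.

Lemma sip_CS v w : P v -> P w ->
  `|B v w| <= Num.sqrt (B v v) * Num.sqrt (B w w).
Proof.
move=> Pv Pw; have vv := sip_ge0 sip Pv; have ww := sip_ge0 sip Pw.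
rewrite -sqrtrM// -sqrtr_sqr ler_sqrt ?mulr_ge0//.
have [w0|w0] := eqVneq (B w w) 0.
  suff -> : B v w = 0 by rewrite expr0n/= mulr_ge0.
  apply/eqP; apply: contraT => vw0.
  (* If [B w w = 0] and [B v w] were nonzero, [v] plus this multiple of [w] would give the form the
     value -1. *)
  have := sip_ge0 sip (PD (PZ 1 Pv) (PZ (- (B v v + 1) / (2 * B v w)) Pw)).
  rewrite sip_quad// w0 mulr0 addr0 expr1n mul1r mulr1.
  have -> : 2 * (- (B v v + 1) / (2 * B v w)) * B v w = - (B v v + 1) by field.
  by move=> h; exfalso; lra.
have wp : 0 < B w w by rewrite lt_neqAle eq_sym w0.
(* The vector [B w w *: v - B v w *: w] is the component of [v] orthogonal to [w], scaled by [B w w]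
   to avoid a division. *)
have := sip_ge0 sip (PD (PZ (B w w) Pv) (PZ (- B v w) Pw)).
rewrite sip_quad// => h.
have : 0 <= B w w * (B v v * B w w - B v w ^+ 2).
  by apply: le_trans h _; rewrite le_eqVlt; apply/orP; left; apply/eqP; ring.
by rewrite pmulr_rge0// subr_ge0.
Qed.

Lemma sip_seminormed : seminormed P (fun v => Num.sqrt (B v v)).
Proof.
split; [exact: PD|exact: PZ|..].
- by move=> v _; exact: sqrtr_ge0.
- move=> v w Pv Pw.
  have vv := sip_ge0 sip Pv; have ww := sip_ge0 sip Pw.
  rewrite -[leRHS]ger0_norm ?addr_ge0 ?sqrtr_ge0// -sqrtr_sqr.
  have := sip_ge0 sip (PD Pv Pw).
  rewrite -{1 2}(scale1r v) -{1 2}(scale1r w) => h.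
  rewrite ler_sqrt ?sqr_ge0// sqrrD !sqr_sqrtr//.
  rewrite -{1 2}(scale1r v) -{1 2}(scale1r w) sip_quad// !expr1n !mul1r !mulr1.
  have := le_trans (ler_norm _) (sip_CS Pv Pw); rewrite mulr2n; lra.
- move=> c v Pv; rewrite (sipZ sip) ?(sipC sip _ (_ *: _)) ?(sipZ sip); try by auto.
  by rewrite mulrA -expr2 sqrtrM ?sqr_ge0// sqrtr_sqr.
Qed.

End semi_ip_theory.
End semi_inner_product.

Lemma finite_integrable_cst d (T : measurableType d) (R : realType)
    (mu : {measure set T -> \bar R}) (D : set T) (c : R) :
  measurable D -> (mu D < +oo)%E -> mu.-integrable D (fun=> c%:E).
Proof.
move=> mD fD; apply: (measurable_bounded_integrable (f := fun=> c)) => //.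
by exists `|c|; split=> // M cM x _ /=; exact: ltW.
Qed.

Section square_integrable.
Context d (T : measurableType d) (R : realType).
Context (mu : {measure set T -> \bar R}) (D : set T).
Hypothesis mD : measurable D.
Implicit Types (f g : T -> R).

(** Measurability is asked of [f] itself because it cannot be recovered from the square. *)
Definition sqint f := aemeas mu D f /\ aeint mu D (fun x => f x ^+ 2).

Lemma sqint_mul f g : sqint f -> sqint g -> aeint mu D (fun x => f x * g x).
Proof.
move=> [mf f2] [mg g2].
apply: (@aeint_dom _ _ _ mu _ mD _ (fun x => f x ^+ 2 + g x ^+ 2)).
- exact: aemeasM.
- apply: aeW => x _; rewrite normrM.
  have := sqr_ge0 (`|f x| - `|g x|).
  rewrite -(real_normK (num_real (f x))) -(real_normK (num_real (g x))).
  have := normr_ge0 (f x); have := normr_ge0 (g x).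
  have := mulr_ge0 (normr_ge0 (f x)) (normr_ge0 (g x)).
  by move: `|f x| `|g x| => a b; rewrite sqrrB; lra.
- exact: aeintD.
Qed.

Lemma sqintD f g : sqint f -> sqint g -> sqint (fun x => f x + g x).
Proof.
move=> sf sg; split; first by apply: aemeasD; [case: sf|case: sg].
rewrite (_ : (fun x => _) = fun x => f x ^+ 2 + 2 * (f x * g x) + g x ^+ 2).
  apply: aeintD => //; last by case: sg.
  apply: aeintD => //; first by case: sf.
  by apply: aeintZ => //; exact: sqint_mul.
by apply/funext => x; ring.
Qed.

Lemma sqintZ (c : R) f : sqint f -> sqint (fun x => c * f x).
Proof.
move=> [mf f2]; split.
  by apply: aemeasM => //; apply: measurable_aemeas; exact: measurable_cst.
under eq_fun do rewrite exprMn.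
exact: aeintZ.
Qed.

Lemma integrable_sqr_sqint f : measurable_fun D f ->
  mu.-integrable D (fun x => (f x ^+ 2)%:E) -> sqint f.
Proof.
by move=> mf fi; split; [exact: measurable_aemeas|exact: integrable_aeint].
Qed.

Lemma sqint_cst (c : R) : (mu D < +oo)%E -> sqint (fun=> c).
Proof.
move=> fD; apply: integrable_sqr_sqint; first exact: measurable_cst.
exact: finite_integrable_cst.
Qed.

Lemma sqint_aeint f : (mu D < +oo)%E -> sqint f -> aeint mu D f.
Proof.
move=> fD /sqint_mul /(_ (sqint_cst 1 fD)).
by under eq_fun do rewrite mulr1.
Qed.

End square_integrable.

Section L2_Om.
Context (R : realType) (d : nat).
Local Notation E := 'rV[R]_d.
Local Notation leb := (lebesgue_rV R d).
Context (Om : set E).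
Hypothesis oOm : open Om.
Hypothesis bOm : bounded_set Om.
Implicit Types (v w : E -> R).

Let mOm := open_measurable_rV oOm.

Lemma bounded_sub_cube (A : set E) : bounded_set A ->
  exists M, A `<=` @cube R d M.
Proof.
move=> [M [Mr MA]]; exists (M + 2) => x Ax i.
(* [bounded_set] bounds the norm by every number above [M], and the open ball from which the
   coordinates are read off costs another 1. *)
have := MA (M + 1) _ x Ax; rewrite ltrDl ltr01 => /(_ isT) xM.
have : ball (0 : E) (`|x| + 1) x.
  by rewrite mx_norm_ball /ball_ /= sub0r normrN ltrDl.
move=> [_ /(_ ord0 i)]; rewrite mxE /ball /= sub0r normrN => xi.
rewrite -ler_norml (le_trans (ltW xi))//.
have -> : M + 2 = (M + 1) + 1 by rewrite -addrA.
by rewrite lerD2r.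
Qed.

Lemma finite_Om : (leb Om < +oo)%E.
Proof.
have [M OM] := bounded_sub_cube bOm.
apply: le_lt_trans (@cube_finite R d M).
by apply: le_measure; rewrite ?inE//; exact: measurable_cbox.
Qed.

Lemma L2_sqint v : L2 Om v -> sqint leb Om v.
Proof. by move=> [mv vi]; exact: integrable_sqr_sqint. Qed.

Lemma L2_mul v w : L2 Om v -> L2 Om w -> leb.-integrable Om (EFin \o (fun x => v x * w x)).
Proof.
move=> Lv Lw; have [g ig gE] := sqint_mul mOm (L2_sqint Lv) (L2_sqint Lw).
apply/integrableP; split.
  by apply/measurable_EFinP; apply: measurable_funM; [case: Lv|case: Lw].
have /integrableP[_] := ig; congr (_ < _)%E.
by apply: ae_integral => //; apply: filterS gE => x + Ox => /= ->.
Qed.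

Lemma L2_semi_ip : semi_ip (L2 Om) (ip Om).
Proof.
split.
- move=> v w Lv Lw; split.
    by apply: measurable_funD; [case: Lv|case: Lw].
  have [_ vi] := Lv; have [_ wi] := Lw; have vw := L2_mul Lv Lw.
  have := integrableD mOm (integrableD mOm vi (integrableZl mOm 2 vw)) wi.
  apply: eq_integrable => // x _ /=; rewrite -EFinM -!EFinD; congr EFin.
  by rewrite addrfctE; ring.
- move=> c v [mv vi]; split; first exact: measurable_funM.
  have := integrableZl mOm (c ^+ 2) vi.
  apply: eq_integrable => // x _ /=; rewrite -EFinM; congr EFin.
  by rewrite scalrfctE exprMn.
- by move=> v w; rewrite /ip; under eq_Rintegral do rewrite mulrC.
- move=> u v w Lu Lv Lw; rewrite /ip -RintegralD//; [|exact: L2_mul..].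
  by apply: eq_Rintegral => x _; rewrite -mulrDl.
- move=> c v w Lv Lw; rewrite /ip -RintegralZl//; last exact: L2_mul.
  by apply: eq_Rintegral => x _; rewrite mulrA.
- by move=> v Lv; apply: Rintegral_ge0 => x _; rewrite -expr2 sqr_ge0.
Qed.

Lemma L2_integrable v : L2 Om v -> leb.-integrable Om (EFin \o v).
Proof.
move=> Lv; have L1 : L2 Om (fun=> 1).
  split; first exact: measurable_cst.
  exact: (finite_integrable_cst _ mOm finite_Om).
have := L2_mul Lv L1; apply: eq_integrable => // x _ /=.
by rewrite mulr1.
Qed.

Lemma continuous_L2 v M : continuous v -> (forall x, ~ @cube R d M x -> v x = 0) ->
  L2 Om v.
Proof.
move=> cv v0; split; first by apply: measurable_funTS; exact: continuous_measurable_rV.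
apply: (integrableS measurableT mOm) => //.
apply: (@bounded_cube_integrable _ _ M (fun x => v x ^+ 2)).
  by move=> x; apply: (@continuous_comp _ _ _ v (fun t => t ^+ 2));
    [exact: cv|exact: exprn_continuous].
by move=> x /v0 ->; rewrite expr0n.
Qed.

End L2_Om.

(** * Sobolev spaces *)

Section sobolev.
Context (R : realType) (d : nat).
Local Notation E := 'rV[R]_d.
Local Notation leb := (lebesgue_rV R d).
Context (Om : set E).
Hypothesis oOm : open Om.
Hypothesis bOm : bounded_set Om.
Let mOm := open_measurable_rV oOm.
Implicit Types (v w phi : E -> R) (g : 'I_d -> E -> R).

Local Notation e_ i := (delta_mx ord0 i : E).

Lemma partialsD (s : seq 'I_d) phi psi : smooth phi -> smooth psi ->
  partials s (phi + psi) = partials s phi + partials s psi.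
Proof.
move=> sphi spsi; elim: s => //= i s ->; apply/funext => x.
by rewrite deriveD; [|exact: (sphi s).2|exact: (spsi s).2].
Qed.

Lemma partialsZ (s : seq 'I_d) (c : R) phi : smooth phi ->
  partials s (c *: phi) = c *: partials s phi.
Proof.
move=> sphi; elim: s => //= i s ->; apply/funext => x.
by rewrite deriveZ; [|exact: (sphi s).2].
Qed.

Lemma test_funD phi psi : test_fun Om phi -> test_fun Om psi ->
  test_fun Om (phi + psi).
Proof.
move=> [sphi [C [cC CO phi0]]] [spsi [C' [cC' CO' psi0]]]; split.
  move=> s; rewrite partialsD//; split=> [|i x].
    by move=> x; apply: continuousD; [exact: (sphi s).1|exact: (spsi s).1].
  by apply: derivableD; [exact: (sphi s).2|exact: (spsi s).2].
exists (C `|` C'); split; first exact: compactU.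
  by move=> x [/CO|/CO'].
move=> x /not_orP[Cx C'x].
by rewrite addrfctE phi0// psi0// addr0.
Qed.

Lemma test_funZ (c : R) phi : test_fun Om phi -> test_fun Om (c *: phi).
Proof.
move=> [sphi [C [cC CO phi0]]]; split.
  move=> s; rewrite partialsZ//; split=> [|i x].
    by move=> x; apply: (continuousM (s := cst c)); [exact: cst_continuous|exact: (sphi s).1].
  by apply: derivableZ; exact: (sphi s).2.
by exists C; split=> // x /phi0; rewrite scalrfctE => ->; rewrite scaler0.
Qed.

Lemma test_fun0 : test_fun Om 0.
Proof.
split; last by exists set0; split => //; exact: compact0.
have s0 s : partials s (0 : E -> R) = 0.
  by elim: s => //= i s ->; apply/funext => x; rewrite derive_cst.
move=> s; rewrite s0; split=> [x|i x]; first exact: cst_continuous.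
exact: derivable_cst.
Qed.

Lemma test_fun_continuous phi : test_fun Om phi -> continuous phi.
Proof. by move=> [/(_ [::])[]]. Qed.

Lemma test_fun_derivable phi i x : test_fun Om phi -> derivable phi x (e_ i).
Proof. by move=> [/(_ [::])[_]]. Qed.

Lemma test_fun_partial phi i : test_fun Om phi -> test_fun Om ('D_(e_ i) phi).
Proof.
move=> [sphi [C [cC CO phi0]]]; split.
  by move=> s; have := sphi (rcons s i); rewrite /partials foldr_rcons.
exists C; split=> // x Cx.
have cC' : open (~` C) by apply: closed_openC; exact: compact_closed.
rewrite (@near_eq_derive _ _ _ _ (cst 0)) ?derive_cst//.
have := cC'; rewrite openE => /(_ x Cx); apply: filterS => y /phi0.
by move=> ->.
Qed.

Lemma test_fun_cube phi : test_fun Om phi ->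
  exists M, forall x, ~ @cube R d M x -> phi x = 0.
Proof.
move=> [_ [C [/compact_bounded/bounded_sub_cube[M CM] _ phi0]]].
by exists M => x xM; apply: phi0 => /CM.
Qed.

Lemma test_fun_L2 phi : test_fun Om phi -> L2 Om phi.
Proof.
move=> tphi; have [M HM] := test_fun_cube tphi.
by apply: (continuous_L2 oOm (M := M)) => //; exact: test_fun_continuous.
Qed.

Lemma test_fun_out phi x : test_fun Om phi -> ~ Om x -> phi x = 0.
Proof. by move=> [_ [C [_ CO phi0]]] Ox; apply: phi0 => /CO. Qed.

Lemma test_fun_weak_grad phi : test_fun Om phi ->
  is_weak_grad Om phi (fun i => 'D_(e_ i) phi).
Proof.
move=> tphi; split=> [i|psi tpsi i]; first exact/test_fun_L2/test_fun_partial.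
have tdphi := test_fun_partial i tphi.
have tdpsi := test_fun_partial i tpsi.
have L1 := L2_mul oOm (test_fun_L2 tphi) (test_fun_L2 tdpsi).
have L2' := L2_mul oOm (test_fun_L2 tdphi) (test_fun_L2 tpsi).
apply/eqP; rewrite -subr_eq0 opprK -RintegralD//; apply/eqP.
rewrite Rintegral_mkcond.
(* [dp] is the partial derivative of [phi * psi] on the whole space. It vanishes outside [Om], so
   the integral over [Om] is one over the space. *)
pose dp x := phi x * 'D_(e_ i) psi x + 'D_(e_ i) phi x * psi x.
rewrite (_ : _ \_ Om = dp); last first.
  apply/funext => x; rewrite patchE; case: ifPn => //; rewrite notin_setE => Ox.
  by rewrite /dp (test_fun_out tphi)// (test_fun_out tpsi)// mul0r mulr0 addr0.
have [M HM] := test_fun_cube tphi; have [M' HM'] := test_fun_cube tpsi.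
have H (x : E) : ~ cube M x -> phi x * psi x = 0 by move=> /HM ->; rewrite mul0r.
have [M1 HM1] := test_fun_cube tdphi.
(* Outside the cube of half-width [K] both [phi] and its partial derivative vanish, hence so do
   [phi * psi] and [dp]. *)
pose K := Num.max M M1.
have KM x : ~ @cube R d K x -> ~ cube M x /\ ~ cube M1 x.
  move=> xK; split=> xM; apply: xK => j; have /andP[a b] := xM j.
    by rewrite -ler_norml le_max; apply/orP; left; rewrite ler_norml a b.
  by rewrite -ler_norml le_max; apply/orP; right; rewrite ler_norml a b.
have cdp : continuous dp.
  move=> x; have cf f : test_fun Om f -> {for x, continuous f}.
    by move=> tf; exact: test_fun_continuous.
  exact: (continuousD (continuousM (cf _ tphi) (cf _ tdpsi))
    (continuousM (cf _ tdphi) (cf _ tpsi))).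
have ddp x : is_derive x (e_ i) (phi * psi) (dp x).
  apply: DeriveDef.
    by apply: derivableM; exact: test_fun_derivable.
  rewrite deriveM; [|exact: test_fun_derivable..].
  by rewrite /dp /GRing.scale/= [X in _ + X]mulrC.
rewrite /Rintegral (integral_partial0 (M := K) cdp ddp)//.
- by move=> x /KM[/HM p0 _]; rewrite mulrfctE p0 mul0r.
- by move=> x /KM[/HM p0 /HM1 p1]; rewrite /dp p0 p1 !mul0r addr0.
Qed.

(** [grad] is a choice among weak gradients; uniqueness almost everywhere is what makes it additive
    and homogeneous up to null sets. *)
Lemma weak_grad_unique v g g' : is_weak_grad Om v g -> is_weak_grad Om v g' ->
  forall i, {ae leb, forall x, Om x -> g i x = g' i x}.
Proof.
move=> [Lg wg] [Lg' wg'] i; have sip := L2_semi_ip oOm.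
have sm := sip_seminormed sip.
have LB : L2 Om (g i - g' i) by apply: (smB sm).
have gi := L2_integrable oOm bOm (Lg i); have gi' := L2_integrable oOm bOm (Lg' i).
suff : {ae leb, forall x, Om x -> (g i - g' i) x = 0}.
  by apply: filterS => x + Ox => /(_ Ox)/eqP; rewrite subr_eq0 => /eqP.
apply: (fundamental_lemma_rV oOm); first exact: L2_integrable.
move=> phi tphi; rewrite -[LHS]/(ip Om (g i - g' i) phi).
have Lphi := test_fun_L2 tphi.
rewrite (sipD sip)//; last exact: (smN sm).
rewrite -scaleN1r (sipZ sip)// mulN1r.
by apply/eqP; rewrite subr_eq0 -eqr_opp -[X in X == _]wg// -[X in _ == X]wg'.
Qed.

End sobolev.

Section pairing.
Context (R : realType) (V W : lmodType R).

(** A common interface for the L^2 inner product, the product of gradients on H^1_0 and the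
    H^{-1}-H^1_0 duality. The bound with constant 1 is all that integrability of time-dependent
    pairings requires, so that is proved once for the three of them. *)
Record pairing (P : V -> Prop) (nP : V -> R) (Q : W -> Prop) (nQ : W -> R)
    (B : V -> W -> R) : Prop := Pairing {
  prP : seminormed P nP;
  prQ : seminormed Q nQ;
  prDl : forall u v w, P u -> P v -> Q w -> B (u + v) w = B u w + B v w;
  prZl : forall c v w, P v -> Q w -> B (c *: v) w = c * B v w;
  prDr : forall v w z, P v -> Q w -> Q z -> B v (w + z) = B v w + B v z;
  prZr : forall c v w, P v -> Q w -> B v (c *: w) = c * B v w;
  pr_bound : forall v w, P v -> Q w -> `|B v w| <= nP v * nQ w }.

Context P nP Q nQ B (pr : pairing P nP Q nQ B).

Lemma prBl u v w : P u -> P v -> Q w -> B (u - v) w = B u w - B v w.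
Proof.
move=> Pu Pv Qw; rewrite (prDl pr)//; last exact: (smN (prP pr)).
by rewrite -scaleN1r (prZl pr)// mulN1r.
Qed.

Lemma prBr v w z : P v -> Q w -> Q z -> B v (w - z) = B v w - B v z.
Proof.
move=> Pv Qw Qz; rewrite (prDr pr)//; last exact: (smN (prQ pr)).
by rewrite -scaleN1r (prZr pr)// mulN1r.
Qed.

Lemma pr_eq0l v w : P v -> Q w -> nP v = 0 -> B v w = 0.
Proof.
move=> Pv Qw v0; apply/eqP; rewrite -normr_le0.
by rewrite (le_trans (pr_bound pr Pv Qw))// v0 mul0r.
Qed.

End pairing.

Lemma semi_ip_pairing (R : realType) (V : lmodType R) (P : V -> Prop)
    (B : V -> V -> R) : semi_ip P B ->
  pairing P (fun v => Num.sqrt (B v v)) P (fun v => Num.sqrt (B v v)) B.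
Proof.
move=> sip; have sm := sip_seminormed sip; split=> //.
- exact: (sipD sip).
- exact: (sipZ sip).
- move=> v w z Pv Pw Pz; rewrite (sipC sip) (sipD sip)//.
  by rewrite (sipC sip w) (sipC sip z).
- by move=> c v w Pv Pw; rewrite (sipC sip) (sipZ sip)// (sipC sip w).
- exact: (sip_CS sip).
Qed.

Section sobolev_spaces.
Context (R : realType) (d : nat).
Local Notation E := 'rV[R]_d.
Local Notation leb := (lebesgue_rV R d).
Context (Om : set E).
Hypothesis oOm : open Om.
Hypothesis bOm : bounded_set Om.
Let mOm := open_measurable_rV oOm.
Implicit Types (v w phi : E -> R) (g h : 'I_d -> E -> R).

Let sL2 := L2_semi_ip oOm.

Lemma L2_seminormed : seminormed (L2 Om) (L2norm Om).
Proof. exact: sip_seminormed sL2. Qed.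

Lemma L2_pairing : pairing (L2 Om) (L2norm Om) (L2 Om) (L2norm Om) (ip Om).
Proof. exact: semi_ip_pairing sL2. Qed.

Lemma ip_ae v v' w w' : {ae leb, forall x, Om x -> v x = v' x} ->
  {ae leb, forall x, Om x -> w x = w' x} -> ip Om v w = ip Om v' w'.
Proof.
move=> vE wE; apply: ae_Rintegral => //.
by apply: filterS2 vE wE => x + + Ox => -> // ->.
Qed.

Lemma gradP v : H1 Om v -> is_weak_grad Om v (grad Om v).
Proof. by move=> [_ [g wg]]; apply: (xgetPex _ (P := is_weak_grad Om v)); exists g. Qed.

Lemma weak_gradD v w g h : L2 Om v -> L2 Om w ->
  is_weak_grad Om v g -> is_weak_grad Om w h ->
  is_weak_grad Om (v + w) (fun i => g i + h i).
Proof.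
move=> Lv Lw [Lg wg] [Lh wh]; split=> [i|phi tphi i]; first exact: (sipPD sL2).
have Lp := test_fun_L2 oOm tphi.
have Ldp := test_fun_L2 oOm (test_fun_partial i tphi).
rewrite -[LHS]/(ip Om (v + w) _) -[X in - X]/(ip Om (g i + h i) phi).
rewrite !(sipD sL2)// opprD; congr (_ + _); [exact: wg|exact: wh].
Qed.

Lemma weak_gradZ (c : R) v g : L2 Om v -> is_weak_grad Om v g ->
  is_weak_grad Om (c *: v) (fun i => c *: g i).
Proof.
move=> Lv [Lg wg]; split=> [i|phi tphi i]; first exact: (sipPZ sL2).
have Lp := test_fun_L2 oOm tphi.
have Ldp := test_fun_L2 oOm (test_fun_partial i tphi).
rewrite -[LHS]/(ip Om (c *: v) _) -[X in - X]/(ip Om (c *: g i) phi).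
by rewrite !(sipZ sL2)// -mulrN; congr (_ * _); exact: wg.
Qed.

Lemma H1_L2 v : H1 Om v -> L2 Om v. Proof. by case. Qed.

Lemma H1_grad_L2 v i : H1 Om v -> L2 Om (grad Om v i).
Proof. by move=> /gradP[]. Qed.

Lemma H1D v w : H1 Om v -> H1 Om w -> H1 Om (v + w).
Proof.
move=> Hv Hw; split; first by apply: (sipPD sL2); [case: Hv|case: Hw].
by eexists; apply: (weak_gradD (H1_L2 Hv) (H1_L2 Hw)); exact: gradP.
Qed.

Lemma H1Z (c : R) v : H1 Om v -> H1 Om (c *: v).
Proof.
move=> Hv; split; first by apply: (sipPZ sL2); case: Hv.
by eexists; apply: (weak_gradZ _ (H1_L2 Hv)); exact: gradP.
Qed.

Lemma gradD v w i : H1 Om v -> H1 Om w -> {ae leb, forall x, Om x ->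
  grad Om (v + w) i x = (grad Om v i + grad Om w i) x}.
Proof.
move=> Hv Hw.
exact: (weak_grad_unique oOm bOm (gradP (H1D Hv Hw))
  (weak_gradD (H1_L2 Hv) (H1_L2 Hw) (gradP Hv) (gradP Hw)) i).
Qed.

Lemma gradZ (c : R) v i : H1 Om v -> {ae leb, forall x, Om x ->
  grad Om (c *: v) i x = (c *: grad Om v i) x}.
Proof.
move=> Hv.
exact: (weak_grad_unique oOm bOm (gradP (H1Z c Hv))
  (weak_gradZ c (H1_L2 Hv) (gradP Hv)) i).
Qed.

Lemma ip_grad_semi_ip : semi_ip (H1 Om) (ip_grad Om).
Proof.
have rfl (f : E -> R) : {ae leb, forall x, Om x -> f x = f x} by exact: aeW.
split; [exact: H1D|exact: H1Z|..].
- by move=> v w; apply: eq_bigr => i _; exact: (sipC sL2).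
- move=> u v w Hu Hv Hw; rewrite /ip_grad -big_split/=; apply: eq_bigr => i _.
  rewrite (ip_ae (gradD i Hu Hv) (rfl _)) (sipD sL2)//; exact: H1_grad_L2.
- move=> c v w Hv Hw; rewrite /ip_grad mulr_sumr; apply: eq_bigr => i _.
  rewrite (ip_ae (gradZ c i Hv) (rfl _)) (sipZ sL2)//; exact: H1_grad_L2.
- by move=> v Hv; apply: sumr_ge0 => i _; apply: (sip_ge0 sL2); exact: H1_grad_L2.
Qed.

Lemma H1_semi_ip : semi_ip (H1 Om) (fun v w => ip Om v w + ip_grad Om v w).
Proof.
have sg := ip_grad_semi_ip; split; [exact: H1D|exact: H1Z|..].
- by move=> v w; rewrite (sipC sL2) (sipC sg).
- move=> u v w Hu Hv Hw; rewrite (sipD sL2) ?(sipD sg)//; try exact: H1_L2.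
  by rewrite addrACA.
- move=> c v w Hv Hw; rewrite (sipZ sL2) ?(sipZ sg)//; try exact: H1_L2.
  by rewrite mulrDr.
- by move=> v Hv; rewrite addr_ge0 ?(sip_ge0 sg)// (sip_ge0 sL2)//; exact: H1_L2.
Qed.

Lemma H1_seminormed : seminormed (H1 Om) (H1norm Om).
Proof. exact: sip_seminormed H1_semi_ip. Qed.

Lemma test_fun_H1 phi : test_fun Om phi -> H1 Om phi.
Proof.
by move=> tphi; split; [exact: test_fun_L2|eexists; exact: test_fun_weak_grad].
Qed.

Lemma H10_H1 v : H10 Om v -> H1 Om v. Proof. by case. Qed.

Lemma H10_L2 v : H10 Om v -> L2 Om v. Proof. by move=> /H10_H1/H1_L2. Qed.

Lemma H10_seminormed : seminormed (H10 Om) (H1norm Om).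
Proof.
have sm := H1_seminormed; split.
- move=> v w [Hv av] [Hw aw]; split; first exact: H1D.
  move=> e e0; have e20 : 0 < e / 2 by rewrite divr_gt0.
  have [phi tphi vphi] := av _ e20; have [psi tpsi wpsi] := aw _ e20.
  exists (phi + psi); first exact: test_funD.
  have Hp := test_fun_H1 tphi; have Hq := test_fun_H1 tpsi.
  rewrite opprD addrACA (le_lt_trans (sm_nrmD sm _ _))//; try exact: (smB sm).
  by apply: lt_le_trans (ltrD vphi wpsi) _; rewrite -splitr.
- move=> c v [Hv av]; split; first exact: H1Z.
  (* Dividing by [|c| + 1] instead of [|c|] covers [c = 0]. *)
  move=> e e0; have [|phi tphi vphi] := av (e / (`|c| + 1)).
    by rewrite divr_gt0// ltr_wpDl.
  exists (c *: phi); first exact: test_funZ.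
  have Hp := test_fun_H1 tphi.
  rewrite -scalerBr (sm_nrmZ sm)//; last exact: (smB sm).
  have c1 : 0 < `|c| + 1 by rewrite ltr_wpDl.
  move: vphi; rewrite ltr_pdivlMr//; apply: le_lt_trans.
  rewrite mulrC ler_wpM2l// ?lerDl//; apply: (sm_ge0 sm); exact: (smB sm).
- by move=> v /H10_H1; exact: (sm_ge0 sm).
- by move=> v w /H10_H1 Hv /H10_H1 Hw; exact: (sm_nrmD sm).
- by move=> c v /H10_H1; exact: (sm_nrmZ sm).
Qed.

Lemma H100 : H10 Om 0.
Proof.
have sm := H1_seminormed; have t0 := @test_fun0 _ _ Om.
split; first exact: test_fun_H1.
move=> e e0; exists 0 => //; rewrite subrr -(scale0r 0) (sm_nrmZ sm).
  by rewrite normr0 mul0r.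
exact: test_fun_H1.
Qed.

Lemma L2norm_le_H1norm v : H1 Om v -> L2norm Om v <= H1norm Om v.
Proof.
move=> Hv; rewrite /L2norm /H1norm ler_sqrt.
  by rewrite lerDl; exact: (sip_ge0 ip_grad_semi_ip).
exact: (sip_ge0 H1_semi_ip).
Qed.

Lemma H10_grad_pairing :
  pairing (H10 Om) (H1norm Om) (H10 Om) (H1norm Om) (ip_grad Om).
Proof.
have sg := ip_grad_semi_ip; have pg := semi_ip_pairing sg.
have nE v : H1 Om v -> Num.sqrt (ip_grad Om v v) <= H1norm Om v.
  move=> Hv; rewrite /H1norm ler_sqrt; last exact: (sip_ge0 H1_semi_ip).
  by rewrite lerDr (sip_ge0 sL2)//; exact: H1_L2.
split; [exact: H10_seminormed|exact: H10_seminormed|..].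
- by move=> u v w /H10_H1 ? /H10_H1 ? /H10_H1 ?; exact: (prDl pg).
- by move=> c v w /H10_H1 ? /H10_H1 ?; exact: (prZl pg).
- by move=> u v w /H10_H1 ? /H10_H1 ? /H10_H1 ?; exact: (prDr pg).
- by move=> c v w /H10_H1 ? /H10_H1 ?; exact: (prZr pg).
- move=> v w /H10_H1 Hv /H10_H1 Hw; rewrite (le_trans (pr_bound pg Hv Hw))//.
  by rewrite ler_pM ?sqrtr_ge0// nE.
Qed.

(** [sup] has its meaning only for nonempty sets that are bounded above. The vector 0 gives an
    element and the continuity constant of [f] a bound. *)
Lemma Hm1_has_sup f : Hm1 Om f ->
  has_sup [set `|f v| | v in [set v | H10 Om v /\ H1norm Om v <= 1]].
Proof.
move=> [_ [C fC]]; split.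
  exists `|f 0|; exists 0 => //; split; first exact: H100.
  rewrite -(scale0r 0) (sm_nrmZ H10_seminormed); last exact: H100.
  by rewrite normr0 mul0r.
exists `|C| => _ [v [Hv v1] <-]; rewrite (le_trans (fC v Hv))//.
have v0 := sm_ge0 H10_seminormed Hv.
by rewrite (le_trans (ler_wpM2r v0 (ler_norm C)))// ler_piMr.
Qed.

Lemma Hm1_bound f v : Hm1 Om f -> H10 Om v ->
  `|f v| <= Hm1norm Om f * H1norm Om v.
Proof.
move=> Hf Hv; have [flin [C fC]] := Hf.
have fZ c w : H10 Om w -> f (c *: w) = c * f w.
  move=> Hw; have f0 : f 0 = 0.
    have := flin 1 _ _ H100 H100; rewrite scaler0 addr0 mul1r => h.
    by apply: (addrI (f 0)); rewrite addr0.
  have h := flin c w 0 Hw H100; rewrite f0 [RHS]addr0 in h.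
  by rewrite -h [c *: w + 0]addr0.
have v0 := sm_ge0 H10_seminormed Hv.
(* A vector of norm 0 cannot be normalized, but there the bound by [C] already forces [f v = 0]. *)
move: v0; rewrite le_eqVlt => /orP[/eqP v0|v0].
  by have := fC v Hv; rewrite -v0 !mulr0.
rewrite -ler_pdivrMr//.
have -> : `|f v| / H1norm Om v = `|f ((H1norm Om v)^-1 *: v)|.
  by rewrite fZ// normrM [`|_^-1|]ger0_norm ?invr_ge0 ?ltW// mulrC.
apply: ub_le_sup; first by case: (Hm1_has_sup Hf).
exists ((H1norm Om v)^-1 *: v); last exact: erefl.
split; first exact: (smZ H10_seminormed).
rewrite (sm_nrmZ H10_seminormed)// ger0_norm; last by rewrite invr_ge0 ltW.
by rewrite mulVf// gt_eqF.
Qed.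

Lemma Hm1norm_le f K : Hm1 Om f -> 0 <= K ->
  (forall v, H10 Om v -> `|f v| <= K * H1norm Om v) -> Hm1norm Om f <= K.
Proof.
move=> Hf K0 fK; apply: ge_sup; first by case: (Hm1_has_sup Hf).
by move=> _ [v [Hv v1] <-]; rewrite (le_trans (fK v Hv))// ler_piMr.
Qed.

Lemma Hm1norm_ge0 f : Hm1 Om f -> 0 <= Hm1norm Om f.
Proof.
move=> Hf; have [[x xS] ub] := Hm1_has_sup Hf.
rewrite (le_trans _ (ub_le_sup ub xS))//.
by case: xS => v _ <-.
Qed.

Lemma Hm1_pairing : pairing (Hm1 Om) (Hm1norm Om) (H10 Om) (H1norm Om)
  (fun f v => f v).
Proof.
have HD f f' : Hm1 Om f -> Hm1 Om f' -> Hm1 Om (f + f').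
  move=> Hf Hg; split.
    move=> c v w Hv Hw; rewrite !addrfctE (Hf.1 c)// (Hg.1 c)//.
    by rewrite mulrDr addrACA.
  exists (Hm1norm Om f + Hm1norm Om f') => v Hv; rewrite addrfctE mulrDl.
  by rewrite (le_trans (ler_normD _ _))// lerD// Hm1_bound.
have HZ c f : Hm1 Om f -> Hm1 Om (c *: f).
  move=> Hf; split.
    move=> a v w Hv Hw; rewrite !scalrfctE (Hf.1 a)//.
    by rewrite /GRing.scale/= mulrDr mulrCA.
  exists (`|c| * Hm1norm Om f) => v Hv; rewrite scalrfctE normrM -mulrA.
  by rewrite ler_wpM2l// Hm1_bound.
have nZ c f : Hm1 Om f -> Hm1norm Om (c *: f) <= `|c| * Hm1norm Om f.
  move=> Hf; apply: Hm1norm_le; first exact: HZ.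
    by rewrite mulr_ge0// Hm1norm_ge0.
  move=> v Hv; rewrite scalrfctE normrM -mulrA ler_wpM2l//.
  exact: Hm1_bound.
have f0 f : Hm1 Om f -> f 0 = 0.
  move=> Hf; have := Hf.1 1 _ _ H100 H100; rewrite scaler0 addr0 mul1r => h.
  by apply: (addrI (f 0)); rewrite addr0.
split; [split=> //|exact: H10_seminormed|..].
- exact: Hm1norm_ge0.
- move=> f f' Hf Hg; apply: Hm1norm_le; first exact: HD.
    by rewrite addr_ge0 ?Hm1norm_ge0.
  move=> v Hv; rewrite addrfctE mulrDl (le_trans (ler_normD _ _))//.
  by rewrite lerD// Hm1_bound.
- move=> c f Hf; apply/eqP; rewrite eq_le nZ//=.
  have [->|c0] := eqVneq c 0.
    by rewrite normr0 mul0r Hm1norm_ge0//; exact: HZ.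
  rewrite -ler_pdivlMl ?normr_gt0// -normfV.
  by rewrite -{1}(scale1r f) -(mulVf c0) -scalerA nZ//; exact: HZ.
- by [].
- by [].
- by move=> f v w Hf Hv Hw; have := Hf.1 1 v w Hv Hw; rewrite scale1r mul1r.
- move=> c f v Hf Hv; have := Hf.1 c v 0 Hv H100.
  by rewrite addr0 f0// addr0.
- by move=> f v Hf Hv; exact: Hm1_bound.
Qed.

End sobolev_spaces.

#[global] Instance ae_leb_filter (R : realType) :
  Filter (nbhs (almost_everywhere (@lebesgue_measure R))).
Proof. exact: (@ae_filter_ringOfSetsType _ _ R (@lebesgue_measure R)). Qed.

(** * Bochner spaces and time derivatives *)

Lemma aemeas_sqr d (T : measurableType d) (R : realType)
    (mu : {measure set T -> \bar R}) (D : set T) (f : T -> R) :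
  aemeas mu D f -> aemeas mu D (fun x => f x ^+ 2).
Proof.
move=> mf; rewrite (_ : (fun x => _) = fun x => f x * f x); last exact/funext.
exact: aemeasM.
Qed.

Section bochner_theory.
Context (R : realType).
Local Notation mu := (@lebesgue_measure R).
Implicit Types (a b : R).

(* Stated on the type over which [lebesgue_measure] is defined. *)
Lemma mitv a b : measurable
  (`]a, b[%classic : set (g_sigma_algebraType R.-ocitv.-measurable)).
Proof. exact: measurable_itv. Qed.

Lemma itv_finite a b : (mu (`]a, b[%classic : set R) < +oo)%E.
Proof. by rewrite lebesgue_measure_itv/=; case: ifP; rewrite ?ltry. Qed.

(** Two simple functions take finitely many pairs of values, so any relation between them holds on a
    finite union of intersections of level sets. This makes sums and multiples of simple functions
    simple. *)
Lemma simple_fun_set2 (V W : Type) (P : V -> Prop) (Q : W -> Prop)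
    (s : R -> V) (s' : R -> W) (A : V -> W -> Prop) :
  simple_fun P s -> simple_fun Q s' -> measurable [set t | A (s t) (s' t)].
Proof.
move=> [fs _ ms] [fs' _ ms'].
have -> : [set t | A (s t) (s' t)] =
    \bigcup_(v in range s) \bigcup_(w in range s')
      ([set t | A v w] `&` (s @^-1` [set v] `&` s' @^-1` [set w])).
  apply/seteqP; split=> [t At|t [_ [u _ <-] [_ [u' _ <-] [/= Au [-> ->]]]]] //=.
  by exists (s t) => //; exists (s' t).
apply: fin_bigcup_measurable => // v _; apply: fin_bigcup_measurable => // w _.
apply: measurableI; last by apply: measurableI; [exact: ms|exact: ms'].
have [Avw|nA] := pselect (A v w).
  rewrite (_ : [set _ | _] = setT); last by apply/seteqP; split.
  exact: measurableT.
rewrite (_ : [set _ | _] = set0); last by apply/seteqP; split.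
exact: measurable0.
Qed.

Section one_space.
Context (V : lmodType R) (P : V -> Prop) (nrm : V -> R).
Hypothesis sm : seminormed P nrm.
Context (a b : R).
Local Notation D := (`]a, b[%classic : set R).
Implicit Types (z : R -> V).

(** The strong measurability contained in [L2B], separated from it because sums and pairings are
    shown measurable before they are shown integrable. *)
Definition bmeas z :=
  {ae mu, forall t, a < t < b -> P (z t)} /\
  exists s : nat -> R -> V, (forall n, simple_fun P (s n)) /\
    {ae mu, forall t, a < t < b -> (fun n => nrm (s n t - z t)) @ \oo --> (0 : R)}.

Lemma simple_aemeas (F : R -> V -> R) (s : R -> V) : simple_fun P s ->
  (forall v, P v -> aemeas mu D (fun t => F t v)) ->
  aemeas mu D (fun t => F t (s t)).
Proof.
move=> [/finite_seqP[r rE] Ps ms] mF.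
(* Without repetitions in the list of values, exactly one indicator in the sum below is nonzero at
   each [t]. *)
pose r' := undup r.
have sr t : s t \in r'.
  by rewrite mem_undup; suff : [set` r] (s t) by []; rewrite -rE; exists t.
have rP v : v \in r' -> P v.
  rewrite mem_undup => vr; have : [set` r] v by [].
  by rewrite -rE => -[t _ <-].
have -> : (fun t => F t (s t)) =
    fun t => \sum_(v <- r') \1_(s @^-1` [set v]) t * F t v.
  apply/funext => t; rewrite (bigD1_seq (s t)) ?undup_uniq//= indicE mem_set//.
  rewrite mul1r big1 ?addr0// => v vs; rewrite indicE memNset ?mul0r//=.
  by apply/eqP; rewrite eq_sym.
clear sr; clearbody r'; elim: r' rP => [_|v r' IH rP].
  rewrite (_ : (fun t => _) = fun=> 0); last by apply/funext => t; rewrite big_nil.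
  by apply: measurable_aemeas; exact: measurable_cst.
rewrite (_ : (fun t => _) = fun t => \1_(s @^-1` [set v]) t * F t v +
    \sum_(v <- r') \1_(s @^-1` [set v]) t * F t v); last first.
  by apply/funext => t; rewrite big_cons.
apply: aemeasD; last by apply: IH => w wr; apply: rP; rewrite inE wr orbT.
apply: aemeasM; last by apply: mF; apply: rP; rewrite inE eqxx.
by apply: measurable_aemeas; apply: measurable_indic; exact: ms.
Qed.

(** A Caratheodory argument: along a simple function, [F] is a finite sum of indicators times
    measurable functions, and the Lipschitz bound in [v], whose constant may vary with [t], carries
    measurability to the limit. Norms, pairings and products with the desired state are all
    instances. *)
Lemma bmeas_aemeas (F : R -> V -> R) (C : R -> R) z : bmeas z ->
  (forall v, P v -> aemeas mu D (fun t => F t v)) ->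
  {ae mu, forall t, a < t < b -> forall v w, P v -> P w ->
    `|F t v - F t w| <= C t * nrm (v - w)} ->
  aemeas mu D (fun t => F t (z t)).
Proof.
move=> [Pz [s [ss sz]]] mF FC.
apply: (@aemeas_cvg _ _ _ mu D (fun n t => F t (s n t)) _ (mitv a b)).
  by move=> n; exact: simple_aemeas.
apply: filterS3 Pz sz FC => t + + + Dt.
have tab : a < t < b by move: Dt => /=; rewrite in_itv.
move=> /(_ tab) Pz /(_ tab) sz /(_ tab) FC.
have Ps n : P (s n t) by have [_ + _] := ss n; apply.
apply/cvgrPdist_le => e e0; near=> n.
rewrite distrC (le_trans (FC _ _ _ _))//.
have n0 : 0 <= nrm (s n t - z t) by apply: (sm_ge0 sm); exact: (smB sm).
apply: (@le_trans _ _ ((`|C t| + 1) * nrm (s n t - z t))).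
  by rewrite ler_wpM2r// (le_trans (ler_norm _))// lerDl.
have C0 : 0 < `|C t| + 1 by rewrite ltr_wpDl.
rewrite -ler_pdivlMl// mulrC -[leLHS]ger0_norm//.
near: n; move/cvgrPdist_le : sz => /(_ (e / (`|C t| + 1))).
rewrite divr_gt0// => /(_ isT); apply: filterS => n.
by rewrite sub0r normrN.
Unshelve. all: by end_near. Qed.

Lemma bmeas_norm z : bmeas z -> aemeas mu D (fun t => nrm (z t)).
Proof.
move=> bz; apply: (bmeas_aemeas (F := fun _ v => nrm v) (C := fun=> 1) bz).
  by move=> v _; apply: measurable_aemeas; exact: measurable_cst.
by apply: aeW => t _ v w Pv Pw; rewrite mul1r; exact: (sm_nrmBB sm).
Qed.

Lemma L2BP z : L2B P nrm a b z <-> bmeas z /\ sqint mu D (fun t => nrm (z t)).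
Proof.
split=> [[Pz sz zoo]|[[Pz sz] [_ zi]]].
  have bz : bmeas z by [].
  split=> //; split; first exact: bmeas_norm.
  apply: (@lty_aeint _ _ _ mu D _ (mitv a b)) => //.
    by apply: aemeas_sqr; exact: bmeas_norm.
  by move=> t _; exact: sqr_ge0.
split=> //; exact: (@aeint_lty _ _ _ mu D _ (mitv a b) zi).
Qed.

Lemma bmeasD z z' : bmeas z -> bmeas z' -> bmeas (fun t => z t + z' t).
Proof.
move=> [Pz [s [ss sz]]] [Pz' [s' [ss' sz']]]; split.
  apply: filterS2 Pz Pz' => t + + ab => /(_ ab) ? /(_ ab) ?; exact: (smD sm).
exists (fun n t => s n t + s' n t); split=> [n|].
  have [fs Ps ms] := ss n; have [fs' Ps' ms'] := ss' n; split.
  - apply: (sub_finite_set _ (finite_image2 (fun v w => v + w) fs fs')).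
    by move=> _ [t _ <-]; exists (s n t); [exists t|exists (s' n t) => //; exists t].
  - by move=> t; exact: (smD sm).
  - by move=> v; exact: (@simple_fun_set2 _ _ P P _ _ (fun x y => x + y = v)).
apply: filterS (filterI (filterI Pz Pz') (filterI sz sz')) => t.
move=> [[p p'] [c c']] ab; move: (p ab) (p' ab) (c ab) (c' ab) => {}p {}p' {}c {}c'.
have Ps n : P (s n t) by have [_ + _] := ss n; apply.
have Ps' n : P (s' n t) by have [_ + _] := ss' n; apply.
have cc : (fun n => nrm (s n t - z t) + nrm (s' n t - z' t)) @ \oo --> (0 : R).
  by rewrite -[X in _ --> X]addr0; exact: cvgD.
apply: (squeeze_cvgr (f := fun=> 0) _ _ cc); last exact: cvg_cst.
apply: nearW => n /=; rewrite (sm_ge0 sm)/=.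
  by rewrite opprD addrACA (sm_nrmD sm)//; exact: (smB sm).
by apply: (smB sm); exact: (smD sm).
Qed.

Lemma bmeasZ (c : R) z : bmeas z -> bmeas (fun t => c *: z t).
Proof.
move=> [Pz [s [ss sz]]]; split.
  by apply: filterS Pz => t + ab => /(_ ab) ?; exact: (smZ sm).
exists (fun n t => c *: s n t); split=> [n|].
  have [fs Ps ms] := ss n; split.
  - apply: (sub_finite_set _ (finite_image (fun v => c *: v) fs)).
    by move=> _ [t _ <-]; exists (s n t) => //; exists t.
  - by move=> t; exact: (smZ sm).
  - move=> v; exact: (@simple_fun_set2 _ _ P P _ _ (fun x y => c *: x = v) (ss n) (ss n)).
apply: filterS2 Pz sz => t p cv ab; move: (p ab) (cv ab) => {}p {}cv.
have Ps n : P (s n t) by have [_ + _] := ss n; apply.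
have -> : (fun n => nrm (c *: s n t - c *: z t)) = fun n => `|c| * nrm (s n t - z t).
  by apply/funext => n; rewrite -scalerBr (sm_nrmZ sm)//; exact: (smB sm).
by rewrite -[X in _ --> X](mulr0 `|c|); apply: cvgM => //; exact: cvg_cst.
Qed.

Lemma L2BD z z' : L2B P nrm a b z -> L2B P nrm a b z' ->
  L2B P nrm a b (fun t => z t + z' t).
Proof.
move=> /L2BP[bz zi] /L2BP[bz' zi']; apply/L2BP; have bzz := bmeasD bz bz'.
split=> //; split; first exact: bmeas_norm.
have [_ zz] := sqintD (mitv a b) zi zi'.
apply: (@aeint_dom _ _ _ mu _ (mitv a b) _ _ _ _ zz).
  by apply: aemeas_sqr; exact: bmeas_norm.
apply: filterS2 bz.1 bz'.1 => t + + /= tab.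
have ab : a < t < b by move: tab; rewrite in_itv.
move=> /(_ ab) p /(_ ab) p'.
have pp := sm_ge0 sm (smD sm p p').
have p0 := sm_ge0 sm p; have p'0 := sm_ge0 sm p'.
rewrite ger0_norm ?sqr_ge0// ler_sqr ?nnegrE ?addr_ge0//.
exact: (sm_nrmD sm).
Qed.

Lemma L2BZ (c : R) z : L2B P nrm a b z -> L2B P nrm a b (fun t => c *: z t).
Proof.
move=> /L2BP[bz zi]; apply/L2BP; have bzz := bmeasZ c bz.
split=> //; split; first exact: bmeas_norm.
have [_ zz] := sqintZ (mitv a b) `|c| zi.
apply: aeint_ae zz; apply: filterS bz.1 => t + tab.
have ab : a < t < b by move: tab; rewrite /= in_itv.
by move=> /(_ ab) p; rewrite (sm_nrmZ sm).
Qed.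

Import HBSimple.

Lemma bmeas_scale (th : R -> R) (v : V) : measurable_fun setT th -> P v ->
  bmeas (fun t => th t *: v).
Proof.
move=> mth Pv; split; first by apply: aeW => t _; exact: (smZ sm).
have /(approximation_sfun measurableT)[g gth] : measurable_fun setT (EFin \o th).
  exact/measurable_EFinP.
exists (fun n t => g n t *: v); split=> [n|].
  split.
  - apply: (sub_finite_set _ (finite_image (fun x => x *: v) (fimfunP (g n)))).
    by move=> _ [t _ <-]; exists (g n t).
  - by move=> t; exact: (smZ sm).
  - move=> w; have := @simple_fun_set2 _ _ (fun=> True) (fun=> True) (g n) (g n)
      (fun x y => x *: v = w).
    have sg : simple_fun (fun=> True) (g n).
      by split=> // x; rewrite -[X in measurable X]setTI; exact: measurable_funP.
    by move=> /(_ sg sg).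
apply: aeW => t _.
have -> : (fun n => nrm (g n t *: v - th t *: v)) = fun n => `|g n t - th t| * nrm v.
  by apply/funext => n; rewrite -scalerBl (sm_nrmZ sm).
rewrite -[X in _ --> X](mul0r (nrm v)); apply: cvgM; last exact: cvg_cst.
apply/cvgrPdist_lt => e e0; have := gth t Logic.I.
move=> /fine_cvg /cvgrPdist_lt /(_ e e0); apply: filterS => n /=.
by rewrite sub0r normrN normr_id distrC.
Qed.

Lemma L2B_scale (th : R -> R) (v : V) : measurable_fun setT th ->
  sqint mu D th -> P v -> L2B P nrm a b (fun t => th t *: v).
Proof.
move=> mth [_ ith] Pv; apply/L2BP; have bz := bmeas_scale mth Pv.
split=> //; split; first exact: bmeas_norm.
have := aeintZ (mitv a b) (nrm v ^+ 2) ith; apply: aeint_ae.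
apply: aeW => t _; rewrite (sm_nrmZ sm)// exprMn mulrC.
by rewrite real_normK ?num_real.
Qed.

Lemma L2B_cst (v : V) : P v -> L2B P nrm a b (fun=> v).
Proof.
move=> Pv; have := @L2B_scale (fun=> 1) v.
rewrite scale1r; apply => //; apply: sqint_cst; first exact: mitv.
exact: itv_finite.
Qed.

End one_space.

Lemma L2B_sub (V : lmodType R) (P : V -> Prop) (nrm : V -> R) a b a' b' z :
  seminormed P nrm -> a <= a' -> b' <= b -> L2B P nrm a b z -> L2B P nrm a' b' z.
Proof.
move=> sm aa bb /(L2BP sm)[[Pz [s [ss sz]]] [mz zi]]; apply/(L2BP sm).
have sub t : a' < t < b' -> a < t < b.
  by move=> /andP[h1 h2]; rewrite (le_lt_trans aa h1) (lt_le_trans h2 bb).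
have sub' : `]a', b'[%classic `<=` `]a, b[%classic.
  by move=> t /=; rewrite !in_itv/=; exact: sub.
split; last first.
  by split; [exact: (aemeasS (mitv a b) (mitv a' b') sub' mz)|
    exact: (aeintS (mitv a b) (mitv a' b') sub' zi)].
split; first by apply: filterS Pz => t + /sub.
by exists s; split=> //; apply: filterS sz => t + /sub.
Qed.

Lemma L2B_ae (V : lmodType R) (P : V -> Prop) (nrm : V -> R) a b z z' :
  seminormed P nrm -> {ae mu, forall t, a < t < b -> z t = z' t} ->
  L2B P nrm a b z' -> L2B P nrm a b z.
Proof.
move=> sm zz' /(L2BP sm)[[Pz [s [ss sz]]] [mz zi]]; apply/(L2BP sm).
have nz : {ae mu, forall t, (`]a, b[%classic : set R) t -> nrm (z t) = nrm (z' t)}.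
  by apply: filterS zz' => t + /=; rewrite in_itv => h /h ->.
split; last first.
  split; first exact: aemeas_ae nz mz.
  by apply: aeint_ae zi; apply: filterS nz => t + tab => ->.
split; first by apply: filterS2 zz' Pz => t h1 h2 ab; rewrite h1//; exact: h2.
by exists s; split=> //; apply: filterS2 zz' sz => t h1 h2 ab; rewrite h1//; exact: h2.
Qed.

Section pairing_integrable.
Context (V W : lmodType R) (P : V -> Prop) (nP : V -> R) (Q : W -> Prop)
  (nQ : W -> R) (B : V -> W -> R).
Hypothesis pr : pairing P nP Q nQ B.
Context (a b : R).

(** The Caratheodory argument is applied once in each variable: for fixed [w] the Lipschitz constant
    is [nQ w], and then along [f] it is [nP (f t)]. *)
Lemma pairing_aemeas f z : bmeas P nP a b f -> bmeas Q nQ a b z ->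
  aemeas mu `]a, b[%classic (fun t => B (f t) (z t)).
Proof.
move=> bf bz.
apply: (bmeas_aemeas (prQ pr) (F := fun t v => B (f t) v) (C := fun t => nP (f t)) bz).
  move=> w Qw.
  apply: (bmeas_aemeas (prP pr) (F := fun _ v => B v w) (C := fun=> nQ w) bf).
    by move=> v _; apply: measurable_aemeas; exact: measurable_cst.
  apply: aeW => t _ v v' Pv Pv'; rewrite -(prBl pr)// mulrC.
  by apply: (pr_bound pr) => //; exact: (smB (prP pr)).
apply: filterS bf.1 => t + ab => /(_ ab) Pf v v' Qv Qv'.
rewrite -(prBr pr)//; apply: (pr_bound pr) => //; exact: (smB (prQ pr)).
Qed.

Lemma pairing_aeint f z : L2B P nP a b f -> L2B Q nQ a b z ->
  aeint mu `]a, b[%classic (fun t => B (f t) (z t)).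
Proof.
move=> /(L2BP (prP pr))[bf fi] /(L2BP (prQ pr))[bz zi].
have := sqint_mul (mitv a b) fi zi.
apply: (@aeint_dom _ _ _ mu _ (mitv a b)); first exact: pairing_aemeas.
apply: filterS2 bf.1 bz.1 => t + + /= tab.
have ab : a < t < b by move: tab; rewrite in_itv.
by move=> /(_ ab) p /(_ ab) q; exact: (pr_bound pr).
Qed.

End pairing_integrable.

End bochner_theory.

(** * Test functions and weak derivatives in time *)

Section time_test_functions.
Context (R : realType).
Local Notation mu := (@lebesgue_measure R).
Implicit Types (a b : R) (phi f : R -> R).

Lemma L2B_weaken (V : lmodType R) (P Q : V -> Prop) (nP nQ : V -> R) a b z :
  seminormed P nP -> seminormed Q nQ -> (forall v, P v -> Q v) ->
  (forall v, P v -> nQ v <= nP v) -> L2B P nP a b z -> L2B Q nQ a b z.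
Proof.
move=> sP sQ PQ nPQ /(L2BP sP)[[Pz [s [ss sz]]] [mz zi]].
have bz : bmeas Q nQ a b z.
  split; first by apply: filterS Pz => t + ab => /(_ ab)/PQ.
  exists s; split=> [n|]; first by have [fs Ps ms] := ss n; split=> // t; exact: PQ.
  apply: filterS2 Pz sz => t + + ab => /(_ ab) Pt /(_ ab) sz.
  have Ps n : P (s n t) by have [_ + _] := ss n; apply.
  apply: (squeeze_cvgr (f := fun=> 0) _ _ sz); last exact: cvg_cst.
  apply: nearW => n; rewrite nPQ ?andbT; last exact: (smB sP).
  by apply: (sm_ge0 sQ); apply: PQ; exact: (smB sP).
apply/(L2BP sQ); split=> //; split; first exact: (bmeas_norm sQ).
apply: (@aeint_dom _ _ _ mu _ (mitv a b) _ _ _ _ zi).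
  by apply: aemeas_sqr; exact: (bmeas_norm sQ).
apply: filterS Pz => t + /= tab.
have ab : a < t < b by move: tab; rewrite in_itv.
move=> /(_ ab) Pt; rewrite ger0_norm ?sqr_ge0// ler_sqr ?nnegrE; first exact: nPQ.
  by apply: (sm_ge0 sQ); exact: PQ.
exact: (sm_ge0 sP).
Qed.

Lemma test_time_derive a b phi : test_fun_time a b phi ->
  test_fun_time a b (derive1 phi).
Proof.
move=> [dphi [C [cC Cab phi0]]]; split.
  by move=> n t; rewrite -derive1Sn; exact: dphi.
exists C; split=> // t Ct; rewrite derive1E.
have oC : open (~` C) by apply: closed_openC; exact: compact_closed.
rewrite (@near_eq_derive _ _ _ _ (cst 0)) ?derive_cst//.
have := oC; rewrite openE => /(_ t Ct); apply: filterS => y /phi0.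
by move=> ->.
Qed.

Lemma test_time_continuous a b phi : test_fun_time a b phi -> continuous phi.
Proof.
move=> [/(_ 0%N) dphi _] t; apply: (@differentiable_continuous _ _ _ t phi).
by apply/derivable1_diffP; exact: dphi.
Qed.

Lemma test_time_is_derive a b phi (t : R) : test_fun_time a b phi ->
  is_derive t (1 : R) phi (derive1 phi t).
Proof.
by move=> [/(_ 0%N t) dphi _]; apply: DeriveDef => //; rewrite derive1E.
Qed.

Lemma test_time_bounded a b phi : test_fun_time a b phi ->
  exists K, forall t, `|phi t| <= K.
Proof.
move=> tphi; have cphi := test_time_continuous tphi.
have [_ [C [cC _ phi0]]] := tphi.
have : compact (phi @` C) by apply: continuous_compact => //; exact: continuous_subspaceT.
move=> /compact_bounded[K [Kr HK]]; exists (`|K| + 1) => t.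
have K0 : 0 <= `|K| + 1 by rewrite addr_ge0.
have [tC|/phi0 ->] := pselect (C t); last by rewrite normr0.
apply: HK; last by exists t.
by rewrite (le_lt_trans (ler_norm K))// ltrDl.
Qed.

Lemma bounded_mul_aeint a b phi f (K : R) : measurable_fun setT phi ->
  (forall t, `|phi t| <= K) ->
  aeint mu `]a, b[%classic f -> aeint mu `]a, b[%classic (fun t => phi t * f t).
Proof.
move=> mphi phiK fi; have := aeintZ (mitv a b) K (aeint_norm fi).
apply: (@aeint_dom _ _ _ mu _ (mitv a b)).
  apply: aemeasM; last exact: aeint_meas fi.
  by apply: measurable_aemeas; exact: measurable_funTS.
by apply: aeW => t _; rewrite normrM ler_wpM2r.
Qed.

Lemma test_time_mul_aeint a b a' b' phi f : test_fun_time a' b' phi ->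
  aeint mu `]a, b[%classic f -> aeint mu `]a, b[%classic (fun t => phi t * f t).
Proof.
move=> tphi; have [K HK] := test_time_bounded tphi.
apply: bounded_mul_aeint HK; apply: continuous_measurable_fun.
exact: test_time_continuous tphi.
Qed.

Lemma fundamental_lemma_time_ae a b f : aeint mu `]a, b[%classic f ->
  (forall phi, test_fun_time a b phi ->
    \int[mu]_(t in `]a, b[) (phi t * f t) = 0) ->
  {ae mu, forall t, a < t < b -> f t = 0}.
Proof.
move=> [g ig fg] fphi.
have : {ae mu, forall t, a < t < b -> g t = 0}.
  apply: fundamental_lemma_time => // phi tphi; rewrite -[RHS](fphi _ tphi).
  by apply: (ae_Rintegral (mitv a b)); apply: filterS fg => t + tab => ->.
by apply: filterS2 fg => t fgt gt tab; rewrite fgt ?gt//= in_itv.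
Qed.

Lemma test_time_sub a b a' b' phi : a <= a' -> b' <= b ->
  test_fun_time a' b' phi -> test_fun_time a b phi.
Proof.
move=> aa bb [dphi [C [cC Cab phi0]]]; split=> //; exists C; split=> // t /Cab /=.
by rewrite !in_itv/= => /andP[h1 h2]; rewrite (le_lt_trans aa h1) (lt_le_trans h2 bb).
Qed.

Lemma test_time_sub_integral a b a' b' phi f : a <= a' -> b' <= b ->
  test_fun_time a' b' phi ->
  \int[mu]_(t in `]a, b[) (phi t * f t) = \int[mu]_(t in `]a', b'[) (phi t * f t).
Proof.
move=> aa bb [dphi [C [cC Cab phi0]]].
rewrite [LHS]Rintegral_mkcond [RHS]Rintegral_mkcond.
apply: eq_Rintegral => t _; rewrite !patchE.
have [tC|/phi0->] := pselect (C t); last by rewrite mul0r !if_same.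
have t' := Cab _ tC; rewrite !mem_set//.
move: t'; rewrite /= !in_itv/= => /andP[h1 h2].
by rewrite (le_lt_trans aa h1) (lt_le_trans h2 bb).
Qed.

Lemma test_time_bnd a b phi : test_fun_time a b phi -> phi a = 0 /\ phi b = 0.
Proof.
move=> [_ [C [_ Cab phi0]]]; split; apply: phi0 => /Cab /=; rewrite in_itv/= ltxx//.
by rewrite andbF.
Qed.

Lemma Rintegral_FTC a b f F : a < b -> continuous f ->
  (forall t : R, is_derive t (1 : R) F (f t)) ->
  \int[mu]_(t in `]a, b[) f t = F b - F a.
Proof.
move=> ab cf dF.
have fi : mu.-integrable `[a, b]%classic (EFin \o f).
  apply: continuous_compact_integrable; first exact: segment_compact.
  exact: continuous_subspaceT.
have := continuous_is_derive_FTC ab cf dF => E.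
rewrite Rintegral_itv_bndo_bndc; last first.
  apply: integrableS fi => //; exact: subset_itv_oo_cc.
rewrite Rintegral_itv_obnd_cbnd; last first.
  apply: integrableS fi => //; exact: subset_itv_oc_cc.
by rewrite /Rintegral E.
Qed.

End time_test_functions.

Section time_derivative.
Context (R : realType) (d : nat).
Local Notation E := 'rV[R]_d.
Local Notation mu := (@lebesgue_measure R).
Context (Om : set E).
Hypothesis oOm : open Om.
Hypothesis bOm : bounded_set Om.
Implicit Types (a b : R) (z : R -> E -> R) (g : R -> (E -> R) -> R) (v w : E -> R).

Let sL2 := L2_seminormed oOm.
Let sH := H10_seminormed oOm bOm.
Let pH := Hm1_pairing oOm bOm.
Let sHm := prP pH.

Lemma L2_H10_L2 a b z : L2_H10 Om a b z -> L2_L2 Om a b z.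
Proof.
apply: L2B_weaken; [exact: sH|exact: sL2|exact: H10_L2|].
by move=> v /H10_H1; exact: L2norm_le_H1norm.
Qed.

Lemma Hm1_apply_aeint a b g v : L2_Hm1 Om a b g -> H10 Om v ->
  aeint mu `]a, b[%classic (fun t => g t v).
Proof. by move=> Lg Hv; apply: (pairing_aeint pH Lg); exact: L2B_cst. Qed.

Lemma ip_apply_aeint a b z v : L2_L2 Om a b z -> L2 Om v ->
  aeint mu `]a, b[%classic (fun t => ip Om (z t) v).
Proof.
move=> Lz Lv; apply: (pairing_aeint (L2_pairing oOm) Lz).
exact: (L2B_cst sL2).
Qed.

(** Membership of [f] is a premise of the last clause only, so that [choice] selects norming vectors
    for all [f] at once; a functional outside H^{-1} receives the vector 0. *)
Lemma Hm1_norming f n : exists v, [/\ H10 Om v, H1norm Om v <= 1 &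
  Hm1 Om f -> Hm1norm Om f <= `|f v| + n.+1%:R^-1].
Proof.
have [Hf|nHf] := pselect (Hm1 Om f); last first.
  exists 0; split=> //; first exact: H100.
  rewrite -(scale0r 0) (sm_nrmZ sH); last exact: H100.
  by rewrite normr0 mul0r.
have n0 : (0 : R) < n.+1%:R^-1 by rewrite invr_gt0.
have [_ [v [Hv v1] <-] fv] := sup_adherent n0 (Hm1_has_sup oOm bOm Hf).
by exists v; split=> // _; rewrite -lerBlDr ltW.
Qed.

(** The null set in the premise depends on [v], and there are uncountably many [v]. Instead of a
    dense sequence in H^1_0, the proof uses vectors that nearly attain the norms of the countably
    many values of the simple functions [s n]. Off one null set [g t] vanishes on all of these
    vectors, so the norm of [s n t] is at most that of [s n t - g t], and the norm of [g t] is at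
    most twice that. *)
Lemma L2_Hm1_eq0 a b g : L2_Hm1 Om a b g ->
  (forall v, H10 Om v -> {ae mu, forall t, a < t < b -> g t v = 0}) ->
  {ae mu, forall t, a < t < b -> forall v, H10 Om v -> g t v = 0}.
Proof.
move=> [Hg [s [ss sg]] _] g0.
have [vf vfP] := choice (fun fn : ((E -> R) -> R) * nat => Hm1_norming fn.1 fn.2).
have [r rE] := choice (fun n => proj1 (finite_seqP _) (let: And3 h _ _ := ss n in h)).
have all : {ae mu, forall t, forall n k j, a < t < b ->
    g t (vf (nth 0 (r n) k, j)) = 0}.
  apply: ae_foralln => n; apply: ae_foralln => k; apply: ae_foralln => j.
  by apply: g0; case: (vfP (nth 0 (r n) k, j)).
apply: filterS3 Hg sg all => t + + all ab v Hv.
move=> /(_ ab) Hg /(_ ab) sg.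
have Hs n : Hm1 Om (s n t) by have [_ + _] := ss n; apply.
have HB n : Hm1 Om (s n t - g t) by exact: (smB sHm).
have sn n : Hm1norm Om (s n t) <= Hm1norm Om (s n t - g t).
  apply/ler_addgt0Pr => e e0.
  have : [set` r n] (s n t) by rewrite -rE; exists t.
  move=> /= /nthP -/(_ 0)[k kr kE].
  pose j := Num.truncn e^-1.
  have je : j.+1%:R^-1 < e by rewrite invf_plt ?posrE// truncnS_gt.
  move: (vfP (nth 0 (r n) k, j)) (all n k j ab) => /=; rewrite kE.
  set w := vf _ => -[Hw w1 /(_ (Hs n)) sw] gw.
  rewrite (le_trans sw)// lerD ?(ltW je)//.
  have -> : s n t w = (s n t - g t) w.
    by rewrite -[RHS]/(s n t w - g t w) gw subr0.
  rewrite (le_trans (Hm1_bound oOm bOm (HB n) Hw))//.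
  by rewrite ler_piMr//; exact: (Hm1norm_ge0 oOm bOm).
suff g00 : Hm1norm Om (g t) <= 0.
  apply: (pr_eq0l pH) => //; apply/eqP.
  by rewrite eq_le g00 (Hm1norm_ge0 oOm bOm).
have c2 : (fun n => 2 * Hm1norm Om (s n t - g t)) @ \oo --> (0 : R).
  by rewrite -[X in _ --> X](mulr0 2); apply: cvgM => //; exact: cvg_cst.
rewrite -(cvg_lim (@Rhausdorff R) c2); apply: limr_ge.
  by apply/cvg_ex; exists 0.
apply: nearW => n; rewrite -{1}(subKr (s n t) (g t)).
rewrite (le_trans (sm_nrmB sHm (Hs n) (HB n)))//.
by have := sn n; lra.
Qed.

(** [dt] is a choice; by uniqueness any explicit derivative may replace it under an integral. The
    difference is written with [(-1) *:] to reuse closure of [L2B] under sums and multiples. *)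
Lemma time_deriv_unique a b z g g' : is_time_deriv Om a b z g ->
  is_time_deriv Om a b z g' ->
  {ae mu, forall t, a < t < b -> forall v, H10 Om v -> g t v = g' t v}.
Proof.
move=> [Lg zg] [Lg' zg'].
have LN : L2_Hm1 Om a b (fun t => g t + (-1) *: g' t).
  by apply: (L2BD sHm) => //; exact: (L2BZ sHm).
have : {ae mu, forall t, a < t < b -> forall v, H10 Om v ->
    (g t + (-1) *: g' t) v = 0}.
  apply: (L2_Hm1_eq0 LN) => v Hv.
  apply: (fundamental_lemma_time_ae (Hm1_apply_aeint LN Hv)).
  move=> phi tphi.
  have i1 := test_time_mul_aeint tphi (Hm1_apply_aeint Lg Hv).
  have i2 := test_time_mul_aeint tphi (Hm1_apply_aeint Lg' Hv).
  transitivity (\int[mu]_(t in `]a, b[) (phi t * g t v - phi t * g' t v)).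
    apply: eq_Rintegral => t _; rewrite -mulrBr; congr (_ * _).
    by rewrite scaleN1r.
  rewrite (aeRintegralB (mitv a b) i1 i2); apply/eqP; rewrite subr_eq0 -eqr_opp.
  by rewrite -zg// -zg'.
apply: filterS => t gg ab v Hv; have := gg ab v Hv.
by rewrite scaleN1r -[LHS]/(g t v - g' t v) => /eqP; rewrite subr_eq0 => /eqP.
Qed.

Lemma dtP a b z : (exists g, is_time_deriv Om a b z g) ->
  is_time_deriv Om a b z (dt Om a b z).
Proof. by move=> [g zg]; apply: (xgetPex _ (P := is_time_deriv Om a b z)); exists g. Qed.

Lemma time_derivD a b z z' g g' : L2_L2 Om a b z -> L2_L2 Om a b z' ->
  is_time_deriv Om a b z g -> is_time_deriv Om a b z' g' ->
  is_time_deriv Om a b (z + z') (fun t => g t + g' t).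
Proof.
move=> Lz Lz' [Lg zg] [Lg' zg']; split; first exact: (L2BD sHm).
move=> phi tphi v Hv; have Lv := H10_L2 Hv.
have i1 := test_time_mul_aeint tphi (Hm1_apply_aeint Lg Hv).
have i2 := test_time_mul_aeint tphi (Hm1_apply_aeint Lg' Hv).
have j1 := test_time_mul_aeint (test_time_derive tphi) (ip_apply_aeint Lz Lv).
have j2 := test_time_mul_aeint (test_time_derive tphi) (ip_apply_aeint Lz' Lv).
transitivity (\int[mu]_(t in `]a, b[) (derive1 phi t * ip Om (z t) v +
    derive1 phi t * ip Om (z' t) v)).
  apply: (ae_Rintegral (mitv a b)).
  have [+ _ _] := Lz; have [+ _ _] := Lz'; apply: filterS2 => t + + tab.
  have ab : a < t < b by move: tab; rewrite /= in_itv.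
  move=> /(_ ab) p' /(_ ab) p; rewrite -mulrDr; congr (_ * _).
  exact: (sipD (L2_semi_ip oOm)).
rewrite (aeRintegralD (mitv a b) j1 j2) zg// zg'// -opprD; congr (- _).
rewrite -(aeRintegralD (mitv a b) i1 i2).
by apply: eq_Rintegral => t _; rewrite -mulrDr.
Qed.

Lemma time_derivZ a b (c : R) z g : L2_L2 Om a b z ->
  is_time_deriv Om a b z g ->
  is_time_deriv Om a b (c *: z) (fun t => c *: g t).
Proof.
move=> Lz [Lg zg]; split; first exact: (L2BZ sHm).
move=> phi tphi v Hv; have Lv := H10_L2 Hv.
have i1 := test_time_mul_aeint tphi (Hm1_apply_aeint Lg Hv).
have j1 := test_time_mul_aeint (test_time_derive tphi) (ip_apply_aeint Lz Lv).
transitivity (\int[mu]_(t in `]a, b[) (c * (derive1 phi t * ip Om (z t) v))).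
  apply: (ae_Rintegral (mitv a b)).
  have [+ _ _] := Lz; apply: filterS => t + tab.
  have ab : a < t < b by move: tab; rewrite /= in_itv.
  move=> /(_ ab) p; rewrite mulrCA; congr (_ * _).
  exact: (sipZ (L2_semi_ip oOm)).
rewrite (aeRintegralZ (mitv a b) c j1) zg// mulrN; congr (- _).
rewrite -(aeRintegralZ (mitv a b) c i1).
by apply: eq_Rintegral => t _; rewrite mulrCA.
Qed.

Lemma time_deriv_sub a b a' b' z g : a <= a' -> b' <= b ->
  is_time_deriv Om a b z g -> is_time_deriv Om a' b' z g.
Proof.
move=> aa bb [Lg zg]; split; first exact: (L2B_sub sHm aa bb Lg).
move=> phi tphi v Hv.
rewrite -(test_time_sub_integral _ aa bb (test_time_derive tphi)).
rewrite -(test_time_sub_integral _ aa bb tphi); apply: zg => //.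
exact: test_time_sub tphi.
Qed.

Lemma time_deriv_ae a b z z' g : (forall t, a < t < b -> z t = z' t) ->
  is_time_deriv Om a b z g -> is_time_deriv Om a b z' g.
Proof.
move=> zz' [Lg zg]; split; first exact: Lg.
move=> phi tphi v Hv; rewrite -(zg phi tphi v Hv).
by apply: eq_Rintegral => t; rewrite mem_setE => /zz' ->.
Qed.

Lemma ip_Hm1 w : L2 Om w -> Hm1 Om (ip Om w).
Proof.
move=> Lw; have pr := L2_pairing oOm; split.
  move=> c v v' /H10_L2 Hv /H10_L2 Hv'.
  by rewrite (prDr pr) ?(prZr pr)//; exact: (smZ sL2).
exists (L2norm Om w) => v Hv.
rewrite (le_trans (pr_bound pr Lw (H10_L2 Hv)))// ler_wpM2l//.
  exact: (sm_ge0 sL2).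
by apply: (L2norm_le_H1norm oOm bOm); exact: H10_H1.
Qed.

Lemma bounded_sqint a b (th : R -> R) (K : R) : measurable_fun setT th ->
  (forall t, a < t < b -> `|th t| <= K) -> sqint mu `]a, b[%classic th.
Proof.
move=> mth thK; have [mK iK] := sqint_cst (mitv a b) K (itv_finite a b).
split; first by apply: measurable_aemeas; exact: measurable_funTS.
apply: (@aeint_dom _ _ _ mu _ (mitv a b) _ _ _ _ iK).
  by apply: aemeas_sqr; apply: measurable_aemeas; exact: measurable_funTS.
apply: aeW => t /=; rewrite in_itv => /thK tK.
by rewrite normrX ler_sqr ?nnegrE// (le_trans _ tK).
Qed.

Lemma continuous_sqint a b (th : R -> R) : continuous th ->
  sqint mu `]a, b[%classic th.
Proof.
move=> cth; have : compact (th @` `[a, b]%classic).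
  apply: continuous_compact; first exact: continuous_subspaceT.
  exact: segment_compact.
move=> /compact_bounded[K [Kr HK]].
apply: (@bounded_sqint _ _ _ (`|K| + 1)); first exact: continuous_measurable_fun.
move=> t /andP[h1 h2]; apply: HK.
  by rewrite (le_lt_trans (ler_norm K))// ltrDl.
by exists t => //=; rewrite in_itv/= !ltW.
Qed.

Lemma time_deriv_scale a b (th th' : R -> R) w : a < b ->
  continuous th' -> (forall t : R, is_derive t (1 : R) th (th' t)) -> L2 Om w ->
  is_time_deriv Om a b (fun t => th t *: w) (fun t => th' t *: ip Om w).
Proof.
move=> ab cth' dth Lw; split.
  apply: (L2B_scale sHm); [exact: continuous_measurable_fun| |exact: ip_Hm1].
  exact: continuous_sqint.
move=> phi tphi v Hv; have Lv := H10_L2 Hv.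
have cth : continuous th.
  move=> t; apply: (@differentiable_continuous _ _ _ t th).
  by apply/derivable1_diffP; case: (dth t).
have cphi := test_time_continuous tphi.
have tphi' := test_time_derive tphi; have cphi' := test_time_continuous tphi'.
have iC f : continuous f -> aeint mu `]a, b[%classic f.
  move=> cf; apply: (sqint_aeint (mitv a b) (itv_finite a b)).
  exact: continuous_sqint.
have i1 : aeint mu `]a, b[%classic (fun t => derive1 phi t * th t).
  by apply: (test_time_mul_aeint tphi'); exact: iC.
have i2 : aeint mu `]a, b[%classic (fun t => phi t * th' t).
  by apply: (test_time_mul_aeint tphi); exact: iC.
have sip := L2_semi_ip oOm.
transitivity (ip Om w v * \int[mu]_(t in `]a, b[) (derive1 phi t * th t)).
  rewrite -(aeRintegralZ (mitv a b) _ i1); apply: eq_Rintegral => t _.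
  by rewrite (sipZ sip)//; ring.
transitivity (ip Om w v * - \int[mu]_(t in `]a, b[) (phi t * th' t)); last first.
  rewrite mulrN; congr (- _); rewrite -(aeRintegralZ (mitv a b) _ i2).
  by apply: eq_Rintegral => t _; rewrite scalrfctE /GRing.scale/=; ring.
(* The sum of the two integrals is the integral of the derivative of [phi * th], which vanishes at
   both ends. *)
congr (_ * _); apply/eqP; rewrite -subr_eq0 opprK; apply/eqP.
rewrite -(aeRintegralD (mitv a b) i1 i2).
have dd (t : R) : is_derive t (1 : R) (phi * th) (derive1 phi t * th t + phi t * th' t).
  have := is_deriveM (test_time_is_derive t tphi) (dth t).
  by rewrite /GRing.scale/= addrC [th t * _]mulrC.
have cc : continuous (fun t => derive1 phi t * th t + phi t * th' t).
  move=> t; exact: (continuousD (continuousM (cphi' t) (cth t))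
    (continuousM (cphi t) (cth' t))).
rewrite (Rintegral_FTC ab cc dd); have [-> ->] : (phi * th) a = 0 /\ (phi * th) b = 0.
  by have [h1 h2] := test_time_bnd tphi; rewrite !mulrfctE h1 h2 !mul0r.
by rewrite subrr.
Qed.

Lemma time_deriv_cst a b w : a < b -> L2 Om w ->
  is_time_deriv Om a b (fun=> w) (fun=> 0).
Proof.
move=> ab Lw; have := @time_deriv_scale a b (fun=> 1) (fun=> 0) w ab.
rewrite scale1r scale0r; by apply => //; exact: cst_continuous.
Qed.

End time_derivative.

(** * Time grid and one-sided limits *)

Section cells.
Context (R : realType).
Local Notation mu := (@lebesgue_measure R).
Implicit Types (f : R -> R).

Lemma mitvoc (a b : R) : measurable
  (`]a, b]%classic : set (g_sigma_algebraType R.-ocitv.-measurable)).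
Proof. exact: measurable_itv. Qed.

Lemma Rintegral_oc_oo f a b :
  \int[mu]_(t in `]a, b]) f t = \int[mu]_(t in `]a, b[) f t.
Proof.
rewrite Rintegral_mkcond [RHS]Rintegral_mkcond.
apply: ae_Rintegral; first exact: measurableT.
exists [set b]; split; [exact: measurable_set1|exact: lebesgue_measure_set1|].
move=> t /= h; apply: contrapT => tb; apply: h => _; rewrite !patchE !mem_setE !in_itv/=.
rewrite le_eqVlt; case: eqP => [//|_].
by [].
Qed.

Context (N : nat) (tau : nat -> R).
Hypothesis tauS : forall l, (l < N)%N -> tau l < tau l.+1.

Lemma tau_le i j : (i <= j)%N -> (j <= N)%N -> tau i <= tau j.
Proof.
move=> ij; elim: j ij => [|j IH].
  by rewrite leqn0 => /eqP ->.
rewrite leq_eqVlt ltnS => /orP[/eqP ->//|ij] jN.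
by rewrite (le_trans (IH ij (ltnW jN)))// ltW// tauS.
Qed.

Lemma tau_lt i j : (i < j)%N -> (j <= N)%N -> tau i < tau j.
Proof.
move=> ij jN; rewrite (lt_le_trans (tauS (leq_trans ij jN)))//.
exact: tau_le.
Qed.

Lemma cell_mem t : tau 0 < t <= tau N -> exists2 l, (l < N)%N & cell tau l t.
Proof.
move=> /andP[t0 tN].
have : exists n, (n <= N)%N && (t <= tau n) by exists N; rewrite leqnn.
move=> /ex_minnP[[|l] /andP[lN tl] min]; first by rewrite leNgt t0 in tl.
exists l => //; rewrite /cell /= in_itv/= tl andbT ltNge; apply/negP => tl'.
by have := min l; rewrite tl' (ltnW lN) ltnn => /(_ isT).
Qed.

Lemma sum_cells f n : (n <= N)%N -> (0 < n)%N ->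
  aeint mu `]tau 0%N, tau N[%classic f ->
  \sum_(0 <= l < n) \int[mu]_(t in cell tau l) f t =
  \int[mu]_(t in `]tau 0%N, tau n[) f t.
Proof.
move=> + + fi; elim: n => // -[|n] IH nN _.
  by rewrite big_nat1 Rintegral_oc_oo.
have nN' : (n.+1 <= N)%N by apply: leq_trans nN; exact: leqnSn.
rewrite big_nat_recr; last exact: leq0n.
rewrite [LHS]/= (IH nN' isT) Rintegral_oc_oo.
have t0 : tau 0%N < tau n.+1 by exact: tau_lt.
have t1 : tau n.+1 < tau n.+2 by exact: tauS.
have Ei : (`]tau 0%N, tau n.+2[ = `]tau 0%N, tau n.+1] `|` `]tau n.+1, tau n.+2[)%classic.
  apply/seteqP; split=> t /=; rewrite !in_itv/=.
    by move=> /andP[h1 h2]; case: (leP t (tau n.+1)) => h; [left|right];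
      rewrite ?h1 ?h2.
  move=> [] /andP[h1 h2]; first by rewrite h1 (le_lt_trans h2).
  by rewrite h2 (lt_trans t0).
have fi' : aeint mu (`]tau 0%N, tau n.+1] `|` `]tau n.+1, tau n.+2[)%classic f.
  rewrite -Ei; apply: (aeintS (mitv _ _) (mitv _ _) _ fi).
  move=> t /=; rewrite !in_itv/= => /andP[-> h] /=.
  by rewrite (lt_le_trans h)// tau_le.
rewrite Ei -(Rintegral_oc_oo f (tau 0) (tau n.+1)) -(aeRintegral_setU (mitvoc _ _)
  (mitv _ _) fi')//.
apply/disj_setPS => t [] /=; rewrite !in_itv/= => /andP[_ h] /andP[h' _].
by rewrite ltNge h in h'.
Qed.

End cells.

Section one_sided_limits.
Context (R : realType) (d : nat).
Local Notation E := 'rV[R]_d.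
Context (Om : set E).
Hypothesis oOm : open Om.
Implicit Types (f : R -> E -> R) (v w : E -> R).

Let sL2 := L2_seminormed oOm.
Let pL2 := L2_pairing oOm.

(* [rlim] and [llim] are the instances f s = z (t + s) and f s = z (t - s). *)
Definition lim0 f : E -> R := xget 0 [set w | L2 Om w /\
    (fun s => L2norm Om (f s - w)) @ 0^'+ --> (0 : R)].

(** The middle condition does not occur in [lim0]; it makes the triangle inequality applicable to
    [f s], the seminorm being controlled on members only. *)
Definition haslim f w := [/\ L2 Om w, \forall s \near 0^'+, L2 Om (f s) &
  (fun s => L2norm Om (f s - w)) @ 0^'+ --> (0 : R)].

Lemma squeeze0 (f g : R -> R) : (\forall s \near 0^'+, 0 <= f s <= g s) ->
  g @ 0^'+ --> (0 : R) -> f @ 0^'+ --> (0 : R).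
Proof. by move=> fg g0; apply: (squeeze_cvgr fg _ g0); exact: cvg_cst. Qed.

Lemma haslim_unique f w w' : haslim f w -> L2 Om w' ->
  (fun s => L2norm Om (f s - w')) @ 0^'+ --> (0 : R) -> L2norm Om (w' - w) = 0.
Proof.
move=> [Lw Lf fw] Lw' fw'.
have : (fun=> L2norm Om (w' - w)) @ (0 : R)^'+ --> (0 : R).
  apply: (@squeeze0 _ (fun s => L2norm Om (f s - w) + L2norm Om (f s - w'))).
    apply: filterS Lf => s Lf.
    rewrite (sm_ge0 sL2 (smB sL2 Lw' Lw))/=.
    rewrite (_ : w' - w = (f s - w) - (f s - w')); last first.
      by rewrite opprB [RHS]addrC addrA subrK.
    by apply: (sm_nrmB sL2); exact: (smB sL2).
  by rewrite -[X in _ --> X]addr0; exact: cvgD.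
by move=> /cvg_lim <-//; rewrite lim_cst.
Qed.

Lemma lim0P f w : haslim f w -> L2 Om (lim0 f) /\ L2norm Om (lim0 f - w) = 0.
Proof.
move=> fw; have [Lw Lf cfw] := fw.
have := xgetPex 0 (ex_intro [set w | L2 Om w /\
    (fun s => L2norm Om (f s - w)) @ 0^'+ --> (0 : R)] w (conj Lw cfw)).
by rewrite -/(lim0 f) => -[L1 c1]; split=> //; exact: (haslim_unique fw).
Qed.

Lemma haslimD f f' w w' : haslim f w -> haslim f' w' ->
  haslim (fun s => f s + f' s) (w + w').
Proof.
move=> [Lw Lf fw] [Lw' Lf' fw']; split; first exact: (smD sL2).
  by apply: filterS2 Lf Lf' => s; exact: (smD sL2).
apply: (@squeeze0 _ (fun s => L2norm Om (f s - w) + L2norm Om (f' s - w'))).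
  apply: filterS2 Lf Lf' => s Ls Ls'; rewrite opprD addrACA.
  have L1 := smB sL2 Ls Lw; have L2' := smB sL2 Ls' Lw'.
  by rewrite (sm_ge0 sL2 (smD sL2 L1 L2'))/= (sm_nrmD sL2).
by rewrite -[X in _ --> X]addr0; exact: cvgD.
Qed.

Lemma haslimZ (c : R) f w : haslim f w -> haslim (fun s => c *: f s) (c *: w).
Proof.
move=> [Lw Lf fw]; split; first exact: (smZ sL2).
  by apply: filterS Lf => s; exact: (smZ sL2).
apply: (@squeeze0 _ (fun s => `|c| * L2norm Om (f s - w))).
  apply: filterS Lf => s Ls.
  have L1 := smB sL2 Ls Lw.
  rewrite -scalerBr (sm_nrmZ sL2 c L1) lexx andbT.
  by rewrite mulr_ge0// (sm_ge0 sL2 L1).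
by rewrite -[X in _ --> X](mulr0 `|c|); apply: cvgM => //; exact: cvg_cst.
Qed.

Lemma haslim_cst f w : L2 Om w -> (\forall s \near 0^'+, f s = w) -> haslim f w.
Proof.
move=> Lw fw; split=> //; first by apply: filterS fw => s ->.
apply: cvg_near_cst; apply: filterS fw => s ->.
by rewrite subrr -(scale0r w) (sm_nrmZ sL2)// normr0 mul0r.
Qed.

Lemma ip_lim0 f w v : haslim f w -> L2 Om v -> ip Om (lim0 f) v = ip Om w v.
Proof.
move=> fw Lv; have [L0 n0] := lim0P fw; have [Lw _ _] := fw.
apply/eqP; rewrite -subr_eq0 -(prBl pL2)//; apply/eqP.
by apply: (pr_eq0l pL2) => //; exact: (smB sL2).
Qed.

Lemma ip_lim0r f w v : haslim f w -> L2 Om v -> ip Om v (lim0 f) = ip Om v w.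
Proof.
by move=> fw Lv; rewrite (sipC (L2_semi_ip oOm)) (ip_lim0 fw)// (sipC (L2_semi_ip oOm)).
Qed.

End one_sided_limits.

(** * The discrete Lagrangian as a quadratic functional *)

Section bilinear_forms.
Context (R : realType).

Record bilin (V W : lmodType R) (P : V -> Prop) (Q : W -> Prop)
    (B : V -> W -> R) : Prop := Bilin {
  blDl : forall u v w, P u -> P v -> Q w -> B (u + v) w = B u w + B v w;
  blZl : forall c v w, P v -> Q w -> B (c *: v) w = c * B v w;
  blDr : forall v w z, P v -> Q w -> Q z -> B v (w + z) = B v w + B v z;
  blZr : forall c v w, P v -> Q w -> B v (c *: w) = c * B v w }.

Record lin (V : lmodType R) (P : V -> Prop) (f : V -> R) : Prop := Lin {
  liD : forall u v, P u -> P v -> f (u + v) = f u + f v;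
  liZ : forall c v, P v -> f (c *: v) = c * f v }.

Section theory.
Context (V W : lmodType R) (P : V -> Prop) (Q : W -> Prop).
Implicit Types (B : V -> W -> R).

Lemma bilinD B B' : bilin P Q B -> bilin P Q B' ->
  bilin P Q (fun v w => B v w + B' v w).
Proof.
move=> [Dl Zl Dr Zr] [Dl' Zl' Dr' Zr']; split=> *.
- by rewrite Dl// Dl'// addrACA.
- by rewrite Zl// Zl'// mulrDr.
- by rewrite Dr// Dr'// addrACA.
- by rewrite Zr// Zr'// mulrDr.
Qed.

Lemma bilinZ c B : bilin P Q B -> bilin P Q (fun v w => c * B v w).
Proof.
move=> [Dl Zl Dr Zr]; split=> *.
- by rewrite Dl// mulrDr.
- by rewrite Zl// mulrCA.
- by rewrite Dr// mulrDr.
- by rewrite Zr// mulrCA.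
Qed.

Lemma bilinN B : bilin P Q B -> bilin P Q (fun v w => - B v w).
Proof.
move=> /(bilinZ (-1)); rewrite (_ : (fun v w => _) = fun v w => - B v w)//.
by apply/funext => v; apply/funext => w; rewrite mulN1r.
Qed.

Lemma bilin_sum m n (B : nat -> V -> W -> R) :
  (forall l, (m <= l < n)%N -> bilin P Q (B l)) ->
  bilin P Q (fun v w => \sum_(m <= l < n) B l v w).
Proof.
move=> bB; split=> *.
- by rewrite -big_split/=; apply: eq_big_nat => l /bB[Dl Zl Dr Zr]; rewrite Dl.
- by rewrite mulr_sumr; apply: eq_big_nat => l /bB[Dl Zl Dr Zr]; rewrite Zl.
- by rewrite -big_split/=; apply: eq_big_nat => l /bB[Dl Zl Dr Zr]; rewrite Dr.
- by rewrite mulr_sumr; apply: eq_big_nat => l /bB[Dl Zl Dr Zr]; rewrite Zr.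
Qed.

Lemma bl0l B w : bilin P Q B -> P 0 -> Q w -> B 0 w = 0.
Proof. by move=> bB P0 Qw; rewrite -(scale0r 0) (blZl bB)// mul0r. Qed.

Lemma bl0r B v : bilin P Q B -> P v -> Q 0 -> B v 0 = 0.
Proof. by move=> bB Pv Q0; rewrite -(scale0r 0) (blZr bB)// mul0r. Qed.

Lemma lin0 (f : V -> R) : lin P f -> P 0 -> f 0 = 0.
Proof. by move=> lf P0; rewrite -(scale0r 0) (liZ lf)// mul0r. Qed.

End theory.

Local Notation mu := (@lebesgue_measure R).

Lemma pairing_int_bilin (V W : lmodType R) (P : V -> Prop) (nP : V -> R)
    (Q : W -> Prop) (nQ : W -> R) (B : V -> W -> R) (a b : R) :
  pairing P nP Q nQ B ->
  bilin (L2B P nP a b : (R -> V) -> Prop) (L2B Q nQ a b : (R -> W) -> Prop)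
    (fun f z => \int[mu]_(t in `]a, b[) B (f t) (z t)).
Proof.
move=> pr.
have oo t : (`]a, b[%classic : set R) t -> a < t < b by rewrite /= in_itv.
split=> [f f' z Lf Lf' Lz|c f z Lf Lz|f z z' Lf Lz Lz'|c f z Lf Lz].
- rewrite -(aeRintegralD (mitv a b) (pairing_aeint pr Lf Lz) (pairing_aeint pr Lf' Lz)).
  apply: (ae_Rintegral (mitv a b)).
  have [h1 _ _] := Lf; have [h2 _ _] := Lf'; have [h3 _ _] := Lz.
  apply: filterS3 h1 h2 h3 => t + + + /oo ab => /(_ ab) ? /(_ ab) ? /(_ ab) ?.
  exact: (prDl pr).
- rewrite -(aeRintegralZ (mitv a b) c (pairing_aeint pr Lf Lz)).
  apply: (ae_Rintegral (mitv a b)); have [h1 _ _] := Lf; have [h3 _ _] := Lz.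
  apply: filterS2 h1 h3 => t + + /oo ab => /(_ ab) ? /(_ ab) ?.
  exact: (prZl pr).
- rewrite -(aeRintegralD (mitv a b) (pairing_aeint pr Lf Lz) (pairing_aeint pr Lf Lz')).
  apply: (ae_Rintegral (mitv a b)).
  have [h1 _ _] := Lf; have [h2 _ _] := Lz'; have [h3 _ _] := Lz.
  apply: filterS3 h1 h2 h3 => t + + + /oo ab => /(_ ab) ? /(_ ab) ? /(_ ab) ?.
  exact: (prDr pr).
- rewrite -(aeRintegralZ (mitv a b) c (pairing_aeint pr Lf Lz)).
  apply: (ae_Rintegral (mitv a b)); have [h1 _ _] := Lf; have [h3 _ _] := Lz.
  apply: filterS2 h1 h3 => t + + /oo ab => /(_ ab) ? /(_ ab) ?.
  exact: (prZr pr).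
Qed.

Lemma aeint_integrable d (T : measurableType d) (m : {measure set T -> \bar R})
    (D : set T) (f : T -> R) : measurable D -> measurable_fun D f ->
  aeint m D f -> m.-integrable D (EFin \o f).
Proof.
move=> mD mf [g ig fg]; apply/integrableP; split; first exact/measurable_EFinP.
have /integrableP[_] := ig; congr (_ < _)%E.
by apply: ae_integral => //; apply: filterS fg => x + Dx => /= ->.
Qed.

Section scalar_controls.
Context (T : R).
Local Notation D := (`]0, T[%classic : set R).

Lemma L2t_sqint a b u : 0 <= a -> b <= T -> L2t 0 T u ->
  sqint mu `]a, b[%classic u.
Proof.
move=> a0 bT [mu_ iu].
have sub : `]a, b[%classic `<=` D.
  move=> t /=; rewrite !in_itv/= => /andP[h1 h2].
  by rewrite (le_lt_trans a0 h1) (lt_le_trans h2 bT).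
split; first by apply: measurable_aemeas; exact: measurable_funS mu_.
apply: (aeintS (mitv 0 T) (mitv a b) sub).
exact: integrable_aeint.
Qed.

Lemma sqint_L2t u : measurable_fun D u -> sqint mu D u -> L2t 0 T u.
Proof.
move=> mu_ [_ iu]; split=> //; apply: (aeint_integrable (mitv 0 T)) iu.
exact: measurable_funX.
Qed.

Lemma L2tD u v : L2t 0 T u -> L2t 0 T v -> L2t 0 T (u + v).
Proof.
move=> Lu Lv; apply: sqint_L2t; first by apply: measurable_funD; [case: Lu|case: Lv].
by apply: (sqintD (mitv 0 T)); exact: L2t_sqint.
Qed.

Lemma L2tZ c u : L2t 0 T u -> L2t 0 T (c *: u).
Proof.
move=> Lu; apply: sqint_L2t; first by apply: measurable_funM => //; case: Lu.
by apply: (sqintZ (mitv 0 T)); exact: L2t_sqint.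
Qed.

Lemma L2t0 : L2t 0 T 0.
Proof.
apply: sqint_L2t; first exact: measurable_cst.
exact: (sqint_cst (mitv 0 T) 0 (itv_finite 0 T)).
Qed.

Lemma L2t_mul u v : L2t 0 T u -> L2t 0 T v -> aeint mu D (fun t => u t * v t).
Proof. by move=> Lu Lv; apply: (sqint_mul (mitv 0 T)); exact: L2t_sqint. Qed.

Lemma L2t_aeint a b u : 0 <= a -> b <= T -> L2t 0 T u -> aeint mu `]a, b[%classic u.
Proof.
move=> a0 bT Lu; apply: (sqint_aeint (mitv a b) (itv_finite a b)).
exact: L2t_sqint.
Qed.

Lemma L2t_mul_bilin : bilin (L2t 0 T : (R -> R) -> Prop) (L2t 0 T : (R -> R) -> Prop)
  (fun u v => \int[mu]_(t in `]0, T[) (u t * v t)).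
Proof.
split=> [u u' v Lu Lu' Lv|c u v Lu Lv|u v v' Lu Lv Lv'|c u v Lu Lv].
- rewrite -(aeRintegralD (mitv 0 T) (L2t_mul Lu Lv) (L2t_mul Lu' Lv)).
  by apply: eq_Rintegral => t _; rewrite -mulrDl.
- rewrite -(aeRintegralZ (mitv 0 T) c (L2t_mul Lu Lv)).
  by apply: eq_Rintegral => t _; rewrite mulrA.
- rewrite -(aeRintegralD (mitv 0 T) (L2t_mul Lu Lv) (L2t_mul Lu Lv')).
  by apply: eq_Rintegral => t _; rewrite -mulrDr.
- rewrite -(aeRintegralZ (mitv 0 T) c (L2t_mul Lu Lv)).
  by apply: eq_Rintegral => t _; rewrite mulrCA.
Qed.

Lemma L2t_int_lin : lin (L2t 0 T : (R -> R) -> Prop)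
  (fun u => \int[mu]_(t in `]0, T[) u t).
Proof.
have i u : L2t 0 T u -> aeint mu D u by exact: L2t_aeint.
split=> [u v Lu Lv|c u Lu].
- by rewrite -(aeRintegralD (mitv 0 T) (i _ Lu) (i _ Lv)).
- by rewrite -(aeRintegralZ (mitv 0 T) c (i _ Lu)).
Qed.

Lemma Gop_lin k (m : 'I_k -> nat) (I : forall l, 'I_(m l) -> interval R)
    (a : forall l, 'cV[R]_(m l)) :
  (forall l i, [set` I l i] `<=` D) ->
  bilin (fun _ : 'cV[R]_k => True) (L2t 0 T : (R -> R) -> Prop)
    (fun lam u => (lam^T *m Gop I a u) ord0 ord0).
Proof.
move=> ID.
have mI (i : interval R) : measurable ([set` i] : set
  (g_sigma_algebraType R.-ocitv.-measurable)) by exact: measurable_itv.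
have ii l i u : L2t 0 T u -> aeint mu [set` I l i] u.
  by move=> Lu; apply: (aeintS (mitv 0 T) (mI _) (@ID l i)); exact: L2t_aeint.
have GD u v : L2t 0 T u -> L2t 0 T v -> Gop I a (u + v) = Gop I a u + Gop I a v.
  move=> Lu Lv; apply/colP => l; rewrite !mxE -big_split/=.
  apply: eq_bigr => j _; rewrite !mxE -mulrDr -mulrDr; congr (_ * (_ * _)).
  by rewrite -(aeRintegralD (mI _) (ii _ _ _ Lu) (ii _ _ _ Lv)).
have GZ c u : L2t 0 T u -> Gop I a (c *: u) = c *: Gop I a u.
  move=> Lu; apply/colP => l; rewrite !mxE mulr_sumr.
  apply: eq_bigr => j _; rewrite !mxE [RHS]mulrCA; congr (_ * _).
  rewrite [RHS]mulrCA; congr (_ * _).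
  by rewrite -(aeRintegralZ (mI _) c (ii _ _ _ Lu)).
split=> [l l' u _ _ Lu|c l u _ Lu|l u v _ Lu Lv|c l u _ Lu].
- by rewrite linearD/= mulmxDl mxE.
- by rewrite linearZ/= -scalemxAl mxE.
- by rewrite GD// mulmxDr mxE.
- by rewrite GZ// -scalemxAr mxE.
Qed.

End scalar_controls.
End bilinear_forms.

(** * Piecewise regular states and their bilinear forms *)

Section state_class.
Context (R : realType) (d : nat).
Local Notation E := 'rV[R]_d.
Local Notation mu := (@lebesgue_measure R).
Context (Om : set E).
Hypothesis oOm : open Om.
Hypothesis bOm : bounded_set Om.
Context (T : R) (N : nat) (tau : nat -> R) (mesh : nat -> set (set E)).
Hypothesis tau0 : tau 0%N = 0.
Hypothesis tauN : tau N = T.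
Hypothesis tauS : forall l, (l < N)%N -> tau l < tau l.+1.
Implicit Types (z y p : R -> E -> R) (v w : E -> R).

Let sL2 := L2_seminormed oOm.
Let sH := H10_seminormed oOm bOm.
Let pH := Hm1_pairing oOm bOm.
Let pG := H10_grad_pairing oOm bOm.

Lemma tau_ge0 l : (l <= N)%N -> 0 <= tau l.
Proof. by move=> lN; rewrite -tau0; exact: (tau_le tauS). Qed.

Lemma tau_leT l : (l <= N)%N -> tau l <= T.
Proof. by move=> lN; rewrite -tauN; exact: (tau_le tauS). Qed.

(* Functions that are piecewise smooth enough for [Lagr_t] to be a quadratic
   functional; both W(0,T) and X_{s,h} are contained in this space. *)
Record piecewise z : Prop := Piecewise {
  pwL2 : L2_L2 Om 0 T z;
  pwH : forall l, (l < N)%N -> L2_H10 Om (tau l) (tau l.+1) z;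
  pwdt : forall l, (l < N)%N -> exists g, is_time_deriv Om (tau l) (tau l.+1) z g;
  pwr : forall l, (l < N)%N -> exists w, haslim Om (fun s => z (tau l + s)) w;
  pwl : forall l, (0 < l < N)%N -> exists w, haslim Om (fun s => z (tau l - s)) w }.

Lemma L2_sub_cell l z : (l < N)%N -> L2_L2 Om 0 T z ->
  L2_L2 Om (tau l) (tau l.+1) z.
Proof.
move=> lN; apply: (L2B_sub sL2); first by apply: tau_ge0; exact: ltnW.
exact: tau_leT.
Qed.

Lemma piecewiseD z z' : piecewise z -> piecewise z' -> piecewise (z + z').
Proof.
move=> [L H D r l] [L' H' D' r' l']; split=> [|i iN|i iN|i iN|i iN].
- exact: (L2BD sL2 L L').
- exact: (L2BD sH (H i iN) (H' i iN)).
- have [g Hg] := D i iN; have [g' Hg'] := D' i iN; exists (fun t => g t + g' t).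
  exact: (time_derivD oOm bOm (L2_sub_cell iN L) (L2_sub_cell iN L') Hg Hg').
- have [w Hw] := r i iN; have [w' Hw'] := r' i iN.
  by exists (w + w'); exact: (haslimD oOm Hw Hw').
- have [w Hw] := l i iN; have [w' Hw'] := l' i iN.
  by exists (w + w'); exact: (haslimD oOm Hw Hw').
Qed.

Lemma piecewiseZ (c : R) z : piecewise z -> piecewise (c *: z).
Proof.
move=> [L H D r l]; split=> [|i iN|i iN|i iN|i iN].
- exact: (L2BZ sL2 c L).
- exact: (L2BZ sH c (H i iN)).
- have [g Hg] := D i iN; exists (fun t => c *: g t).
  exact: (time_derivZ oOm bOm c (L2_sub_cell iN L) Hg).
- by have [w Hw] := r i iN; exists (c *: w); exact: (haslimZ oOm c Hw).
- by have [w Hw] := l i iN; exists (c *: w); exact: (haslimZ oOm c Hw).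
Qed.

Lemma near0r (e : R) : 0 < e -> \forall s \near 0^'+, 0 < s < e.
Proof.
move=> e0; near=> s; apply/andP; split; first by near: s; exact: nbhs_right_gt.
by near: s; exact: nbhs_right_lt.
Unshelve. all: by end_near. Qed.

(** The slope [c] treats both sides at once: 1 for right limits, -1 for left limits. *)
Lemma W_haslim z (t c : R) : W Om T z -> 0 <= t <= T ->
  (\forall s \near 0^'+, 0 <= t + c * s <= T) ->
  haslim Om (fun s => z (t + c * s)) (z t).
Proof.
move=> [_ _ L2z cz] tT ns; split; first exact: L2z.
  by apply: filterS ns => s; exact: L2z.
have := cz t tT; apply: cvg_comp => A /= wA.
have c1 : (fun s : R => t + c * s) @ 0^'+ --> t.
  apply: cvg_at_right_filter.
  have h : (fun s : R => t + c * s) @ (0 : R) --> t + c * 0.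
    exact: (cvgD (cvg_cst t) (cvgM (cvg_cst c) cvg_id)).
  by rewrite mulr0 addr0 in h.
have := c1 _ wA; rewrite /= /nbhs /= => h.
near=> s; have : `[0, T]%classic (t + c * s).
  by rewrite /= in_itv/=; near: s.
by near: s.
Unshelve. all: by end_near. Qed.

Lemma W_haslimr z t : W Om T z -> 0 <= t < T ->
  haslim Om (fun s => z (t + s)) (z t).
Proof.
move=> Wz /andP[t0 tT].
have := @W_haslim z t 1 Wz; under [X in haslim _ X]eq_fun do rewrite mul1r.
apply; first by rewrite t0 ltW.
have e0 : 0 < T - t by rewrite subr_gt0.
apply: filterS (near0r e0) => s /andP[s0 sT].
by rewrite mul1r addr_ge0 ?(ltW s0)//=; lra.
Qed.

Lemma W_haslimL z t : W Om T z -> 0 < t <= T ->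
  haslim Om (fun s => z (t - s)) (z t).
Proof.
move=> Wz /andP[t0 tT].
have := @W_haslim z t (-1) Wz; under [X in haslim _ X]eq_fun do rewrite mulN1r.
apply; first by rewrite tT ltW.
apply: filterS (near0r t0) => s /andP[s0 sT].
by rewrite mulN1r; apply/andP; split; lra.
Qed.

Lemma tau_ltT l : (l < N)%N -> tau l < T.
Proof. by move=> lN; rewrite (lt_le_trans (tauS lN))// tau_leT. Qed.

Lemma W_piecewise z : W Om T z -> piecewise z.
Proof.
move=> Wz; have [LH [g Hg] L2z cz] := Wz; split=> [|i iN|i iN|i iN|i /andP[i0 iN]].
- exact: (L2_H10_L2 oOm bOm).
- by apply: (L2B_sub sH) LH; [apply: tau_ge0; exact: ltnW|exact: tau_leT].
- exists g; apply: (time_deriv_sub oOm bOm) Hg; last exact: tau_leT.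
  by apply: tau_ge0; exact: ltnW.
- exists (z (tau i)); apply: W_haslimr => //.
  by rewrite tau_ltT// tau_ge0// ltnW.
- exists (z (tau i)); apply: W_haslimL => //.
  by rewrite tau_leT ?(ltnW iN)// -tau0 (tau_lt tauS)// ltnW.
Qed.

Lemma Vh_H10 l w : Vh Om (mesh l) w -> H10 Om w. Proof. by case. Qed.

Lemma Xsh_haslimr z l w : (l < N)%N -> L2 Om w -> (forall t, cell tau l t -> z t = w) ->
  haslim Om (fun s => z (tau l + s)) w.
Proof.
move=> lN Lw zw; apply: (haslim_cst oOm) => //.
have e0 : 0 < tau l.+1 - tau l by rewrite subr_gt0 tauS.
apply: filterS (near0r e0) => s /andP[s0 se]; apply: zw.
by rewrite /cell /= in_itv/=; apply/andP; split; lra.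
Qed.

Lemma Xsh_haslimL z l w : (l < N)%N -> L2 Om w -> (forall t, cell tau l t -> z t = w) ->
  haslim Om (fun s => z (tau l.+1 - s)) w.
Proof.
move=> lN Lw zw; apply: (haslim_cst oOm) => //.
have e0 : 0 < tau l.+1 - tau l by rewrite subr_gt0 tauS.
apply: filterS (near0r e0) => s /andP[s0 se]; apply: zw.
by rewrite /cell /= in_itv/=; apply/andP; split; lra.
Qed.

Lemma Xsh_piecewise z : Xsh Om T N tau mesh z -> piecewise z.
Proof.
move=> [Lz zc]; split=> [|i iN|i iN|i iN|[|i] /andP[i0 iN]] //.
- have [w Vw zw] := zc i iN; have Hw := Vh_H10 Vw.
  apply: (L2B_ae sH (z' := fun=> w)); last exact: (L2B_cst sH).
  apply: aeW => t /andP[h1 h2]; apply: zw.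
  by rewrite /cell /= in_itv/= h1 ltW.
- have [w Vw zw] := zc i iN; have Lw := H10_L2 (Vh_H10 Vw).
  exists (fun=> 0); apply: (time_deriv_ae (z := fun=> w)).
    by move=> t /andP[h1 h2]; rewrite zw// /cell /= in_itv/= h1 ltW.
  by apply: (time_deriv_cst oOm bOm) => //; exact: tauS.
- have [w Vw zw] := zc i iN; have Lw := H10_L2 (Vh_H10 Vw).
  by exists w; exact: Xsh_haslimr.
- have [w Vw zw] := zc i (ltnW iN); have Lw := H10_L2 (Vh_H10 Vw).
  by exists w; apply: Xsh_haslimL => //; exact: ltnW.
Qed.

Lemma Xsh0 : Xsh Om T N tau mesh 0.
Proof.
have H0 := H100 oOm bOm.
split; first by apply: (L2B_cst sL2); exact: H10_L2.
move=> l lN; exists 0 => //; split=> //.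
  by apply: continuous_subspaceT => x; exact: cst_continuous.
by move=> c _; exists 0, 0 => x _; rewrite addr0 /dotv big1// => i _; rewrite mxE mul0r.
Qed.

Lemma piecewise0 : piecewise 0.
Proof. by apply: Xsh_piecewise; exact: Xsh0. Qed.

Lemma rlimE z l w v : (l < N)%N -> haslim Om (fun s => z (tau l + s)) w -> L2 Om v ->
  ip Om (rlim Om z (tau l)) v = ip Om w v.
Proof. by move=> lN; exact: ip_lim0. Qed.

Lemma rlim_L2 z l : (l < N)%N -> piecewise z -> L2 Om (rlim Om z (tau l)).
Proof. by move=> lN pz; have [w /(lim0P oOm)[]] := pwr pz lN. Qed.

Lemma llim_L2 z l : (0 < l < N)%N -> piecewise z -> L2 Om (llim Om z (tau l)).
Proof. by move=> lN pz; have [w /(lim0P oOm)[]] := pwl pz lN. Qed.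

Lemma rlim_lin v l : (l < N)%N -> L2 Om v ->
  lin (piecewise : (R -> E -> R) -> Prop) (fun z => ip Om (rlim Om z (tau l)) v).
Proof.
move=> lN Lv; have sip := L2_semi_ip oOm; split=> [z z' pz pz'|c z pz].
- have [w Hw] := pwr pz lN; have [w' Hw'] := pwr pz' lN.
  have [Lw _ _] := Hw; have [Lw' _ _] := Hw'.
  have e1 := rlimE lN Hw Lv; have e2 := rlimE lN Hw' Lv.
  have e3 := @rlimE (z + z') l (w + w') v lN (haslimD oOm Hw Hw') Lv.
  exact: (etrans e3 (etrans (sipD sip Lw Lw' Lv) (esym (congr2 +%R e1 e2)))).
- have [w Hw] := pwr pz lN; have [Lw _ _] := Hw.
  have e1 := rlimE lN Hw Lv.
  have e3 := @rlimE (c *: z) l (c *: w) v lN (haslimZ oOm c Hw) Lv.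
  exact: (etrans e3 (etrans (sipZ sip c Lw Lv) (esym (congr1 ( *%R c) e1)))).
Qed.

Lemma llimE z l w v : haslim Om (fun s => z (tau l - s)) w -> L2 Om v ->
  ip Om (llim Om z (tau l)) v = ip Om w v.
Proof. exact: ip_lim0. Qed.

Lemma llim_lin v l : (0 < l < N)%N -> L2 Om v ->
  lin (piecewise : (R -> E -> R) -> Prop) (fun z => ip Om (llim Om z (tau l)) v).
Proof.
move=> lN Lv; have sip := L2_semi_ip oOm; split=> [z z' pz pz'|c z pz].
- have [w Hw] := pwl pz lN; have [w' Hw'] := pwl pz' lN.
  have [Lw _ _] := Hw; have [Lw' _ _] := Hw'.
  have e1 := llimE Hw Lv; have e2 := llimE Hw' Lv.
  have e3 := @llimE (z + z') l (w + w') v (haslimD oOm Hw Hw') Lv.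
  exact: (etrans e3 (etrans (sipD sip Lw Lw' Lv) (esym (congr2 +%R e1 e2)))).
- have [w Hw] := pwl pz lN; have [Lw _ _] := Hw.
  have e1 := llimE Hw Lv.
  have e3 := @llimE (c *: z) l (c *: w) v (haslimZ oOm c Hw) Lv.
  exact: (etrans e3 (etrans (sipZ sip c Lw Lv) (esym (congr1 ( *%R c) e1)))).
Qed.

Lemma rlim_linr v l : (l < N)%N -> L2 Om v ->
  lin (piecewise : (R -> E -> R) -> Prop) (fun z => ip Om v (rlim Om z (tau l))).
Proof.
move=> lN Lv; rewrite (_ : (fun z => _) = fun z => ip Om (rlim Om z (tau l)) v).
  exact: rlim_lin.
by apply/funext => z; exact: (sipC (L2_semi_ip oOm)).
Qed.

Lemma jump_L2 z l : (0 < l < N)%N -> piecewise z -> L2 Om (jump Om z (tau l)).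
Proof.
move=> /[dup] /andP[_ lN] lN' pz.
by apply: (smB sL2); [exact: rlim_L2|exact: llim_L2].
Qed.

Lemma ip_jump z l v : (0 < l < N)%N -> piecewise z -> L2 Om v ->
  ip Om (jump Om z (tau l)) v =
  ip Om (rlim Om z (tau l)) v - ip Om (llim Om z (tau l)) v.
Proof.
move=> lN' pz Lv; have /andP[_ lN] := lN'.
exact: (prBl (L2_pairing oOm) (rlim_L2 lN pz) (llim_L2 lN' pz) Lv).
Qed.

Lemma rlim_bilin l : (l < N)%N ->
  bilin (piecewise : (R -> E -> R) -> Prop) (piecewise : (R -> E -> R) -> Prop)
    (fun y p => ip Om (rlim Om y (tau l)) (rlim Om p (tau l))).
Proof.
move=> lN; split=> [y y' p py py' pp|c y p py pp|y p p' py pp pp'|c y p py pp].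
- exact: (liD (rlim_lin lN (rlim_L2 lN pp)) py py').
- exact: (liZ (rlim_lin lN (rlim_L2 lN pp)) c py).
- exact: (liD (rlim_linr lN (rlim_L2 lN py)) pp pp').
- exact: (liZ (rlim_linr lN (rlim_L2 lN py)) c pp).
Qed.

Lemma jump_bilin l : (0 < l < N)%N ->
  bilin (piecewise : (R -> E -> R) -> Prop) (piecewise : (R -> E -> R) -> Prop)
    (fun y p => ip Om (jump Om y (tau l)) (rlim Om p (tau l))).
Proof.
move=> lN'; have /andP[_ lN] := lN'.
split=> [y y' p py py' pp|c y p py pp|y p p' py pp pp'|c y p py pp].
- have Lp := rlim_L2 lN pp.
  have e1 := ip_jump lN' py Lp; have e2 := ip_jump lN' py' Lp.
  have e3 := ip_jump lN' (piecewiseD py py') Lp.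
  apply: (etrans e3); rewrite [RHS](congr2 +%R e1 e2) addrACA -opprD.
  congr (_ - _); first exact: (liD (rlim_lin lN Lp) py py').
  exact: (liD (llim_lin lN' Lp) py py').
- have Lp := rlim_L2 lN pp.
  have e1 := ip_jump lN' py Lp; have e3 := ip_jump lN' (piecewiseZ c py) Lp.
  apply: (etrans e3); rewrite [RHS](congr1 ( *%R c) e1) mulrBr.
  congr (_ - _); first exact: (liZ (rlim_lin lN Lp) c py).
  exact: (liZ (llim_lin lN' Lp) c py).
- exact: (liD (rlim_linr lN (jump_L2 lN' py)) pp pp').
- exact: (liZ (rlim_linr lN (jump_L2 lN' py)) c pp).
Qed.

Lemma ip_grad_on_bilin l : (l < N)%N ->
  bilin (piecewise : (R -> E -> R) -> Prop) (piecewise : (R -> E -> R) -> Prop)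
    (fun y p => ip_grad_on Om (cell tau l) y p).
Proof.
move=> lN; have [Dl Zl Dr Zr] := pairing_int_bilin (tau l) (tau l.+1) pG.
have E y p : ip_grad_on Om (cell tau l) y p =
    \int[mu]_(t in `]tau l, tau l.+1[) ip_grad Om (y t) (p t).
  exact: Rintegral_oc_oo.
split=> [y y' p py py' pp|c y p py pp|y p p' py pp pp'|c y p py pp]; rewrite !E.
- exact: (Dl _ _ _ (pwH py lN) (pwH py' lN) (pwH pp lN)).
- exact: (Zl _ _ _ (pwH py lN) (pwH pp lN)).
- exact: (Dr _ _ _ (pwH py lN) (pwH pp lN) (pwH pp' lN)).
- exact: (Zr _ _ _ (pwH py lN) (pwH pp lN)).
Qed.

(** The argument [p t] varies with [t], so uniqueness of the derivative is used with one null set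
    for all arguments. *)
Lemma pair_dtE l y p g : (l < N)%N -> is_time_deriv Om (tau l) (tau l.+1) y g ->
  piecewise p -> pair_on (cell tau l) (dt Om (tau l) (tau l.+1) y) p =
  \int[mu]_(t in `]tau l, tau l.+1[) g t (p t).
Proof.
move=> lN yg pp; rewrite /pair_on Rintegral_oc_oo; apply: (ae_Rintegral (mitv _ _)).
have yd := dtP (ex_intro _ g yg).
have [Hp _ _] := pwH pp lN.
apply: filterS2 (time_deriv_unique oOm bOm yd yg) Hp => t + + tt.
have ab : tau l < t < tau l.+1 by move: tt; rewrite /= in_itv.
by move=> /(_ ab) h /(_ ab); exact: h.
Qed.

Lemma pair_dt_bilin l : (l < N)%N ->
  bilin (piecewise : (R -> E -> R) -> Prop) (piecewise : (R -> E -> R) -> Prop)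
    (fun y p => pair_on (cell tau l) (dt Om (tau l) (tau l.+1) y) p).
Proof.
move=> lN; have [Dl Zl Dr Zr] := pairing_int_bilin (tau l) (tau l.+1) pH.
split=> [y y' p py py' pp|c y p py pp|y p p' py pp pp'|c y p py pp].
- have [g Hg] := pwdt py lN; have [g' Hg'] := pwdt py' lN.
  have L := L2_sub_cell lN (pwL2 py); have L' := L2_sub_cell lN (pwL2 py').
  apply: (etrans (pair_dtE lN (time_derivD oOm bOm L L' Hg Hg') pp)).
  apply: (etrans (Dl _ _ _ Hg.1 Hg'.1 (pwH pp lN))).
  exact: (esym (congr2 +%R (pair_dtE lN Hg pp) (pair_dtE lN Hg' pp))).
- have [g Hg] := pwdt py lN; have L := L2_sub_cell lN (pwL2 py).
  apply: (etrans (pair_dtE lN (time_derivZ oOm bOm c L Hg) pp)).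
  apply: (etrans (Zl _ _ _ Hg.1 (pwH pp lN))).
  exact: (esym (congr1 ( *%R c) (pair_dtE lN Hg pp))).
- have [g Hg] := pwdt py lN.
  apply: (etrans (pair_dtE lN Hg (piecewiseD pp pp'))).
  apply: (etrans (Dr _ _ _ Hg.1 (pwH pp lN) (pwH pp' lN))).
  exact: (esym (congr2 +%R (pair_dtE lN Hg pp) (pair_dtE lN Hg pp'))).
- have [g Hg] := pwdt py lN.
  apply: (etrans (pair_dtE lN Hg (piecewiseZ c pp))).
  apply: (etrans (Zr _ _ _ Hg.1 (pwH pp lN))).
  exact: (esym (congr1 ( *%R c) (pair_dtE lN Hg pp))).
Qed.

End state_class.

(** * The tracking term and the desired state *)

Section desired_state.
Context (R : realType) (d : nat).
Local Notation E := 'rV[R]_d.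
Local Notation mu := (@lebesgue_measure R).
Local Notation leb := (lebesgue_rV R d).
Context (Om : set E).
Hypothesis oOm : open Om.
Context (T : R) (yd : R * E -> R).
Hypothesis Lyd : L2Q Om T yd.
Implicit Types (z y : R -> E -> R) (v w : E -> R).

Local Notation D := (`]0, T[%classic : set R).
Let mOm := open_measurable_rV oOm.
Let sL2 := L2_seminormed oOm.
Let pL2 := L2_pairing oOm.

Definition yslice (t : R) : E -> R := fun x => yd (t, x).

Let mDO : measurable (`]0, T[%classic `*` Om :
  set (g_sigma_algebraType R.-ocitv.-measurable * E)).
Proof. by apply: measurableX => //; exact: mitv. Qed.

(** Fubini's theorem after extension by zero. Since the real integral is itself [fine] of the
    extended one, the measurable representative agrees with the slice integral on all of [D]. *)
Lemma prod_integrable_slices (f : R * E -> R) :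
  (mu \x leb)%E.-integrable (D `*` Om) (EFin \o f) ->
  {ae mu, forall t, D t -> leb.-integrable Om (fun x => (f (t, x))%:E)} /\
  aeint mu D (fun t => \int[leb]_(x in Om) f (t, x)).
Proof.
move=> fi.
pose F := (EFin \o f) \_ (D `*` Om).
have Fi : (mu \x leb)%E.-integrable setT F.
  exact: (integrable_mkcond _ mDO).1.
have FE t : D t -> (fun x => F (t, x)) = (fun x => (f (t, x))%:E) \_ Om.
  move=> Dt; apply/funext => x; rewrite /F !patchE.
  congr (if _ then _ else _); apply/idP/idP; rewrite !inE; first by case.
  by move=> Ox; split.
have ae1 : {ae mu, forall t, leb.-integrable setT (fun x => F (t, x))}.
  exact: (ae_integrable1 Fi).
have ae2 : {ae mu, forall t, D t -> leb.-integrable Om (fun x => (f (t, x))%:E)}.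
  apply: filterS ae1 => t + Dt; rewrite FE// => h.
  exact: (integrable_mkcond _ mOm).2.
split=> //.
have Gi := integrable_fubini_F Fi.
exists (fun t => fine (fubini_F leb F t)).
  have Gi' : mu.-integrable D (fubini_F leb F).
    exact: (integrableS measurableT (mitv 0 T) _ Gi).
  apply: (le_integrable (mitv 0 T) _ _ Gi').
    apply/measurable_EFinP; apply: measurableT_comp; first exact: fine_measurable.
    exact: (measurable_int mu Gi').
  have fle (x : \bar R) : (`|(fine x)%:E| <= `|x|)%E.
    by case: x => [r| |]; rewrite ?leey.
  by move=> t Dt; exact: fle.
apply: aeW => t Dt.
by rewrite /fubini_F FE// -integral_mkcond.
Qed.

Lemma yslice_L2 : {ae mu, forall t, 0 < t < T -> L2 Om (yslice t)}.
Proof.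
have [myd iyd] := Lyd; have [h _] := prod_integrable_slices iyd.
apply: filterS h => t + tT; have Dt : D t by rewrite /= in_itv.
move=> /(_ Dt) it; split=> //.
move=> _ Y mY; rewrite (_ : Om `&` _ = xsection ((D `*` Om) `&` yd @^-1` Y) t).
  exact: (measurable_xsection t (myd mDO Y mY)).
apply/seteqP; split=> x; rewrite /xsection /= inE.
  by move=> [Ox yY]; split=> //; split.
by move=> [[_ Ox] yY]; split.
Qed.

Lemma yslice_norm : sqint mu D (fun t => L2norm Om (yslice t)).
Proof.
have [myd iyd] := Lyd; have [_ h] := prod_integrable_slices iyd.
have E2 : {ae mu, forall t, D t ->
    L2norm Om (yslice t) ^+ 2 = \int[leb]_(x in Om) (yd (t, x) ^+ 2)}.
  apply: filterS yslice_L2 => t + Dt; rewrite /= in_itv in Dt; move=> /(_ Dt) Lt.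
  by rewrite sqr_sqrtr//; exact: (sip_ge0 (L2_semi_ip oOm)).
split; last exact: aeint_ae E2 h.
have [g ig gE] := h.
have mg : measurable_fun D g.
  by apply/measurable_EFinP; exact: (measurable_int mu ig).
exists (Num.sqrt \o g).
  apply: (measurableT_comp _ mg).
  exact: (continuous_measurable_fun (@sqrt_continuous R)).
apply: filterS2 E2 gE => t + + Dt => /(_ Dt) e2 /(_ Dt) ge.
by rewrite /= -ge -e2 sqrtr_sqr ger0_norm// sqrtr_ge0.
Qed.

Lemma measurable_snd_Om v : measurable_fun Om v ->
  measurable_fun (D `*` Om) (fun q : R * E => v q.2).
Proof.
move=> mv _ Y mY; rewrite (_ : _ `&` _ = D `*` (Om `&` v @^-1` Y)).
  by apply: measurableX; [exact: mitv|exact: mv].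
apply/seteqP; split=> [[t x] [[/= Dt Ox] vY]|[t x] [/= Dt [Ox vY]]].
  by split=> //; split.
by split=> //; split.
Qed.

Lemma sqr_snd_integrable v : L2 Om v ->
  (mu \x leb)%E.-integrable (D `*` Om) (fun q => (v q.2 ^+ 2)%:E).
Proof.
move=> [mv iv].
have mv2 := measurable_snd_Om mv.
apply: (integrable_mkcond _ mDO).2.
set F := (_ \_ _).
have mF : measurable_fun setT F.
  apply/(measurable_restrictT _ mDO)/measurable_EFinP.
  exact: measurable_funX.
apply: (integrable12ltyP mu leb mF).2.
have c0 : (0 <= \int[leb]_(x in Om) (v x ^+ 2)%:E)%E.
  by apply: integral_ge0 => x _; rewrite lee_fin sqr_ge0.
have clty : (\int[leb]_(x in Om) (v x ^+ 2)%:E < +oo)%E.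
  have /integrableP[_] := iv; congr (_ < _)%E; apply: eq_integral => x _.
  by rewrite gee0_abs// lee_fin sqr_ge0.
rewrite (_ : (fun t => \int[leb]_x `|F (t, x)|)%E =
    (fun=> \int[leb]_(x in Om) (v x ^+ 2)%:E)%E \_ D).
  pose C := (\int[leb]_(x in Om) (v x ^+ 2)%:E)%E.
  have e := esym (@integral_mkcond _ _ _ mu D (fun=> C)).
  apply: (@eq_ind_r _ _ (fun I : \bar R => (I < +oo)%E) _ _ e).
  rewrite integral_cst; last exact: (mitv 0 T).
  apply: lte_mul_pinfty => //; first by rewrite ge0_fin_numE.
  exact: (itv_finite 0 T).
apply/funext => t; rewrite patchE; case: ifPn; rewrite ?inE => Dt.
  rewrite [RHS]integral_mkcond; apply: eq_integral => x _.
  rewrite /F !patchE; case: ifPn; case: ifPn => //; rewrite ?inE ?notin_setE.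
  - by rewrite gee0_abs// lee_fin sqr_ge0.
  - by move=> nO [].
  - by move=> Ox h; exfalso; apply: h.
  - by rewrite abse0.
rewrite integral0_eq// => x _; rewrite /F patchE ifN ?abse0// notin_setE.
by move: Dt; rewrite notin_setE => nD [].
Qed.

(** For fixed [v] the product of [v] and [yd] is jointly integrable, being dominated by the sum of
    their squares, so Fubini's theorem provides the measurability. *)
Lemma ip_yslice_aemeas v : L2 Om v -> aemeas mu D (fun t => ip Om v (yslice t)).
Proof.
move=> Lv; apply: aeint_meas.
apply: (prod_integrable_slices (f := fun q => v q.2 * yd q) _).2.
have [myd iyd] := Lyd; have [mv iv] := Lv.
have mv2 := measurable_snd_Om mv.
have i2 := integrableD mDO (sqr_snd_integrable Lv) iyd.
apply: (le_integrable mDO _ _ i2).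
  by apply/measurable_EFinP; exact: measurable_funM.
move=> q _; suff : `|v q.2 * yd q| <= `|v q.2 ^+ 2 + yd q ^+ 2| by exact.
rewrite [leRHS]ger0_norm ?addr_ge0 ?sqr_ge0//.
have := sqr_ge0 (v q.2 - yd q); have := sqr_ge0 (v q.2 + yd q).
by rewrite ler_norml; have := sqr_ge0 (v q.2); have := sqr_ge0 (yd q); nra.
Qed.

Definition yd_form (y : R -> E -> R) : R :=
  \int[mu]_(t in `]0, T[) ip Om (y t) (yslice t).

(** [yd] is a function on the product space, and no strong measurability of its slices is
    established. Measurability against fixed vectors, combined with the Lipschitz bound in [y t], is
    enough for the pairing. *)
Lemma yd_form_aeint y : L2_L2 Om 0 T y ->
  aeint mu D (fun t => ip Om (y t) (yslice t)).
Proof.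
move=> Ly; have [by1 ny] := (L2BP sL2 0 T y).1 Ly.
have h : aeint mu D (fun t => L2norm Om (y t) * L2norm Om (yslice t)).
  exact: (sqint_mul (mitv 0 T) ny yslice_norm).
apply: (@aeint_dom _ _ _ mu _ (mitv 0 T) _ _ _ _ h).
  apply: (bmeas_aemeas sL2 (F := fun t v => ip Om v (yslice t))
      (C := fun t => L2norm Om (yslice t)) by1).
    exact: ip_yslice_aemeas.
  apply: filterS yslice_L2 => t yL tT v w Lv Lw; have Ly' := yL tT.
  rewrite -(prBl pL2 Lv Lw Ly') mulrC.
  exact: (pr_bound pL2 (smB sL2 Lv Lw) Ly').
have [hy _ _] := Ly.
apply: filterS2 yslice_L2 hy => t + + Dt.
have tT : 0 < t < T by move: Dt; rewrite /= in_itv.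
by move=> /(_ tT) L1 /(_ tT) L2'; exact: (pr_bound pL2).
Qed.

Lemma yd_form_lin : lin (L2_L2 Om 0 T : (R -> E -> R) -> Prop) yd_form.
Proof.
have oo t : D t -> 0 < t < T by rewrite /= in_itv.
split=> [y y' Ly Ly'|c y Ly].
- rewrite -(aeRintegralD (mitv 0 T) (yd_form_aeint Ly) (yd_form_aeint Ly')).
  apply: (ae_Rintegral (mitv 0 T)).
  have [h1 _ _] := Ly; have [h2 _ _] := Ly'.
  apply: filterS3 yslice_L2 h1 h2 => t + + + /oo tT.
  by move=> /(_ tT) ? /(_ tT) ? /(_ tT) ?; exact: (prDl pL2).
- rewrite -(aeRintegralZ (mitv 0 T) c (yd_form_aeint Ly)).
  apply: (ae_Rintegral (mitv 0 T)); have [h1 _ _] := Ly.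
  apply: filterS2 yslice_L2 h1 => t + + /oo tT.
  by move=> /(_ tT) ? /(_ tT) ?; exact: (prZl pL2).
Qed.

Definition L2L2_form (y p : R -> E -> R) : R :=
  \int[mu]_(t in `]0, T[) ip Om (y t) (p t).

Lemma L2L2_form_bilin : bilin (L2_L2 Om 0 T : (R -> E -> R) -> Prop)
  (L2_L2 Om 0 T : (R -> E -> R) -> Prop) L2L2_form.
Proof. exact: (pairing_int_bilin 0 T pL2). Qed.

Lemma state_cost y : L2_L2 Om 0 T y ->
  \int[mu]_(t in `]0, T[) \int[leb]_(x in Om) ((y t x - yd (t, x)) ^+ 2) =
  L2L2_form y y - 2 * yd_form y +
  \int[mu]_(t in `]0, T[) ip Om (yslice t) (yslice t).
Proof.
move=> Ly; have iyy := pairing_aeint pL2 Ly Ly; have iyd := yd_form_aeint Ly.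
have idd : aeint mu D (fun t => ip Om (yslice t) (yslice t)).
  have [_ h] := yslice_norm; apply: aeint_ae h.
  apply: filterS yslice_L2 => t yL Dt.
  have tT : 0 < t < T by move: Dt; rewrite /= in_itv.
  have g0 : 0 <= ip Om (yslice t) (yslice t) by exact: (sip_ge0 (L2_semi_ip oOm) (yL tT)).
  by rewrite sqr_sqrtr.
have i2 := aeintZ (mitv 0 T) 2 iyd.
rewrite /L2L2_form /yd_form -(aeRintegralZ (mitv 0 T) 2 iyd).
rewrite -(aeRintegralB (mitv 0 T) iyy i2).
rewrite -(aeRintegralD (mitv 0 T) (aeintB (mitv 0 T) iyy i2) idd).
apply: (ae_Rintegral (mitv 0 T)); have [hy _ _] := Ly.
apply: filterS2 yslice_L2 hy => t + + Dt.
have tT : 0 < t < T by move: Dt; rewrite /= in_itv.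
move=> /(_ tT) Ld /(_ tT) Ly'; have sip := L2_semi_ip oOm.
have LB := smB sL2 Ly' Ld.
rewrite [LHS](_ : _ = ip Om (y t - yslice t) (y t - yslice t)); last first.
  by apply: eq_Rintegral => x _; rewrite expr2.
rewrite (prBl pL2 Ly' Ld LB) (prBr pL2 Ly' Ly' Ld) (prBr pL2 Ld Ly' Ld).
by rewrite (sipC sip (yslice t) (y t)); ring.
Qed.

Lemma control_cost u : 0 <= T -> L2t 0 T u ->
  \int[mu]_(t in `]0, T[) ((u t - 2^-1) ^+ 2) =
  \int[mu]_(t in `]0, T[) (u t * u t) - \int[mu]_(t in `]0, T[) u t +
  \int[mu]_(t in `]0, T[) 4^-1.
Proof.
move=> T0 Lu; have iuu := L2t_mul Lu Lu.
have iu : aeint mu D u by exact: L2t_aeint.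
have i1 : aeint mu D (fun=> 4^-1 : R).
  by apply: (integrable_aeint (f := fun=> _));
    exact: (finite_integrable_cst 4^-1 (mitv 0 T) (itv_finite 0 T)).
rewrite -(aeRintegralB (mitv 0 T) iuu iu).
rewrite -(aeRintegralD (mitv 0 T) (aeintB (mitv 0 T) iuu iu) i1).
by apply: eq_Rintegral => t _; field.
Qed.

End desired_state.

(** * Algebra of forms and quadratic functionals *)

Section composition.
Context (R : realType) (V V' : lmodType R) (P : V -> Prop) (P' : V' -> Prop).
Context (f : V -> V').
Hypothesis fD : forall u v, f (u + v) = f u + f v.
Hypothesis fZ : forall c v, f (c *: v) = c *: f v.
Hypothesis fP : forall v, P v -> P' (f v).

Lemma bilin_compl (W : lmodType R) (Q : W -> Prop) (B : V' -> W -> R) :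
  bilin P' Q B -> bilin P Q (fun v w => B (f v) w).
Proof.
move=> [Dl Zl Dr Zr]; split=> *; rewrite ?fD ?fZ; [apply: Dl|apply: Zl|apply: Dr|apply: Zr]; auto.
Qed.

Lemma bilin_compr (W : lmodType R) (Q : W -> Prop) (B : W -> V' -> R) :
  bilin Q P' B -> bilin Q P (fun w v => B w (f v)).
Proof.
move=> [Dl Zl Dr Zr]; split=> *; rewrite ?fD ?fZ; [apply: Dl|apply: Zl|apply: Dr|apply: Zr]; auto.
Qed.

Lemma lin_comp (g : V' -> R) : lin P' g -> lin P (fun v => g (f v)).
Proof. by move=> [D Z]; split=> *; rewrite ?fD ?fZ; [apply: D|apply: Z]; auto. Qed.

End composition.

Section linear_forms.
Context (R : realType) (V : lmodType R) (P : V -> Prop).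

Lemma lin_add (f g : V -> R) : lin P f -> lin P g -> lin P (fun v => f v + g v).
Proof.
move=> [Df Zf] [Dg Zg]; split=> *; first by rewrite Df// Dg// addrACA.
by rewrite Zf// Zg// mulrDr.
Qed.

Lemma lin_scale c (f : V -> R) : lin P f -> lin P (fun v => c * f v).
Proof.
move=> [Df Zf]; split=> *; first by rewrite Df// mulrDr.
by rewrite Zf// mulrCA.
Qed.

Lemma lin_opp (f : V -> R) : lin P f -> lin P (fun v => - f v).
Proof.
move=> [Df Zf]; split=> *; first by rewrite Df// opprD.
by rewrite Zf// mulrN.
Qed.

End linear_forms.

Lemma derive1_quadratic (R : realType) (a b c : R) :
  derive1 (fun s : R => a + s * b + s ^+ 2 * c) 0 = b.
Proof.
rewrite /derive1; apply: (cvg_lim (@Rhausdorff R)).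
have h : (fun s : R => b + s * c) @ 0^' --> b.
  have h0 : (fun s : R => b + s * c) @ (0 : R) --> b + 0 * c.
    exact: (cvgD (cvg_cst b) (cvgM cvg_id (cvg_cst c))).
  by rewrite mul0r addr0 in h0; apply: cvg_within_filter.
apply: cvg_trans h; apply: near_eq_cvg; near=> s.
have s0 : s != 0 by near: s; exact: nbhs_dnbhs_neq.
by rewrite /GRing.scale/=; field.
Unshelve. all: by end_near. Qed.

Section quadratic.
Context (R : realType) (V : lmodType R).
Context (P : V -> Prop) (F : V -> R) (c : R) (l : V -> R) (B : V -> V -> R).
Hypothesis PD : forall X Y, P X -> P Y -> P (X + Y).
Hypothesis PZ : forall (s : R) X, P X -> P (s *: X).
Hypothesis ll : lin P l.
Hypothesis bB : bilin P P B.
Hypothesis FE : forall X, P X -> F X = c + l X + B X X.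

Lemma derive1_quadratic_form X D : P X -> P D ->
  derive1 (fun s : R => F (X + s *: D)) 0 = l D + B X D + B D X.
Proof.
move=> PX Dp.
rewrite (_ : (fun s : R => _) = fun s : R =>
    F X + s * (l D + B X D + B D X) + s ^+ 2 * B D D).
  by rewrite derive1_quadratic.
apply/funext => s; have Ps : P (s *: D) by exact: PZ.
have PXs : P (X + s *: D) by exact: PD.
rewrite (FE PXs) (FE PX) (liD ll PX Ps) (liZ ll s Dp) (blDl bB PX Ps PXs).
rewrite (blDr bB PX PX Ps) (blDr bB Ps PX Ps) (blZl bB s Dp PX) (blZl bB s Dp Ps).
by rewrite !(blZr bB s _ Dp)//; ring.
Qed.

(* The trapezoidal rule is exact for quadratic functionals. *)
Lemma quadratic_trapezoid X Y (D := X + -1 *: Y) : P X -> P Y ->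
  F X - F Y = 2^-1 * (l D + B X D + B D X) + 2^-1 * (l D + B Y D + B D Y).
Proof.
move=> PX PY; have PN : P (-1 *: Y) by exact: PZ.
rewrite /D (FE PX) (FE PY) (liD ll PX PN) (liZ ll _ PY).
rewrite (blDr bB PX PX PN) (blDl bB PX PN PX) (blDr bB PY PX PN) (blDl bB PX PN PY).
rewrite (blZr bB _ PX PY) (blZl bB _ PY PX) (blZr bB _ PY PY) (blZl bB _ PY PY).
by field.
Qed.

End quadratic.

(** * Expansion of the discrete Lagrangian *)

Section discrete_lagrangian.
Context (R : realType) (d k : nat).
Local Notation E := 'rV[R]_d.
Local Notation mu := (@lebesgue_measure R).
Local Notation pt := (pdpoint R d k).
Context (Om : set E).
Hypothesis oOm : open Om.
Hypothesis bOm : bounded_set Om.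
Context (T : R) (psi : (E -> R) -> R) (y0 : E -> R) (yd : R * E -> R) (alpha : R).
Context (m : 'I_k -> nat) (I : forall l : 'I_k, 'I_(m l) -> interval R).
Context (a : forall l : 'I_k, 'cV[R]_(m l)) (b : 'cV[R]_k).
Context (N : nat) (tau : nat -> R).
Hypothesis T0 : 0 < T.
Hypothesis Hpsi : Hm1 Om psi.
Hypothesis Ly0 : L2 Om y0.
Hypothesis Lyd : L2Q Om T yd.
Hypothesis ID : forall l i, [set` @I l i] `<=` (`]0, T[%classic : set R).
Hypothesis tau0 : tau 0%N = 0.
Hypothesis tauN : tau N = T.
Hypothesis tauS : forall l, (l < N)%N -> tau l < tau l.+1.

Local Notation pw := (piecewise Om T N tau).
Local Notation G := (Gop (@I) (@a)).
Local Notation D := (`]0, T[%classic : set R).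

Lemma N_gt0 : (0 < N)%N.
Proof. by case: N tauN => // h; move: T0; rewrite -h tau0 ltxx. Qed.

Definition psi_form (u : R -> R) (p : R -> E -> R) : R :=
  \sum_(0 <= l < N) pair_on (cell tau l) (Psi psi u) p.

Lemma L2_Psi a' b' u : 0 <= a' -> b' <= T -> L2t 0 T u ->
  L2_Hm1 Om a' b' (Psi psi u).
Proof.
move=> a0 bT Lu; have sHm := prP (Hm1_pairing oOm bOm).
have E1 t : a' < t < b' -> u t = (u \_ D) t.
  move=> /andP[h1 h2]; rewrite patchE ifT// inE /= in_itv/=.
  by rewrite (le_lt_trans a0 h1) (lt_le_trans h2 bT).
(* A scalar factor has to be measurable on the whole line, whereas [u] is measurable only on
   [(0,T)]; hence its extension by zero. *)
apply: (L2B_ae sHm (z' := fun t => (u \_ D) t *: psi)).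
  by apply: aeW => t ab; rewrite /Psi E1.
apply: (L2B_scale sHm) => //.
  by apply/(measurable_restrictT _ (mitv 0 T)); case: Lu.
have [h1 h2] := L2t_sqint a0 bT Lu; split.
  by apply: aemeas_ae h1; apply: aeW => t ab; rewrite E1.
by apply: aeint_ae h2; apply: aeW => t ab; rewrite E1.
Qed.

Lemma psi_form_bilin :
  bilin (L2t 0 T : (R -> R) -> Prop) (pw : (R -> E -> R) -> Prop) psi_form.
Proof.
apply: bilin_sum => l /andP[_ lN].
have [Dl Zl Dr Zr] := pairing_int_bilin (tau l) (tau l.+1) (Hm1_pairing oOm bOm).
have E1 u p : pair_on (cell tau l) (Psi psi u) p =
    \int[mu]_(t in `]tau l, tau l.+1[) Psi psi u t (p t).
  exact: Rintegral_oc_oo.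
have LP u : L2t 0 T u -> L2_Hm1 Om (tau l) (tau l.+1) (Psi psi u).
  apply: L2_Psi; first by apply: (tau_ge0 tau0 tauS); exact: ltnW.
  exact: (tau_leT tauN tauS lN).
have PD u v : Psi psi (u + v) = (Psi psi u : R -> (E -> R) -> R) + Psi psi v.
  by apply/funext => t; rewrite /Psi scalerDl.
have PZ c u : Psi psi (c *: u) = (c *: Psi psi u : R -> (E -> R) -> R).
  by apply/funext => t; rewrite /Psi -scalerA.
split=> [u v p Lu Lv pp|c u p Lu pp|u p p' Lu pp pp'|c u p Lu pp]; rewrite !E1 ?PD ?PZ.
- exact: (Dl _ _ _ (LP _ Lu) (LP _ Lv) (pwH pp lN)).
- exact: (Zl _ _ _ (LP _ Lu) (pwH pp lN)).
- exact: (Dr _ _ _ (LP _ Lu) (pwH pp lN) (pwH pp' lN)).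
- exact: (Zr _ _ _ (LP _ Lu) (pwH pp lN)).
Qed.

(** The bilinear form of the discontinuous Galerkin scheme in time, with the initial value treated
    as the jump at time 0. *)
Definition heat_form (y p : R -> E -> R) : R :=
  \sum_(0 <= l < N) pair_on (cell tau l) (dt Om (tau l) (tau l.+1) y) p
  + \sum_(0 <= l < N) ip_grad_on Om (cell tau l) y p
  + \sum_(1 <= l < N) ip Om (jump Om y (tau l)) (rlim Om p (tau l))
  + ip Om (rlim Om y (tau 0%N)) (rlim Om p (tau 0%N)).

Lemma heat_form_bilin :
  bilin (pw : (R -> E -> R) -> Prop) (pw : (R -> E -> R) -> Prop) heat_form.
Proof.
apply: bilinD; last exact: (@rlim_bilin R d Om oOm T N tau 0%N N_gt0).
apply: bilinD.
  apply: bilinD; apply: bilin_sum => l /andP[_ lN].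
    exact: (pair_dt_bilin oOm bOm tau0 tauN tauS lN).
  exact: (ip_grad_on_bilin oOm bOm T tau lN).
by apply: bilin_sum => l lN; exact: (jump_bilin oOm bOm tau0 tauN tauS).
Qed.

Definition Gform (lam : 'cV[R]_k) (u : R -> R) : R := (lam^T *m G u) ord0 ord0.

Lemma Gform_bilin :
  bilin (fun _ : 'cV[R]_k => True) (L2t 0 T : (R -> R) -> Prop) Gform.
Proof. exact: (Gop_lin _ ID). Qed.

(** Contains both chi and chi_rho. The projections from the innermost outwards are y, u, p, mu^+,
    mu^-, and [X.2] is lambda. *)
Definition admissible (X : pt) : Prop :=
  [/\ pw X.1.1.1.1.1, L2t 0 T X.1.1.1.1.2, pw X.1.1.1.2, L2t 0 T X.1.1.2 &
    L2t 0 T X.1.2].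

Lemma admissibleD X Y : admissible X -> admissible Y -> admissible (X + Y).
Proof.
move=> [h1 h2 h3 h4 h5] [h1' h2' h3' h4' h5']; split.
- exact: (piecewiseD oOm bOm tau0 tauN tauS h1 h1').
- exact: (L2tD h2 h2').
- exact: (piecewiseD oOm bOm tau0 tauN tauS h3 h3').
- exact: (L2tD h4 h4').
- exact: (L2tD h5 h5').
Qed.

Lemma admissibleZ (c : R) X : admissible X -> admissible (c *: X).
Proof.
move=> [h1 h2 h3 h4 h5]; split.
- exact: (piecewiseZ oOm bOm tau0 tauN tauS c h1).
- exact: (L2tZ c h2).
- exact: (piecewiseZ oOm bOm tau0 tauN tauS c h3).
- exact: (L2tZ c h4).
- exact: (L2tZ c h5).
Qed.

Definition int2 (u v : R -> R) : R := \int[mu]_(t in `]0, T[) (u t * v t).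
Definition int1 (u : R -> R) : R := \int[mu]_(t in `]0, T[) u t.

(** Not symmetric: each mixed term of the Lagrangian is entered in one order of the arguments, and
    the derivative supplies the other order. *)
Definition lagr_bil (X Y : pt) : R :=
  2^-1 * L2L2_form Om T X.1.1.1.1.1 Y.1.1.1.1.1
  + alpha / 2 * int2 X.1.1.1.1.2 Y.1.1.1.1.2
  - heat_form X.1.1.1.1.1 Y.1.1.1.2
  + psi_form X.1.1.1.1.2 Y.1.1.1.2
  + int2 X.1.1.2 Y.1.1.1.1.2
  - int2 X.1.2 Y.1.1.1.1.2
  + Gform X.2 Y.1.1.1.1.2.

(** The first two terms are the linear parts of the squares in [J]; the others come from the initial
    state, from the 1 in [u - 1] and from [b]. The 1/4 in [lagr_cst] is the square of 1/2. *)
Definition lagr_lin (X : pt) : R :=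
  - yd_form Om T yd X.1.1.1.1.1 - alpha / 2 * int1 X.1.1.1.1.2
  + ip Om y0 (rlim Om X.1.1.1.2 (tau 0%N)) - int1 X.1.1.2
  - (X.2^T *m b) ord0 ord0.

Definition lagr_cst : R :=
  2^-1 * \int[mu]_(t in `]0, T[) ip Om (yslice yd t) (yslice yd t)
  + alpha / 2 * \int[mu]_(t in `]0, T[) 4^-1.

Let L2L2_bilin : bilin (pw : (R -> E -> R) -> Prop) (pw : (R -> E -> R) -> Prop)
  (L2L2_form Om T).
Proof.
have [Dl Zl Dr Zr] := L2L2_form_bilin oOm T.
split=> *; [apply: Dl|apply: Zl|apply: Dr|apply: Zr]; exact: (pwL2 (N := N) (tau := tau)).
Qed.

Lemma lagr_bil_bilin :
  bilin (admissible : pt -> Prop) (admissible : pt -> Prop) lagr_bil.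
Proof.
have py (X : pt) : admissible X -> pw X.1.1.1.1.1 by case.
have pu (X : pt) : admissible X -> L2t 0 T X.1.1.1.1.2 by case.
have pp (X : pt) : admissible X -> pw X.1.1.1.2 by case.
have pm (X : pt) : admissible X -> L2t 0 T X.1.1.2 by case.
have pn (X : pt) : admissible X -> L2t 0 T X.1.2 by case.
(* Pulls a form on two components back along coordinate projections; every term of [lagr_bil] is a
   multiple of such a pullback. *)
have eq2 (V W : lmodType R) (P : V -> Prop) (Q : W -> Prop) (f : pt -> V)
    (g : pt -> W) (B : V -> W -> R) :
    (forall u v, f (u + v) = f u + f v) -> (forall c v, f (c *: v) = c *: f v) ->
    (forall u v, g (u + v) = g u + g v) -> (forall c v, g (c *: v) = c *: g v) ->
    (forall X, admissible X -> P (f X)) -> (forall X, admissible X -> Q (g X)) ->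
    bilin P Q B ->
    bilin (admissible : pt -> Prop) (admissible : pt -> Prop) (fun X Y => B (f X) (g Y)).
  move=> fD fZ gD gZ fP gQ bB.
  exact: (bilin_compl fD fZ fP (bilin_compr gD gZ gQ bB)).
have i2 := L2t_mul_bilin T.
apply: bilinD; last first.
  by apply: (eq2 _ _ _ _ (fun X : pt => X.2) (fun X : pt => X.1.1.1.1.2) _ _ _ _ _ _ _ Gform_bilin).
apply: bilinD; last first.
  apply: bilinN.
  by apply: (eq2 _ _ _ _ (fun X : pt => X.1.2) (fun X : pt => X.1.1.1.1.2) _ _ _ _ _ _ _ i2).
apply: bilinD; last first.
  by apply: (eq2 _ _ _ _ (fun X : pt => X.1.1.2) (fun X : pt => X.1.1.1.1.2) _ _ _ _ _ _ _ i2).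
apply: bilinD; last first.
  by apply: (eq2 _ _ _ _ (fun X : pt => X.1.1.1.1.2)
    (fun X : pt => X.1.1.1.2) _ _ _ _ _ _ _ psi_form_bilin).
apply: bilinD; last first.
  apply: bilinN.
  by apply: (eq2 _ _ _ _ (fun X : pt => X.1.1.1.1.1)
    (fun X : pt => X.1.1.1.2) _ _ _ _ _ _ _ heat_form_bilin).
apply: bilinD.
  apply: bilinZ.
  by apply: (eq2 _ _ _ _ (fun X : pt => X.1.1.1.1.1)
    (fun X : pt => X.1.1.1.1.1) _ _ _ _ _ _ _ L2L2_bilin).
apply: bilinZ.
by apply: (eq2 _ _ _ _ (fun X : pt => X.1.1.1.1.2) (fun X : pt => X.1.1.1.1.2) _ _ _ _ _ _ _ i2).
Qed.

Lemma lagr_lin_lin : lin (admissible : pt -> Prop) lagr_lin.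
Proof.
have py (X : pt) : admissible X -> L2_L2 Om 0 T X.1.1.1.1.1 by case=> /pwL2.
have pu (X : pt) : admissible X -> L2t 0 T X.1.1.1.1.2 by case.
have pp (X : pt) : admissible X -> pw X.1.1.1.2 by case.
have pm (X : pt) : admissible X -> L2t 0 T X.1.1.2 by case.
have l1 := L2t_int_lin T.
apply: lin_add; last first.
  apply: lin_opp; split=> [X Y _ _|c X _].
    by rewrite /= linearD/= mulmxDl mxE.
  by rewrite /= linearZ/= -scalemxAl mxE.
apply: lin_add; last first.
  by apply: lin_opp; apply: (@lin_comp _ _ _ _ _ (fun X : pt => X.1.1.2) _ _ pm _ l1).
apply: lin_add; last first.
  have l2 := @rlim_linr R d Om oOm T N tau y0 0%N N_gt0 Ly0.
  by apply: (@lin_comp _ _ _ _ _ (fun X : pt => X.1.1.1.2) _ _ pp _ l2).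
apply: lin_add; apply: lin_opp.
  have l3 := yd_form_lin oOm Lyd.
  by apply: (@lin_comp _ _ _ _ _ (fun X : pt => X.1.1.1.1.1) _ _ py _ l3).
apply: lin_scale.
by apply: (@lin_comp _ _ _ _ _ (fun X : pt => X.1.1.1.1.2) _ _ pu _ l1).
Qed.

Lemma J_expand y u : L2_L2 Om 0 T y -> L2t 0 T u ->
  J Om T yd alpha y u =
  2^-1 * (L2L2_form Om T y y - 2 * yd_form Om T yd y +
    \int[mu]_(t in `]0, T[) ip Om (yslice yd t) (yslice yd t)) +
  alpha / 2 * (int2 u u - int1 u + \int[mu]_(t in `]0, T[) 4^-1).
Proof.
move=> Ly Lu.
exact: (congr2 +%R (congr1 ( *%R 2^-1) (state_cost oOm Lyd Ly))
  (congr1 ( *%R (alpha / 2)) (control_cost (ltW T0) Lu))).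
Qed.

Lemma multiplier_terms_expand u mup mum (lam : 'cV[R]_k) :
  L2t 0 T u -> L2t 0 T mup -> L2t 0 T mum ->
  multiplier_terms T G b u mup mum lam =
  int2 mup u - int1 mup - int2 mum u + (Gform lam u - (lam^T *m b) ord0 ord0).
Proof.
move=> Lu Lp Lm; rewrite /multiplier_terms /Gform mulmxBr.
congr (_ - _ + _); last by rewrite !mxE.
rewrite /int2 /int1 -(aeRintegralB (mitv 0 T) (L2t_mul Lp Lu)); last exact: L2t_aeint.
by apply: eq_Rintegral => t _; rewrite mulrBr mulr1.
Qed.

Local Notation Lt := (Lagr_t Om T psi y0 yd alpha G b N tau).

Lemma Lagr_tE X : admissible X -> Lt X = lagr_cst + lagr_lin X + lagr_bil X X.
Proof.
case: X => [[[[[y u] p] mup] mum] lam] [/= py Lu pp Lp Lm].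
have e1 := J_expand (pwL2 py) Lu.
have e2 := multiplier_terms_expand lam Lu Lp Lm.
have Lr := rlim_L2 oOm N_gt0 py; have Lrp := rlim_L2 oOm N_gt0 pp.
have e3 : ip Om (rlim Om y 0 - y0) (rlim Om p 0) =
    ip Om (rlim Om y (tau 0%N)) (rlim Om p (tau 0%N)) - ip Om y0 (rlim Om p (tau 0%N)).
  rewrite -[in LHS]tau0; exact: (prBl (L2_pairing oOm) Lr Ly0 Lrp).
rewrite /Lagr_t; apply: (etrans (congr2 +%R (congr2 +%R (congr2 (fun x z => x - z)
  (congr1 (fun x => x - _ - _ - _) e1) e3) erefl) e2)).
rewrite /lagr_cst /lagr_lin /lagr_bil /= /heat_form /psi_form.
move: (L2L2_form _ _ _ _) (yd_form _ _ _ _) (int2 u u) (int2 mup u) (int2 mum u).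
move=> x1 x2 x3 x4 x5.
move: (\sum_(1 <= l < N) _) => x6.
move: (Gform _ _) ((lam^T *m b) _ _) (int1 u) (int1 mup) => x7 x8 x9 x10.
move: (ip _ y0 _) (ip _ _ (rlim _ p _)) => x11 x12.
do 3 (move: (\sum_(0 <= l < N) _) => ?).
move: (\int[mu]_(t in _) 4^-1) (\int[mu]_(t in _) _) => x13 x14.
by field.
Qed.

End discrete_lagrangian.

(** * The continuous state space *)

Section state_space.
Context (R : realType) (d : nat).
Local Notation E := 'rV[R]_d.
Local Notation mu := (@lebesgue_measure R).
Context (Om : set E).
Hypothesis oOm : open Om.
Hypothesis bOm : bounded_set Om.
Context (T : R).
Hypothesis T0 : 0 < T.
Implicit Types (v w : E -> R).

Let sL2 := L2_seminormed oOm.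
Let sH := H10_seminormed oOm bOm.

Lemma within_squeeze0 (A : set R) (t : R) (f g : R -> R) :
  (forall s, A s -> 0 <= f s <= g s) ->
  g @ within A (nbhs t) --> (0 : R) -> f @ within A (nbhs t) --> (0 : R).
Proof.
move=> fg g0.
apply: (@squeeze_cvgr _ _ _ _ (fun=> 0) g) => //; last exact: cvg_cst.
by near=> s; apply: fg; near: s; exact: withinT.
Unshelve. all: by end_near. Qed.

Lemma within_cvg0D (A : set R) (t : R) (f g : R -> R) :
  f @ within A (nbhs t) --> (0 : R) -> g @ within A (nbhs t) --> (0 : R) ->
  (fun s => f s + g s) @ within A (nbhs t) --> (0 : R).
Proof. by move=> f0 g0; rewrite -[0 : R]addr0; exact: cvgD. Qed.

Lemma within_cvg0Z (A : set R) (t k : R) (f : R -> R) :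
  f @ within A (nbhs t) --> (0 : R) ->
  (fun s => k * f s) @ within A (nbhs t) --> (0 : R).
Proof. by move=> f0; rewrite -[0 : R](mulr0 k); apply: cvgM => //; exact: cvg_cst. Qed.

Lemma WD z z' : W Om T z -> W Om T z' -> W Om T (z + z').
Proof.
move=> [H [g Hg] L c] [H' [g' Hg'] L' c']; split.
- exact: (L2BD sH H H').
- exists (fun t => g t + g' t).
  exact: (time_derivD oOm bOm (L2_H10_L2 oOm bOm H) (L2_H10_L2 oOm bOm H') Hg Hg').
- by move=> t tT; exact: (smD sL2 (L t tT) (L' t tT)).
- move=> t tT; have cc := within_cvg0D (c t tT) (c' t tT).
  apply: within_squeeze0 cc => s; rewrite /= in_itv/= => sT.
  have B1 := smB sL2 (L s sT) (L t tT); have B2 := smB sL2 (L' s sT) (L' t tT).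
  have -> : z s + z' s - (z t + z' t) = (z s - z t) + (z' s - z' t).
    by rewrite opprD addrACA.
  apply/andP; split; first exact: (sm_ge0 sL2 (smD sL2 B1 B2)).
  exact: (sm_nrmD sL2 B1 B2).
Qed.

Lemma WZ (k : R) z : W Om T z -> W Om T (k *: z).
Proof.
move=> [H [g Hg] L c]; split.
- exact: (L2BZ sH k H).
- exists (fun t => k *: g t).
  exact: (time_derivZ oOm bOm k (L2_H10_L2 oOm bOm H) Hg).
- by move=> t tT; exact: (smZ sL2 k (L t tT)).
- move=> t tT; have cc := within_cvg0Z `|k| (c t tT).
  apply: within_squeeze0 cc => s; rewrite /= in_itv/= => sT.
  have B1 := smB sL2 (L s sT) (L t tT).
  have -> : (k *: z) s - (k *: z) t = k *: (z s - z t) by rewrite scalerBr.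
  apply/andP; split; first exact: (sm_ge0 sL2 (smZ sL2 k B1)).
  by have -> := sm_nrmZ sL2 k B1.
Qed.

Lemma W_scale (th th' : R -> R) v : continuous th' ->
  (forall t : R, is_derive t (1 : R) th (th' t)) -> H10 Om v ->
  W Om T (fun t => th t *: v).
Proof.
move=> cth' dth Hv; have Lv := H10_L2 Hv.
have cth : continuous th.
  by move=> t; apply: differentiable_continuous; apply/derivable1_diffP; case: (dth t).
split.
- apply: (L2B_scale sH) => //; first exact: continuous_measurable_fun.
  exact: continuous_sqint.
- by exists (fun t => th' t *: ip Om v); exact: (time_deriv_scale oOm bOm T0 cth' dth Lv).
- by move=> t _; exact: (smZ sL2 (th t) Lv).
- move=> t tT.
  have cc : (fun s => `|th s - th t| * L2norm Om v) @ within `[0, T]%classic (nbhs t) --> (0 : R).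
    have h : (fun s => `|th s - th t| * L2norm Om v) @ t --> `|th t - th t| * L2norm Om v.
      apply: cvgM; last exact: cvg_cst.
      by apply: cvg_norm; apply: cvgB; [exact: cth|exact: cvg_cst].
    by rewrite subrr normr0 mul0r in h; exact: cvg_within_filter.
  apply: within_squeeze0 cc => s _.
  rewrite -scalerBl; apply/andP; split; first exact: (sm_ge0 sL2 (smZ sL2 (th s - th t) Lv)).
  by have -> := sm_nrmZ sL2 (th s - th t) Lv.
Qed.

Lemma W0 : W Om T 0.
Proof.
have H0 := H100 oOm bOm.
have -> : (0 : R -> E -> R) = (fun t : R => (fun=> 0 : R) t *: (0 : E -> R)).
  by apply/funext => t; rewrite scaler0.
by apply: (@W_scale (fun=> 0) (fun=> 0)) => // t; exact: cst_continuous.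
Qed.

(** Applied to the adjoint state, this is the continuity that lets derivatives of cut-offs
    concentrating at a time evaluate the function there. *)
Lemma W_ip_continuous z v : W Om T z -> L2 Om v ->
  {within `[0, T], continuous (fun t => ip Om v (z t))}.
Proof.
move=> [_ _ L c] Lv; apply/subspace_continuousP => t tT.
have tT' : 0 <= t <= T by move: tT; rewrite /= in_itv.
have cc := within_cvg0Z (L2norm Om v) (c t tT').
apply/cvgrPdist_le => e e0; move/cvgr0Pnorm_le : cc => /(_ e e0).
apply: filter_app; near=> s.
have sT : 0 <= s <= T.
  have : `[0, T]%classic s by near: s; exact: withinT.
  by rewrite /= in_itv.
apply: le_trans.
rewrite -(prBr (L2_pairing oOm) Lv (L t tT') (L s sT)).
have h := pr_bound (L2_pairing oOm) Lv (smB sL2 (L t tT') (L s sT)).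
apply: (le_trans h); rewrite (sm_nrmC sL2 (L t tT') (L s sT)); exact: ler_norm.
Unshelve. all: by end_near. Qed.

End state_space.

Section continuous_forms.
Context (R : realType) (d : nat).
Local Notation E := 'rV[R]_d.
Local Notation mu := (@lebesgue_measure R).
Context (Om : set E).
Hypothesis oOm : open Om.
Hypothesis bOm : bounded_set Om.
Context (T : R) (psi : (E -> R) -> R) (N : nat) (tau : nat -> R).
Hypothesis T0 : 0 < T.
Hypothesis Hpsi : Hm1 Om psi.
Hypothesis tau0 : tau 0%N = 0.
Hypothesis tauN : tau N = T.
Hypothesis tauS : forall l, (l < N)%N -> tau l < tau l.+1.

Let pH := Hm1_pairing oOm bOm.
Let pG := H10_grad_pairing oOm bOm.
Let N0 := N_gt0 T0 tau0 tauN.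

Lemma sum_cells_full (f : R -> R) : aeint mu `]0, T[%classic f ->
  \sum_(0 <= l < N) \int[mu]_(t in cell tau l) f t = \int[mu]_(t in `]0, T[) f t.
Proof.
move=> fi; have h := @sum_cells R N tau tauS f N (leqnn N) N0.
by rewrite tau0 tauN in h; exact: h.
Qed.

Lemma W_rlim z v l : W Om T z -> (l < N)%N -> L2 Om v ->
  ip Om (rlim Om z (tau l)) v = ip Om (z (tau l)) v.
Proof.
move=> Wz lN; apply: (rlimE oOm lN); apply: (W_haslimr Wz).
by rewrite (tau_ltT tauN tauS lN) (tau_ge0 tau0 tauS (ltnW lN)).
Qed.

Lemma W_rlimr z v l : W Om T z -> (l < N)%N -> L2 Om v ->
  ip Om v (rlim Om z (tau l)) = ip Om v (z (tau l)).
Proof.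
move=> Wz lN Lv; have h := W_rlim Wz lN Lv; have C := sipC (L2_semi_ip oOm).
exact: (etrans (C _ _) (etrans h (C _ _))).
Qed.

Lemma W_jump z v l : W Om T z -> (0 < l < N)%N -> L2 Om v ->
  ip Om (jump Om z (tau l)) v = 0.
Proof.
move=> Wz lN' Lv; have /andP[l0 lN] := lN'.
have pz := W_piecewise oOm bOm tau0 tauN tauS Wz.
apply: (etrans (ip_jump oOm lN' pz Lv)).
have h1 := W_rlim Wz lN Lv.
have tT : 0 < tau l <= T.
  by rewrite (tau_leT tauN tauS (ltnW lN)) -tau0 (tau_lt tauS l0 (ltnW lN)).
have h2 := @llimE R d Om oOm tau z l _ v (W_haslimL Wz tT) Lv.
by apply: (etrans (congr2 (fun x y => x - y) h1 h2)); rewrite subrr.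
Qed.

Lemma heat_formW y p g : W Om T y -> W Om T p -> is_time_deriv Om 0 T y g ->
  heat_form Om N tau y p = \int[mu]_(t in `]0, T[) g t (p t) +
    \int[mu]_(t in `]0, T[) ip_grad Om (y t) (p t) + ip Om (y 0) (p 0).
Proof.
move=> Wy Wp Hg; have [Hy _ Ly _] := Wy; have [Hp _ Lp _] := Wp.
have pp := W_piecewise oOm bOm tau0 tauN tauS Wp.
have e1 : \sum_(0 <= l < N) pair_on (cell tau l) (dt Om (tau l) (tau l.+1) y) p =
    \int[mu]_(t in `]0, T[) g t (p t).
  rewrite -(sum_cells_full (pairing_aeint pH Hg.1 Hp)).
  apply: eq_big_nat => l /andP[_ lN].
  have Hl : is_time_deriv Om (tau l) (tau l.+1) y g.
    apply: (time_deriv_sub oOm bOm _ _ Hg); last exact: (tau_leT tauN tauS lN).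
    exact: (tau_ge0 tau0 tauS (ltnW lN)).
  by apply: (etrans (pair_dtE oOm bOm lN Hl pp)); rewrite /cell Rintegral_oc_oo.
have e2 : \sum_(0 <= l < N) ip_grad_on Om (cell tau l) y p =
    \int[mu]_(t in `]0, T[) ip_grad Om (y t) (p t).
  exact: (sum_cells_full (pairing_aeint pG Hy Hp)).
have e3 : \sum_(1 <= l < N) ip Om (jump Om y (tau l)) (rlim Om p (tau l)) = 0.
  apply: big1_seq => l; rewrite mem_index_iota => /andP[_ lN].
  by apply: (W_jump Wy lN); apply: (rlim_L2 oOm _ pp); case/andP: lN.
have e4 : ip Om (rlim Om y (tau 0%N)) (rlim Om p (tau 0%N)) = ip Om (y 0) (p 0).
  have L0 : L2 Om (y (tau 0%N)) by apply: Ly; rewrite tau0 lexx ltW.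
  apply: (etrans (W_rlim Wy N0 (rlim_L2 oOm N0 pp))).
  by apply: (etrans (W_rlimr Wp N0 L0)); rewrite tau0.
rewrite /heat_form.
apply: (etrans (congr2 +%R (congr2 +%R (congr2 +%R e1 e2) e3) e4)).
by rewrite addr0.
Qed.

Lemma psi_formW u p : L2t 0 T u -> L2_H10 Om 0 T p ->
  psi_form psi N tau u p = \int[mu]_(t in `]0, T[) (u t * psi (p t)).
Proof.
move=> Lu Hp; have LP := L2_Psi oOm bOm Hpsi (lexx 0) (lexx T) Lu.
exact: (sum_cells_full (pairing_aeint pH LP Hp)).
Qed.

Lemma Lagr_W k y0 yd alpha (G : (R -> R) -> 'cV[R]_k) b y u p mup mum lam :
  L2 Om y0 -> W Om T y -> L2t 0 T u -> W Om T p ->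
  Lagr Om T psi y0 yd alpha G b (y, u, p, mup, mum, lam) =
  Lagr_t Om T psi y0 yd alpha G b N tau (y, u, p, mup, mum, lam).
Proof.
move=> Ly0 Wy Lu Wp; have [Hy gy Ly _] := Wy; have [Hp _ Lp _] := Wp.
have pp := W_piecewise oOm bOm tau0 tauN tauS Wp.
have py := W_piecewise oOm bOm tau0 tauN tauS Wy.
have sub := prBl (L2_pairing oOm).
have h1 := heat_formW Wy Wp (dtP gy); have h2 := psi_formW Lu Hp.
have L0 : L2 Om (y 0) by apply: Ly; rewrite lexx ltW.
have Lp0 : L2 Om (p 0) by apply: Lp; rewrite lexx ltW.
have e3 : ip Om (rlim Om y 0 - y0) (rlim Om p 0) =
    ip Om (rlim Om y (tau 0%N)) (rlim Om p (tau 0%N)) - ip Om y0 (p 0).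
  have e := W_rlimr Wp N0 Ly0; rewrite tau0 in e.
  have Lr := rlim_L2 oOm N0 py; have Lrp := rlim_L2 oOm N0 pp.
  rewrite tau0 in Lr Lrp; rewrite tau0.
  by apply: (etrans (sub _ _ _ Lr Ly0 Lrp)); congr (_ - _).
have e4 := sub _ _ _ L0 Ly0 Lp0.
rewrite /Lagr /Lagr_t; congr (_ + _).
apply: (etrans (congr2 +%R (congr2 (fun x z => x - z) erefl e4) (esym h2))).
apply: esym; apply: (etrans (congr2 +%R (congr2 (fun x z => x - z) erefl e3) erefl)).
rewrite /psi_form; congr (_ + _).
move: h1; rewrite /heat_form /pair_on /ip_grad_on.
move: (J _ _ _ _ _ _) => j.
move: (ip _ y0 _) (ip _ (rlim _ _ _) _) (ip _ (y 0) _) => i1 i2 i3.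
move: (\sum_(1 <= l < N) _) => x6.
move: (\sum_(0 <= l < N) _) (\sum_(0 <= l < N) _) => s1 s2.
move: (\int[mu]_(t in _) _) (\int[mu]_(t in _) _) => r1 r2 h.
transitivity (j - (s2 + s1 + x6 + i2) + i1); first by ring.
by rewrite h; ring.
Qed.

End continuous_forms.

(** * Testing the continuous equations with piecewise constant functions *)

Section cutoff.
Context (R : realType).
Local Notation mu := (@lebesgue_measure R).

Lemma Rintegral_split (f : R -> R) a b c : a < b -> b < c ->
  aeint mu `]a, c[%classic f ->
  \int[mu]_(t in `]a, c[) f t = \int[mu]_(t in `]a, b[) f t + \int[mu]_(t in `]b, c[) f t.
Proof.
move=> ab bc fi.
have E : (`]a, c[%classic : set R) = `]a, b]%classic `|` `]b, c[%classic.
  apply/seteqP; split=> t /=; rewrite !in_itv/=.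
    move=> /andP[h1 h2]; case: (leP t b) => tb; [left|right]; first by rewrite h1.
    by rewrite h2.
  case=> /andP[h1 h2]; first by rewrite h1 (le_lt_trans h2).
  by rewrite h2 (lt_trans ab).
have dj : [disjoint (`]a, b]%classic : set R) & (`]b, c[%classic : set R)].
  apply/disj_setPS => t /= [] ; rewrite !in_itv/= => /andP[_ h1] /andP[h2 _].
  by move: (lt_le_trans h2 h1); rewrite ltxx.
rewrite E in fi; rewrite E (aeRintegral_setU (mitvoc a b) (mitv b c) fi dj).
by congr (_ + _); exact: Rintegral_oc_oo.
Qed.

Section ramp.
Context (c : R).

(* Smooth approximations of the indicator function of ]c, +oo[. *)
Definition ramp (n : nat) (t : R) : R := flat 1 (n%:R * (t - c)).
(** The derivative of [ramp], as differentiation of [flat] sends the polynomial 1 to X^2; an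
    approximate Dirac measure at [c] that lives to the right of [c]. *)
Definition dramp (n : nat) (t : R) : R := n%:R * flat 'X^2 (n%:R * (t - c)).

Lemma is_derive_ramp n (t : R) : is_derive t (1 : R) (ramp n) (dramp n t).
Proof.
have h1 : is_derive (n%:R * (t - c)) (1 : R) (@flat R 1) (flat 'X^2 (n%:R * (t - c))).
  by have := @is_derive_flat R 1 (n%:R * (t - c)); rewrite derivC subr0 mulr1.
have h2 : is_derive t (1 : R) (fun t : R => n%:R * (t - c)) n%:R.
  have h3 : is_derive t (1 : R) (fun t : R => t - c) 1.
    by have := is_deriveB (is_derive_id t (1 : R)) (is_derive_cst c t (1 : R)); rewrite subr0.
  by have := is_deriveZ n%:R h3; rewrite /GRing.scale/= mulr1.
by have := @is_derive1_comp R (flat 1) (fun t : R => n%:R * (t - c)) t _ _ h1 h2; rewrite mulrC.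
Qed.

Lemma dramp_continuous n : continuous (dramp n).
Proof.
move=> t; apply: cvgM; first exact: cvg_cst.
apply: (@continuous_comp _ _ _ (fun t : R => n%:R * (t - c)) (flat 'X^2)).
  by apply: cvgM; [exact: cvg_cst|apply: cvgB; [exact: cvg_id|exact: cvg_cst]].
by apply: differentiable_continuous; exact: differentiable_flat.
Qed.

Lemma ramp_continuous n : continuous (ramp n).
Proof.
move=> t; apply: differentiable_continuous.
by apply/derivable1_diffP; case: (is_derive_ramp n t).
Qed.

Lemma dramp_ge0 n t : 0 <= dramp n t.
Proof.
apply: mulr_ge0 => //; rewrite /flat; case: ifP => // _.
by rewrite hornerXn mulr_ge0 ?sqr_ge0// expR_ge0.
Qed.

Lemma ramp_le n t : t <= c -> ramp n t = 0.
Proof. by move=> tc; apply: flat1_neg; rewrite mulr_ge0_le0// subr_le0. Qed.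

Lemma dramp_le n t : t <= c -> dramp n t = 0.
Proof.
move=> tc; rewrite /dramp /flat ltNge (_ : _ <= 0) ?mulr0//.
by rewrite mulr_ge0_le0// subr_le0.
Qed.

Lemma ramp_cvg t : (ramp ^~ t) @ \oo --> ((c < t)%R%:R : R).
Proof. by have := @flat1_cvg R (t - c); rewrite subr_gt0. Qed.

(** [dramp] is nonnegative, vanishes up to [c] and has the primitive [ramp], so a bound on [f]
    beyond [c] suffices and the mass is a difference of ramps. *)
Lemma dramp_bound n a b (f : R -> R) K : a < b -> aeint mu `]a, b[%classic f ->
  (forall t, a < t < b -> c < t -> `|f t| <= K) ->
  `|\int[mu]_(t in `]a, b[) (dramp n t * f t)| <= K * (ramp n b - ramp n a).
Proof.
move=> ab fi fK.
have di : aeint mu `]a, b[%classic (dramp n).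
  apply: (sqint_aeint (mitv a b) (itv_finite a b)).
  by apply: continuous_sqint; exact: dramp_continuous.
have mf : aemeas mu `]a, b[%classic (fun t => dramp n t * f t).
  exact: (aemeasM (aeint_meas di) (aeint_meas fi)).
have dK := aeintZ (mitv a b) K di.
have bnd : {ae mu, forall t, `]a, b[%classic t -> `|dramp n t * f t| <= K * dramp n t}.
  apply: aeW => t; rewrite /= in_itv/= => tab.
  rewrite normrM (ger0_norm (dramp_ge0 n t)) mulrC.
  have [tc|ct] := leP t c; first by rewrite dramp_le// !mulr0.
  by rewrite ler_wpM2r ?dramp_ge0// fK.
have dfi := @aeint_dom _ _ _ mu _ (mitv a b) _ _ mf bnd dK.
apply: (le_trans (ler_norm_aeRintegral (mitv a b) dfi)).
apply: (le_trans (ae_le_Rintegral (mitv a b) (aeint_norm dfi) dK bnd)).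
rewrite (aeRintegralZ (mitv a b) K di).
by rewrite (Rintegral_FTC ab (@dramp_continuous n) (is_derive_ramp n)).
Qed.

Context (T : R).
Hypothesis cT : 0 <= c < T.

Let T0 : 0 < T. Proof. by case/andP: cT => /le_lt_trans h /h. Qed.

Lemma ramp_integral_cvg f : aeint mu `]0, T[%classic f ->
  (fun n => \int[mu]_(t in `]0, T[) (ramp n t * f t)) @ \oo -->
    \int[mu]_(t in `]c, T[) f t.
Proof.
move=> fi.
have mr n : aemeas mu (`]0, T[%classic : set R) (ramp n).
  apply: measurable_aemeas; apply: measurable_funTS.
  by apply: continuous_measurable_fun; exact: ramp_continuous.
have -> : \int[mu]_(t in `]c, T[) f t = \int[mu]_(t in `]0, T[) ((c < t)%R%:R * f t).
  have /andP[c0 cT'] := cT; have fc : aeint mu `]0, T[%classic (fun t => (c < t)%R%:R * f t).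
    apply: (@aeint_dom _ _ _ mu _ (mitv 0 T) _ (fun t => `|f t|)).
    - apply: (@aemeas_cvg _ _ _ mu _ (fun n t => ramp n t * f t) _ (mitv 0 T)).
        by move=> n; exact: (aemeasM (mr n) (aeint_meas fi)).
      by apply: aeW => t _; apply: cvgM; [exact: ramp_cvg|exact: cvg_cst].
    - by apply: aeW => t _; case: (c < t); rewrite ?mul1r// mul0r normr0.
    - exact: aeint_norm.
  have e1 : \int[mu]_(t in `]c, T[) ((c < t)%R%:R * f t) = \int[mu]_(t in `]c, T[) f t.
    by apply: eq_Rintegral => t; rewrite inE /= in_itv/= => /andP[-> _]; rewrite mul1r.
  (* Splitting the integral needs [0 < c]; for [c = 0] both integrals run over the same interval. *)
  move: c0; rewrite le_eqVlt => /orP[/eqP c0|c0]; first by rewrite -e1 -c0.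
  rewrite (Rintegral_split c0 cT' fc) e1 [X in _ = X + _](_ : _ = 0) ?add0r//.
  rewrite [LHS](_ : _ = \int[mu]_(t in `]0, c[) (0 * (1 : R))).
    by rewrite (aeRintegralZ (mitv 0 c) 0) ?mul0r//;
      exact: (sqint_aeint (mitv 0 c) (itv_finite 0 c) (sqint_cst (mitv 0 c) 1 (itv_finite 0 c))).
  apply: eq_Rintegral => t; rewrite inE /= in_itv/= => /andP[_ tc].
  by rewrite ltNge (ltW tc)/= !mul0r.
apply: (@aeRintegral_cvg _ _ _ mu _ (mitv 0 T) _ _ (fun t => `|f t|)).
- by move=> n; exact: (aemeasM (mr n) (aeint_meas fi)).
- by apply: aeW => t _; apply: cvgM; [exact: ramp_cvg|exact: cvg_cst].
- move=> n; apply: aeW => t _; have /andP[h0 h1] := flat1_ge0 (n%:R * (t - c)).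
  by rewrite normrM (ger0_norm h0) ler_piMl.
- exact: aeint_norm.
Qed.

(** A one-sided approximate identity: the mass [ramp n T] on [(0,T)] tends to 1 and the mass beyond
    any point to the right of [c] tends to 0. *)
Lemma dramp_integral_cvg q : {within `[0, T], continuous q} ->
  aeint mu `]0, T[%classic q ->
  (fun n => \int[mu]_(t in `]0, T[) (dramp n t * q t)) @ \oo --> q c.
Proof.
move=> cq qi; have /andP[c0 cT'] := cT.
have [M M0 qM] : exists2 M, 0 <= M & forall t, 0 <= t <= T -> `|q t| <= M.
  have cnq : {within `[0, T], continuous (fun t => `|q t|)}.
    by move=> t; apply: cvg_norm; exact: cq.
  have [t0 _ h] := EVT_max (ltW T0) cnq.
  exists `|q t0|; first exact: normr_ge0.
  by move=> t tT; apply: h; rewrite in_itv.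
have cT2 : `[0, T]%classic c by rewrite /= in_itv/= c0 ltW.
have qc : q @ within `[0, T]%classic (nbhs c) --> q c.
  by move/subspace_continuousP : cq; exact.
apply/cvgrPdist_le => e e0.
have e3 : 0 < e / 2 by rewrite divr_gt0.
move/cvgrPdist_le : qc => /(_ _ e3); rewrite /prop_near1 /within/= => /nbhs_ballP[r /= r0 hr].
(* Half of [r] and the midpoint of [(c,T)] keep [D] strictly inside the range of the continuity
   estimate and below [T]. *)
pose D := Num.min (c + r / 2) ((c + T) / 2).
have cD : c < D by rewrite /D lt_min; apply/andP; split; lra.
have DT : D < T by rewrite /D gt_min; apply/orP; right; lra.
have D0 : 0 < D by exact: le_lt_trans c0 cD.
have Dr : D < c + r by rewrite /D gt_min; apply/orP; left; lra.
have near_c t : 0 < t < D -> c < t -> `|q t - q c| <= e / 2.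
  move=> /andP[t0 tD] ct; rewrite distrC; apply: hr.
    by rewrite /ball /= ltr_norml; apply/andP; split; lra.
  by rewrite in_itv/= (ltW t0) ltW// (lt_trans tD).
have qic (a b : R) : 0 <= a -> b <= T -> aeint mu `]a, b[%classic (fun t => q t - q c).
  move=> a0 bT; apply: (aeintS (mitv 0 T) (mitv a b)).
    move=> t; rewrite /= !in_itv/= => /andP[h1 h2].
    by rewrite (le_lt_trans a0 h1) (lt_le_trans h2 bT).
  apply: (aeintB (mitv 0 T) qi).
  exact: (sqint_aeint (mitv 0 T) (itv_finite 0 T) (sqint_cst (mitv 0 T) (q c) (itv_finite 0 T))).
have di (n : nat) (a b : R) : aeint mu `]a, b[%classic (dramp n).
  apply: (sqint_aeint (mitv a b) (itv_finite a b)).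
  by apply: continuous_sqint; exact: dramp_continuous.
have dqi n : aeint mu `]0, T[%classic (fun t => dramp n t * (q t - q c)).
  have [K hK] : exists K, forall t, 0 <= t <= T -> `|dramp n t| <= K.
    have cnq : {within `[0, T], continuous (fun t => `|dramp n t|)}.
      apply: continuous_subspaceT => t; apply: cvg_norm; exact: dramp_continuous.
    have [t0 _ h] := EVT_max (ltW T0) cnq.
    by exists `|dramp n t0| => t tT; apply: h; rewrite in_itv.
  have qn := aeintZ (mitv 0 T) K (aeint_norm (qic 0 T (lexx 0) (lexx T))).
  apply: (@aeint_dom _ _ _ mu _ (mitv 0 T) _ _ _ _ qn).
    exact: (aemeasM (aeint_meas (di n 0 T)) (aeint_meas (qic 0 T (lexx 0) (lexx T)))).
  apply: aeW => t; rewrite /= in_itv/= => /andP[t0 tT].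
  by rewrite normrM ler_wpM2r// hK// (ltW t0) ltW.
have DT' := ltW DT; have D0' := ltW D0.
pose K2 := M + `|q c|.
(* The error splits into the part before [D], at most [e / 2] by continuity, the part beyond [D],
   where [K2] bounds the integrand and the mass is small, and the defect of the total mass from
   1. *)
have main n : `|q c - \int[mu]_(t in `]0, T[) (dramp n t * q t)| <=
    e / 2 + (K2 * (ramp n T - ramp n D) + `|q c| * `|1 - ramp n T|).
  have eq1 : \int[mu]_(t in `]0, T[) (dramp n t * q t) =
      \int[mu]_(t in `]0, D[) (dramp n t * (q t - q c)) +
      \int[mu]_(t in `]D, T[) (dramp n t * (q t - q c)) + q c * ramp n T.
    rewrite -(Rintegral_split D0 DT (dqi n)).
    have dT := Rintegral_FTC T0 (@dramp_continuous n) (is_derive_ramp n).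
    rewrite (ramp_le n c0) subr0 in dT.
    rewrite -dT -(aeRintegralZ (mitv 0 T) (q c) (di n 0 T)).
    rewrite -(aeRintegralD (mitv 0 T) (dqi n) (aeintZ (mitv 0 T) (q c) (di n 0 T))).
    by apply: eq_Rintegral => t _; ring.
  have b1 := dramp_bound n D0 (qic 0 D (lexx 0) DT') near_c.
  have b2 : `|\int[mu]_(t in `]D, T[) (dramp n t * (q t - q c))| <=
      K2 * (ramp n T - ramp n D).
    apply: (dramp_bound n DT (qic D T D0' (lexx T))) => t /andP[Dt tT] _.
    apply: (le_trans (ler_normB _ _)); rewrite lerD2r; apply: qM.
    by rewrite (ltW tT) ltW// (lt_trans D0).
  rewrite (ramp_le n c0) subr0 in b1.
  have rD : ramp n D <= 1 by case/andP: (flat1_ge0 (n%:R * (D - c))).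
  have b1' : e / 2 * ramp n D <= e / 2 by rewrite ler_piMr// ltW.
  rewrite eq1 (_ : q c - _ = q c * (1 - ramp n T) -
    (\int[mu]_(t in `]0, D[) (dramp n t * (q t - q c)) +
     \int[mu]_(t in `]D, T[) (dramp n t * (q t - q c)))); last by ring.
  apply: (le_trans (ler_normB _ _)); rewrite normrM addrC addrA lerD2r.
  by apply: (le_trans (ler_normD _ _)); exact: (lerD (le_trans b1 b1') b2).
have cv : (fun n => K2 * (ramp n T - ramp n D) + `|q c| * `|1 - ramp n T|) @ \oo --> (0 : R).
  have -> : (0 : R) = K2 * (1 - 1) + `|q c| * `|1 - 1| by rewrite subrr normr0 !mulr0 addr0.
  have rT := @ramp_cvg T; have rDD := @ramp_cvg D; rewrite cT' in rT; rewrite cD in rDD.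
  apply: cvgD; first by apply: cvgM; [exact: cvg_cst|exact: cvgB].
  apply: cvgM; first exact: cvg_cst.
  by apply: cvg_norm; apply: cvgB => //; exact: cvg_cst.
move/cvgrPdist_le : cv => /(_ _ e3); apply: filterS => n; rewrite sub0r normrN => h.
apply: (le_trans (main n)).
have h2 := le_trans (ler_norm _) h.
have ee : e / 2 + e / 2 = e by field.
by apply: (le_trans (lerD (lexx (e / 2)) h2)); rewrite ee.
Qed.

End ramp.

Section cells.
Context (T : R) (N : nat) (tau : nat -> R).
Hypothesis tau0 : tau 0%N = 0.
Hypothesis tauN : tau N = T.
Hypothesis tauS : forall l, (l < N)%N -> tau l < tau l.+1.

(* The weak form of q' = - F with q(T) = 0. Ramps at c in the place of [th] give,
   in the limit, the integral of F over (c,T). *)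
Lemma cell_integral_adjoint F q : aeint mu `]0, T[%classic F ->
  {within `[0, T], continuous q} -> aeint mu `]0, T[%classic q ->
  (forall th th' : R -> R, continuous th' ->
    (forall t : R, is_derive t (1 : R) th (th' t)) -> th 0 = 0 ->
    \int[mu]_(t in `]0, T[) (th t * F t) = \int[mu]_(t in `]0, T[) (th' t * q t)) ->
  forall l, (l < N)%N -> \int[mu]_(t in cell tau l) F t =
    q (tau l) - (if (l.+1 < N)%N then q (tau l.+1) else 0).
Proof.
move=> Fi cq qi h l lN.
have tail c : 0 <= c < T -> \int[mu]_(t in `]c, T[) F t = q c.
  move=> cT; have /andP[c0 _] := cT.
  have r1 := ramp_integral_cvg cT Fi; have r2 := dramp_integral_cvg cT cq qi.
  have e : (fun n => \int[mu]_(t in `]0, T[) (ramp c n t * F t)) =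
      (fun n => \int[mu]_(t in `]0, T[) (dramp c n t * q t)).
    apply/funext => n; apply: h; first exact: dramp_continuous.
      exact: is_derive_ramp.
    exact: ramp_le.
  by rewrite e in r1; exact: (cvg_unique _ r1 r2).
have t1 : 0 <= tau l < T.
  by rewrite (tau_ltT tauN tauS lN) (tau_ge0 tau0 tauS (ltnW lN)).
rewrite /cell Rintegral_oc_oo -(tail _ t1); case: ifP => lN1.
  have t2 : 0 <= tau l.+1 < T.
    by rewrite (tau_ltT tauN tauS lN1) (tau_ge0 tau0 tauS (ltnW lN1)).
  rewrite -(tail _ t2) (@Rintegral_split F (tau l) (tau l.+1) T) ?addrK//.
  - exact: tauS.
  - by case/andP: t2.
  - apply: (aeintS (mitv 0 T) (mitv (tau l) T)) Fi.
    case/andP: t1 => t1 _ t /=; rewrite !in_itv/= => /andP[h1 ->].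
    by rewrite (le_lt_trans t1).
(* Without a next cell, [tau l.+1] is [T] and the tail is the cell itself. *)
rewrite subr0; have -> : tau l.+1 = T; last by [].
have NE : N = l.+1 by apply/eqP; rewrite eqn_leq lN andbT leqNgt lN1.
by rewrite -tauN NE.
Qed.

End cells.

End cutoff.

(** Boundary terms given per cell are regrouped by grid point, where they form jumps. The initial
    point keeps a right value only, and the last cell contributes nothing at [T]. *)
Lemma sum_by_parts_cells (R : realType) (N : nat) (A B : nat -> R) : (0 < N)%N ->
  \sum_(0 <= l < N) (A l - (if (l.+1 < N)%N then B l else 0)) =
  \sum_(1 <= l < N) (A l - B l.-1) + A 0%N.
Proof.
case: N => // N _; rewrite big_add1/= !sumrB big_nat_recl//.
rewrite [X in _ - X]big_nat_recr//= ltnn addr0.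
rewrite [X in _ - X](_ : _ = \sum_(0 <= l < N) B l); last first.
  by apply: eq_big_nat => l /andP[_ lN]; rewrite ltnS lN.
ring.
Qed.

Lemma Rintegral_lincomb3 (R : realType) (a b : R) (f1 f2 f3 : R -> R) :
  aeint lebesgue_measure `]a, b[%classic f1 ->
  aeint lebesgue_measure `]a, b[%classic f2 ->
  aeint lebesgue_measure `]a, b[%classic f3 ->
  \int[lebesgue_measure]_(t in `]a, b[) (- f1 t - f2 t + f3 t) =
  - (\int[lebesgue_measure]_(t in `]a, b[) f1 t)
  - \int[lebesgue_measure]_(t in `]a, b[) f2 t
  + \int[lebesgue_measure]_(t in `]a, b[) f3 t.
Proof.
move=> i1 i2 i3; have m := mitv a b.
have j1 := aeintZ m (-1) i1.
rewrite -[in RHS]mulN1r -(aeRintegralZ m (-1) i1) -(aeRintegralB m j1 i2).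
rewrite -(aeRintegralD m (aeintB m j1 i2) i3).
by apply: eq_Rintegral => t _; rewrite mulN1r.
Qed.

Section continuous_tests.
Context (R : realType) (d : nat).
Local Notation E := 'rV[R]_d.
Local Notation mu := (@lebesgue_measure R).
Context (Om : set E).
Hypothesis oOm : open Om.
Hypothesis bOm : bounded_set Om.
Context (T : R) (psi : (E -> R) -> R) (y0 : E -> R) (yd : R * E -> R).
Context (N : nat) (tau : nat -> R) (mesh : nat -> set (set E)).
Hypothesis T0 : 0 < T.
Hypothesis Hpsi : Hm1 Om psi.
Hypothesis Ly0 : L2 Om y0.
Hypothesis Lyd : L2Q Om T yd.
Hypothesis tau0 : tau 0%N = 0.
Hypothesis tauN : tau N = T.
Hypothesis tauS : forall l, (l < N)%N -> tau l < tau l.+1.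
Implicit Types (v : E -> R).

Let sL2 := L2_seminormed oOm.
Let sH := H10_seminormed oOm bOm.
Let pL2 := L2_pairing oOm.
Let pH := Hm1_pairing oOm bOm.
Let pG := H10_grad_pairing oOm bOm.
Let N0 := N_gt0 T0 tau0 tauN.
Local Notation D := (`]0, T[%classic : set R).

Let inT t : D t -> 0 < t < T. Proof. by rewrite /= in_itv. Qed.

Let cellT l t : (l < N)%N -> `]tau l, tau l.+1[%classic t -> D t.
Proof.
move=> lN /=; rewrite !in_itv/= => /andP[h1 h2].
by rewrite (le_lt_trans (tau_ge0 tau0 tauS (ltnW lN)) h1) (lt_le_trans h2 (tau_leT tauN tauS lN)).
Qed.

Let cell_aeint l f : (l < N)%N -> aeint mu D f -> aeint mu `]tau l, tau l.+1[%classic f.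
Proof.
by move=> lN; apply: (aeintS (mitv 0 T) (mitv (tau l) (tau l.+1))) => t; exact: cellT.
Qed.

Lemma Xsh_cells w : Xsh Om T N tau mesh w -> exists wl : nat -> E -> R,
  forall l, (l < N)%N -> H10 Om (wl l) /\ forall t, cell tau l t -> w t = wl l.
Proof.
move=> [_ wc]; have h l : exists v,
    (l < N)%N -> H10 Om v /\ forall t, cell tau l t -> w t = v.
  have [lN|_] := boolP (l < N)%N; last by exists 0.
  by have [v Vv vE] := wc l lN; exists v => _; split=> //; exact: Vh_H10 Vv.
by have [f fE] := choice h; exists f.
Qed.

Section state_equation.
Context (y : R -> E -> R) (u : R -> R).
Hypothesis Wy : W Om T y.
Hypothesis Lu : L2t 0 T u.
Hypothesis stateW : forall w, W Om T w ->
  - heat_form Om N tau y w + psi_form psi N tau u w + ip Om y0 (rlim Om w (tau 0%N)) = 0.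

Let g := dt Om 0 T y.
Let Hg : is_time_deriv Om 0 T y g. Proof. by case: Wy => _ /dtP. Qed.
Let Hy : L2_H10 Om 0 T y. Proof. by case: Wy. Qed.

(** The residual of the state equation at time [t], tested with [v]. *)
Let K v t := - g t v - ip_grad Om (y t) v + u t * psi v.

Let gi v : H10 Om v -> aeint mu D (fun t => g t v).
Proof. exact: (Hm1_apply_aeint oOm bOm Hg.1). Qed.

Let yi v : H10 Om v -> aeint mu D (fun t => ip_grad Om (y t) v).
Proof. by move=> Hv; exact: (pairing_aeint pG Hy (L2B_cst sH 0 T Hv)). Qed.

Let ui v : aeint mu D (fun t => u t * psi v).
Proof.
have h := aeintZ (mitv 0 T) (psi v) (L2t_aeint (lexx 0) (lexx T) Lu).
by apply: aeint_ae h; apply: aeW => t _; rewrite mulrC.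
Qed.

Let Ki v : H10 Om v -> aeint mu D (K v).
Proof.
move=> Hv; apply: (aeintD (mitv 0 T) _ (ui v)).
exact: (aeintB (mitv 0 T) (aeintN (mitv 0 T) (gi Hv)) (yi Hv)).
Qed.

(** [th 0] stays free: cut-offs with [th 0 = 0] give the equation on the cells, and [th = 1] gives
    the initial condition. *)
Let test (th th' : R -> R) v : continuous th' ->
  (forall t : R, is_derive t (1 : R) th (th' t)) -> H10 Om v ->
  \int[mu]_(t in `]0, T[) (th t * K v t) = th 0 * (ip Om (y 0) v - ip Om y0 v).
Proof.
move=> cth dth Hv; have Lv := H10_L2 Hv.
have Ww := @W_scale R d Om oOm bOm T T0 th th' v cth dth Hv.
have [Hw _ _ _] := Ww.
have Ly : L2 Om (y 0) by case: Wy => _ _ h _; apply: h; rewrite lexx ltW.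
have h := stateW Ww.
have h1 := heat_formW oOm bOm T0 tau0 tauN tauS Wy Ww Hg.
have h2 := psi_formW oOm bOm T0 Hpsi tau0 tauN tauS Lu Hw.
have h3 := W_rlimr oOm tau0 tauN tauS Ww N0 Ly0; rewrite tau0 in h3.
have i1 := pairing_aeint pH Hg.1 Hw.
have i2 := pairing_aeint pG Hy Hw.
have i3 : aeint mu D (fun t => u t * psi (th t *: v)).
  exact: (pairing_aeint pH (L2_Psi oOm bOm Hpsi (lexx 0) (lexx T) Lu) Hw).
have e : \int[mu]_(t in `]0, T[) (th t * K v t) =
    - (\int[mu]_(t in `]0, T[) g t (th t *: v))
    - \int[mu]_(t in `]0, T[) ip_grad Om (y t) (th t *: v)
    + \int[mu]_(t in `]0, T[) (u t * psi (th t *: v)).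
  apply: etrans; last exact: (Rintegral_lincomb3 i1 i2 i3).
  apply: (ae_Rintegral (mitv 0 T)).
  have [hg _ _] := Hg.1; have [hy _ _] := Hy.
  apply: filterS2 hg hy => t + + /inT tT => /(_ tT) Hgt /(_ tT) Hyt.
  rewrite (prZr pH (th t) Hgt Hv) (prZr pG (th t) Hyt Hv) (prZr pH (th t) Hpsi Hv).
  by rewrite /K; ring.
rewrite e; move: h; rewrite tau0 (_ : rlim Om _ 0 = rlim Om (fun t => th t *: v) (tau 0%N)) ?tau0//.
move=> h; have h' := etrans (esym (congr2 +%R (congr2 +%R (congr1 -%R h1) h2) h3)) h.
have z1 : ip Om (y 0) (th 0 *: v) = th 0 * ip Om (y 0) v := prZr pL2 (th 0) Ly Lv.
have z2 : ip Om y0 (th 0 *: v) = th 0 * ip Om y0 v := prZr pL2 (th 0) Ly0 Lv.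
rewrite z1 z2 in h'; rewrite mulrBr.
move: h'; move: (\int[mu]_(t in _) _) (\int[mu]_(t in _) _) (\int[mu]_(t in _) _) => a1 a2 a3.
move: (th 0 * _) (th 0 * _) => b1 b2 h'.
by apply/eqP; rewrite -subr_eq0 -h'; apply/eqP; ring.
Qed.

Let cellK v l : H10 Om v -> (l < N)%N -> \int[mu]_(t in cell tau l) K v t = 0.
Proof.
move=> Hv lN.
have q0 : aeint mu D (fun=> 0 : R).
  exact: (sqint_aeint (mitv 0 T) (itv_finite 0 T) (sqint_cst (mitv 0 T) 0 (itv_finite 0 T))).
have c0 : {within `[0, T], continuous (fun=> 0 : R)}.
  by apply: continuous_subspaceT => x; exact: cst_continuous.
(* The time derivative stays on [y], so nothing is left to concentrate at grid points: the case
   [q = 0]. *)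
rewrite (cell_integral_adjoint tau0 tauN tauS (Ki Hv) c0 q0) ?if_same ?subrr//.
move=> th th' cth dth th0; rewrite (test cth dth Hv) th0 mul0r.
rewrite [RHS](_ : _ = \int[mu]_(t in `]0, T[) (0 * (0 : R))).
  by rewrite (aeRintegralZ (mitv 0 T) 0 q0) mul0r.
by apply: eq_Rintegral => t _; rewrite mulr0 mul0r.
Qed.

(** With [th = 1] the tested integral is the sum over the cells and hence zero, so only the
    difference of the initial values remains. *)
Let initial v : H10 Om v -> ip Om (y 0) v = ip Om y0 v.
Proof.
move=> Hv; have d1 (t : R) : is_derive t (1 : R) (fun=> 1 : R) 0 by exact: is_derive_cst.
have c1 : continuous (fun _ : R => 0 : R) by move=> t; exact: cst_continuous.
have := test c1 d1 Hv; rewrite mul1r => h.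
apply/eqP; rewrite -subr_eq0 -h; apply/eqP.
rewrite (_ : \int[mu]_(t in _) _ = \int[mu]_(t in `]0, T[) K v t); last first.
  by apply: eq_Rintegral => t _; rewrite mul1r.
rewrite -(sum_cells_full T0 tau0 tauN tauS (Ki Hv)).
by apply: big1_seq => l; rewrite mem_index_iota => /andP[_ /andP[_ lN]]; exact: cellK.
Qed.

Lemma state_equation_Xsh w : Xsh Om T N tau mesh w ->
  - heat_form Om N tau y w + psi_form psi N tau u w + ip Om y0 (rlim Om w (tau 0%N)) = 0.
Proof.
move=> Xw.
have pw := Xsh_piecewise oOm bOm tauS Xw.
have [wl wlE] := Xsh_cells Xw.
have [H0 E0] := wlE 0%N N0; have L0 := H10_L2 H0.
have h0 := Xsh_haslimr oOm tauS N0 L0 E0.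
have e4 : ip Om (rlim Om y (tau 0%N)) (rlim Om w (tau 0%N)) = ip Om (y 0) (wl 0%N).
  have Ly : L2 Om (y (tau 0%N)) by case: Wy => _ _ h _; apply: h; rewrite tau0 lexx ltW.
  apply: (etrans (W_rlim oOm tau0 tauN tauS Wy N0 (rlim_L2 oOm N0 pw))).
  by apply: (etrans (ip_lim0r oOm h0 Ly)); rewrite tau0.
have e5 : ip Om y0 (rlim Om w (tau 0%N)) = ip Om y0 (wl 0%N) := ip_lim0r oOm h0 Ly0.
have e3 : \sum_(1 <= l < N) ip Om (jump Om y (tau l)) (rlim Om w (tau l)) = 0.
  apply: big1_seq => l; rewrite mem_index_iota => /andP[_ lN].
  apply: (W_jump oOm bOm tau0 tauN tauS Wy lN).
  by apply: (rlim_L2 oOm _ pw); case/andP: lN.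
have e : - (\sum_(0 <= l < N) pair_on (cell tau l) (dt Om (tau l) (tau l.+1) y) w)
    - \sum_(0 <= l < N) ip_grad_on Om (cell tau l) y w
    + \sum_(0 <= l < N) pair_on (cell tau l) (Psi psi u) w = 0.
  rewrite -!sumrN -!big_split/=; apply: big1_seq => l.
  rewrite mem_index_iota => /andP[_ /andP[_ lN]].
  have [Hv Ev] := wlE l lN.
  have Hl : is_time_deriv Om (tau l) (tau l.+1) y g.
    apply: (time_deriv_sub oOm bOm _ _ Hg); last exact: (tau_leT tauN tauS lN).
    exact: (tau_ge0 tau0 tauS (ltnW lN)).
  have cE t : `]tau l, tau l.+1[%classic t -> w t = wl l.
    by rewrite /= in_itv/= => /andP[h1 h2]; apply: Ev; rewrite /cell /= in_itv/= h1 ltW.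
  have q1 : pair_on (cell tau l) (dt Om (tau l) (tau l.+1) y) w =
      \int[mu]_(t in `]tau l, tau l.+1[) g t (wl l).
    apply: (etrans (pair_dtE oOm bOm lN Hl pw)).
    by apply: eq_Rintegral => t; rewrite inE => /cE ->.
  have q2 : ip_grad_on Om (cell tau l) y w =
      \int[mu]_(t in `]tau l, tau l.+1[) ip_grad Om (y t) (wl l).
    rewrite /ip_grad_on /cell Rintegral_oc_oo.
    by apply: eq_Rintegral => t; rewrite inE => /cE ->.
  have q3 : pair_on (cell tau l) (Psi psi u) w =
      \int[mu]_(t in `]tau l, tau l.+1[) (u t * psi (wl l)).
    rewrite /pair_on /cell Rintegral_oc_oo.
    by apply: eq_Rintegral => t; rewrite inE => /cE ->.
  have j1 := cell_aeint lN (gi Hv); have j2 := cell_aeint lN (yi Hv).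
  have j3 := cell_aeint lN (ui (wl l)).
  rewrite q1 q2 q3 -(cellK Hv lN) /cell Rintegral_oc_oo.
  exact: (esym (Rintegral_lincomb3 j1 j2 j3)).
rewrite e5 -(initial H0) /heat_form /psi_form.
apply: (etrans (congr2 +%R (congr2 +%R (congr1 -%R (congr2 +%R
  (congr2 +%R erefl e3) e4)) erefl) erefl)).
rewrite addr0; move: e.
move: (\sum_(0 <= l < N) _) (\sum_(0 <= l < N) _) (\sum_(0 <= l < N) _) (ip _ _ _) => s1 s2 s3 i e.
by rewrite -[RHS]e; ring.
Qed.

End state_equation.

Section adjoint_equation.
Context (y p : R -> E -> R).
Hypothesis Wy : W Om T y.
Hypothesis Wp : W Om T p.
Hypothesis adjointW : forall w, W Om T w ->
  - yd_form Om T yd w + L2L2_form Om T w y - heat_form Om N tau w p = 0.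

Let Hp : L2_H10 Om 0 T p. Proof. by case: Wp. Qed.
Let Ly : L2_L2 Om 0 T y. Proof. by case: Wy => /(L2_H10_L2 oOm bOm). Qed.
Let Lp : L2_L2 Om 0 T p. Proof. by case: Wp => /(L2_H10_L2 oOm bOm). Qed.

(** The adjoint equation tested with [v], without its time derivative and initial term; these are
    represented by [q t = ip Om v (p t)]. *)
Let F v t := - ip Om v (yslice yd t) - ip_grad Om v (p t) + ip Om v (y t).

Let q1i v : L2 Om v -> aeint mu D (fun t => ip Om v (yslice yd t)).
Proof. by move=> Lv; exact: (yd_form_aeint oOm Lyd (L2B_cst sL2 0 T Lv)). Qed.

Let q2i v : H10 Om v -> aeint mu D (fun t => ip_grad Om v (p t)).
Proof. by move=> Hv; exact: (pairing_aeint pG (L2B_cst sH 0 T Hv) Hp). Qed.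

Let q3i v : L2 Om v -> aeint mu D (fun t => ip Om v (y t)).
Proof. by move=> Lv; exact: (pairing_aeint pL2 (L2B_cst sL2 0 T Lv) Ly). Qed.

Let qi v : L2 Om v -> aeint mu D (fun t => ip Om v (p t)).
Proof. by move=> Lv; exact: (pairing_aeint pL2 (L2B_cst sL2 0 T Lv) Lp). Qed.

Let Fi v : H10 Om v -> aeint mu D (F v).
Proof.
move=> Hv; have Lv := H10_L2 Hv; apply: (aeintD (mitv 0 T) _ (q3i Lv)).
exact: (aeintB (mitv 0 T) (aeintN (mitv 0 T) (q1i Lv)) (q2i Hv)).
Qed.

(** Here the time derivative acts on the test function and produces [th'], while [th 0 = 0] removes
    the initial term. *)
Let test (th th' : R -> R) v : continuous th' ->
  (forall t : R, is_derive t (1 : R) th (th' t)) -> th 0 = 0 -> H10 Om v ->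
  \int[mu]_(t in `]0, T[) (th t * F v t) =
  \int[mu]_(t in `]0, T[) (th' t * ip Om v (p t)).
Proof.
move=> cth dth th0 Hv; have Lv := H10_L2 Hv.
have Ww := @W_scale R d Om oOm bOm T T0 th th' v cth dth Hv.
have [Hw _ _ _] := Ww; have Lw := L2_H10_L2 oOm bOm Hw.
have Lp0 : L2 Om (p 0) by case: Wp => _ _ h _; apply: h; rewrite lexx ltW.
have h := adjointW Ww.
have Dw := time_deriv_scale oOm bOm T0 cth dth Lv.
have h1 := heat_formW oOm bOm T0 tau0 tauN tauS Ww Wp Dw.
have i1 := yd_form_aeint oOm Lyd Lw.
have i2 := pairing_aeint pG Hw Hp.
have i3 := pairing_aeint pL2 Lw Ly.
have e : \int[mu]_(t in `]0, T[) (th t * F v t) =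
    - (\int[mu]_(t in `]0, T[) ip Om (th t *: v) (yslice yd t))
    - \int[mu]_(t in `]0, T[) ip_grad Om (th t *: v) (p t)
    + \int[mu]_(t in `]0, T[) ip Om (th t *: v) (y t).
  apply: etrans; last exact: (Rintegral_lincomb3 i1 i2 i3).
  apply: (ae_Rintegral (mitv 0 T)).
  have [hp _ _] := Hp; have [hy _ _] := Ly.
  apply: filterS3 (yslice_L2 oOm Lyd) hp hy => t + + + /inT tT.
  move=> /(_ tT) Ldt /(_ tT) Hpt /(_ tT) Lyt.
  rewrite (prZl pL2 (th t) Lv Ldt) (prZl pG (th t) Hv Hpt) (prZl pL2 (th t) Lv Lyt).
  by rewrite /F; ring.
rewrite e; have z : ip Om (th 0 *: v) (p 0) = 0.
  by apply: (etrans (prZl pL2 (th 0) Lv Lp0)); rewrite th0 mul0r.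
have h' := etrans (esym (congr2 (fun a b => a - b) erefl
  (etrans h1 (congr2 +%R erefl z)))) h.
move: h'; rewrite addr0 /yd_form /L2L2_form.
rewrite -[X in _ -> _ = X](_ : \int[mu]_(t in `]0, T[) (th' t *: ip Om v) (p t) = _)//.
move: (\int[mu]_(t in _) _) (\int[mu]_(t in _) _) (\int[mu]_(t in _) _).
move: (\int[mu]_(t in _) _) => a1 a2 a3 a4 h'.
by apply/eqP; rewrite -subr_eq0 -h'; apply/eqP; ring.
Qed.

Let cellF v l : H10 Om v -> (l < N)%N -> \int[mu]_(t in cell tau l) F v t =
  ip Om v (p (tau l)) - (if (l.+1 < N)%N then ip Om v (p (tau l.+1)) else 0).
Proof.
move=> Hv lN; have Lv := H10_L2 Hv.
apply: (cell_integral_adjoint tau0 tauN tauS (Fi Hv)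
  (q := fun t => ip Om v (p t))) => //.
- exact: (W_ip_continuous oOm Wp Lv).
- exact: qi.
- by move=> th th' cth dth th0; exact: test.
Qed.

Lemma adjoint_equation_Xsh w : Xsh Om T N tau mesh w ->
  - yd_form Om T yd w + L2L2_form Om T w y - heat_form Om N tau w p = 0.
Proof.
move=> Xw; have [wl wlE] := Xsh_cells Xw.
have pw := Xsh_piecewise oOm bOm tauS Xw; have Lw := pwL2 pw.
have pp := W_piecewise oOm bOm tau0 tauN tauS Wp.
have Lpt l : (l < N)%N -> L2 Om (p (tau l)).
  move=> lN; case: Wp => _ _ h _; apply: h.
  by rewrite (tau_leT tauN tauS (ltnW lN)) (tau_ge0 tau0 tauS (ltnW lN)).
have rl l v : (l < N)%N -> L2 Om v -> ip Om (rlim Om w (tau l)) v = ip Om (wl l) v.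
  move=> lN Lv; have [Hv Ev] := wlE l lN.
  exact: (rlimE oOm lN (Xsh_haslimr oOm tauS lN (H10_L2 Hv) Ev) Lv).
have ll l v : (l.+1 < N)%N -> L2 Om v -> ip Om (llim Om w (tau l.+1)) v = ip Om (wl l) v.
  move=> lN Lv; have [Hv Ev] := wlE l (ltnW lN).
  exact: (llimE oOm (Xsh_haslimL oOm tauS (ltnW lN) (H10_L2 Hv) Ev) Lv).
(* For the indices of the sum [tau l.-1.+1] is [tau l]; this form fits the summation by parts, where
   cell [l] ends at [tau l.+1]. *)
have e3 : \sum_(1 <= l < N) ip Om (jump Om w (tau l)) (rlim Om p (tau l)) =
    \sum_(1 <= l < N) (ip Om (wl l) (p (tau l)) - ip Om (wl l.-1) (p (tau l.-1.+1))).
  apply: eq_big_nat => l lN'; have /andP[l0 lN] := lN'.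
  have Lr := rlim_L2 oOm lN pp.
  have Lj := jump_L2 oOm lN' pw.
  apply: (etrans (W_rlimr oOm tau0 tauN tauS Wp lN Lj)).
  apply: (etrans (ip_jump oOm lN' pw (Lpt l lN))).
  case: l l0 lN {lN' Lr Lj} => // l _ lN.
  exact: (congr2 (fun a b => a - b) (rl _ _ lN (Lpt _ lN)) (ll _ _ lN (Lpt _ lN))).
have e4 : ip Om (rlim Om w (tau 0%N)) (rlim Om p (tau 0%N)) = ip Om (wl 0%N) (p (tau 0%N)).
  apply: (etrans (W_rlimr oOm tau0 tauN tauS Wp N0 (rlim_L2 oOm N0 pw))).
  exact: (rl _ _ N0 (Lpt _ N0)).
have e1 : \sum_(0 <= l < N) pair_on (cell tau l) (dt Om (tau l) (tau l.+1) w) p = 0.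
  apply: big1_seq => l; rewrite mem_index_iota => /andP[_ /andP[_ lN]].
  have [Hv Ev] := wlE l lN.
  have Dl : is_time_deriv Om (tau l) (tau l.+1) w (fun=> 0).
    apply: (time_deriv_ae (z := fun=> wl l)).
      by move=> t /andP[h1 h2]; rewrite Ev// /cell /= in_itv/= h1 ltW.
    by apply: (time_deriv_cst oOm bOm); [exact: tauS|exact: H10_L2 Hv].
  apply: (etrans (pair_dtE oOm bOm lN Dl pp)).
  have q0 := sqint_aeint (mitv (tau l) (tau l.+1)) (itv_finite (tau l) (tau l.+1))
    (sqint_cst (mitv (tau l) (tau l.+1)) 0 (itv_finite (tau l) (tau l.+1))).
  rewrite [LHS](_ : _ = \int[mu]_(t in `]tau l, tau l.+1[) (0 * (0 : R))).
    by rewrite (aeRintegralZ (mitv (tau l) (tau l.+1)) 0 q0) mul0r.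
  by apply: eq_Rintegral => t _; rewrite mul0r.
have e : - yd_form Om T yd w - (\sum_(0 <= l < N) ip_grad_on Om (cell tau l) w p)
    + L2L2_form Om T w y = \sum_(0 <= l < N) \int[mu]_(t in cell tau l) F (wl l) t.
  rewrite /yd_form -(sum_cells_full T0 tau0 tauN tauS (yd_form_aeint oOm Lyd Lw)).
  rewrite /L2L2_form -(sum_cells_full T0 tau0 tauN tauS (pairing_aeint pL2 Lw Ly)).
  rewrite -!sumrN -!big_split/=; apply: eq_big_nat => l /andP[_ lN].
  have [Hv Ev] := wlE l lN; have Lv := H10_L2 Hv.
  have cE t : `]tau l, tau l.+1[%classic t -> w t = wl l.
    by rewrite /= in_itv/= => /andP[h1 h2]; apply: Ev; rewrite /cell /= in_itv/= h1 ltW.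
  have q1 : \int[mu]_(t in cell tau l) ip Om (w t) (yslice yd t) =
      \int[mu]_(t in `]tau l, tau l.+1[) ip Om (wl l) (yslice yd t).
    rewrite /cell Rintegral_oc_oo.
    by apply: eq_Rintegral => t; rewrite inE => /cE ->.
  have q2 : ip_grad_on Om (cell tau l) w p =
      \int[mu]_(t in `]tau l, tau l.+1[) ip_grad Om (wl l) (p t).
    rewrite /ip_grad_on /cell Rintegral_oc_oo.
    by apply: eq_Rintegral => t; rewrite inE => /cE ->.
  have q3 : \int[mu]_(t in cell tau l) ip Om (w t) (y t) =
      \int[mu]_(t in `]tau l, tau l.+1[) ip Om (wl l) (y t).
    rewrite /cell Rintegral_oc_oo.
    by apply: eq_Rintegral => t; rewrite inE => /cE ->.
  rewrite q1 q2 q3 /cell Rintegral_oc_oo.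
  have j1 := cell_aeint lN (q1i Lv); have j2 := cell_aeint lN (q2i Hv).
  have j3 := cell_aeint lN (q3i Lv).
  exact: (esym (Rintegral_lincomb3 j1 j2 j3)).
have e' : \sum_(0 <= l < N) \int[mu]_(t in cell tau l) F (wl l) t =
    \sum_(1 <= l < N) (ip Om (wl l) (p (tau l)) - ip Om (wl l.-1) (p (tau l.-1.+1)))
    + ip Om (wl 0%N) (p (tau 0%N)).
  rewrite -(sum_by_parts_cells (fun l => ip Om (wl l) (p (tau l)))
    (fun l => ip Om (wl l) (p (tau l.+1))) N0).
  apply: eq_big_nat => l /andP[_ lN].
  by have [Hv _] := wlE l lN; exact: cellF.
rewrite /heat_form.
apply: (etrans (congr2 (fun a b => a - b) erefl
  (congr2 +%R (congr2 +%R (congr2 +%R e1 erefl) e3) e4))).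
move: (etrans e e').
move: (\sum_(1 <= l < N) _) (\sum_(0 <= l < N) _) (yd_form _ _ _ _) => s1 s2 b1.
move: (L2L2_form _ _ _ _) (ip _ _ _) => b2 b3 h.
by apply/eqP; rewrite add0r -(subrr (s1 + b3)) -{1}h subr_eq; apply/eqP; ring.
Qed.

End adjoint_equation.

End continuous_tests.

(** * Derivatives of the discrete Lagrangian *)

Section derivatives.
Context (R : realType) (d k : nat).
Local Notation E := 'rV[R]_d.
Local Notation mu := (@lebesgue_measure R).
Local Notation pt := (pdpoint R d k).
Context (Om : set E).
Hypothesis oOm : open Om.
Hypothesis bOm : bounded_set Om.
Context (T : R) (psi : (E -> R) -> R) (y0 : E -> R) (yd : R * E -> R) (alpha : R).
Context (m : 'I_k -> nat) (I : forall l : 'I_k, 'I_(m l) -> interval R).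
Context (a : forall l : 'I_k, 'cV[R]_(m l)) (b : 'cV[R]_k).
Context (N : nat) (tau : nat -> R).
Hypothesis T0 : 0 < T.
Hypothesis Hpsi : Hm1 Om psi.
Hypothesis Ly0 : L2 Om y0.
Hypothesis Lyd : L2Q Om T yd.
Hypothesis ID : forall l i, [set` @I l i] `<=` (`]0, T[%classic : set R).
Hypothesis tau0 : tau 0%N = 0.
Hypothesis tauN : tau N = T.
Hypothesis tauS : forall l, (l < N)%N -> tau l < tau l.+1.

Local Notation pw := (piecewise Om T N tau).
Local Notation G := (Gop (@I) (@a)).
Local Notation Lt := (Lagr_t Om T psi y0 yd alpha G b N tau).
Local Notation L := (Lagr Om T psi y0 yd alpha G b).
Local Notation adm := (@admissible R d k Om T N tau).
Local Notation ll := (@lagr_lin R d k Om T y0 yd alpha b tau).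
Local Notation bl := (lagr_bil Om T psi alpha (@I) (@a) N tau).

Let admD := @admissibleD R d k Om oOm bOm T N tau tau0 tauN tauS.
Let admZ := @admissibleZ R d k Om oOm bOm T N tau tau0 tauN tauS.
Let llin := @lagr_lin_lin R d k Om oOm T y0 yd alpha b N tau T0 Ly0 Lyd tau0 tauN.
Let blin := @lagr_bil_bilin R d k Om oOm bOm T psi alpha m I a N tau T0 Hpsi ID tau0 tauN tauS.

Let LtE := @Lagr_tE R d k Om oOm T psi y0 yd alpha m I a b N tau T0 Ly0 Lyd tau0 tauN.

Lemma dderiv_Lagr_t X D : adm X -> adm D -> dderiv Lt X D = ll D + bl X D + bl D X.
Proof.
exact: (@derive1_quadratic_form R pt adm Lt (lagr_cst Om T yd alpha) ll bl
  admD admZ llin blin LtE X D).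
Qed.

Lemma Lagr_t_trapezoid X Y : adm X -> adm Y ->
  Lt X - Lt Y = 2^-1 * dderiv Lt X (X - Y) + 2^-1 * dderiv Lt Y (X - Y).
Proof.
move=> aX aY; have aN : adm (-1 *: Y) := admZ (-1) aY.
have aXY : adm (X + -1 *: Y) := admD aX aN.
rewrite -[- Y]scaleN1r (dderiv_Lagr_t aX aXY) (dderiv_Lagr_t aY aXY).
exact: (@quadratic_trapezoid R pt adm Lt (lagr_cst Om T yd alpha) ll bl
  admZ llin blin LtE X Y aX aY).
Qed.

Lemma dderiv_Lagr_t_lin X : adm X -> lin (adm : pt -> Prop) (dderiv Lt X).
Proof.
move=> aX; split=> [D D' aD aD'|c D aD].
  rewrite (dderiv_Lagr_t aX aD) (dderiv_Lagr_t aX aD') (dderiv_Lagr_t aX (admD aD aD')).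
  rewrite (liD llin aD aD') (blDr blin aX aD aD') (blDl blin aD aD' aX).
  by ring.
rewrite (dderiv_Lagr_t aX aD) (dderiv_Lagr_t aX (admZ c aD)).
rewrite (liZ llin c aD) (blZr blin c aX aD) (blZl blin c aD aX).
by ring.
Qed.

(** The zero function is piecewise constant for every mesh; the empty mesh serves as an instance. *)
Let pw0 : pw 0 := piecewise0 oOm bOm T (fun=> set0) tauS.
Let u0 := @L2t0 R T.
Let bH := heat_form_bilin oOm bOm T0 tau0 tauN tauS.
Let bP := psi_form_bilin oOm bOm Hpsi tau0 tauN tauS.
Let bI : bilin (L2t 0 T : (R -> R) -> Prop) (L2t 0 T : (R -> R) -> Prop) (int2 T).
Proof. exact: L2t_mul_bilin. Qed.
Let bG := Gform_bilin a ID.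
Let bL := L2L2_form_bilin oOm T.

Lemma admissible_dir_y dy : pw dy -> adm (dir_y k dy).
Proof. by move=> h; split. Qed.

Lemma admissible_dir_p dp : pw dp -> adm (dir_p k dp).
Proof. by move=> h; split. Qed.

Lemma admissible_dir_u du : L2t 0 T du -> adm (dir_u d k du).
Proof. by move=> h; split. Qed.

Lemma admissible_dir_mup dm : L2t 0 T dm -> adm (dir_mup d k dm).
Proof. by move=> h; split. Qed.

Lemma admissible_dir_mum dm : L2t 0 T dm -> adm (dir_mum d k dm).
Proof. by move=> h; split. Qed.

Lemma admissible_dir_lam dl : adm (dir_lam d dl).
Proof. by split. Qed.

Let int10 : int1 T (0 : R -> R) = 0.
Proof. exact: (lin0 (L2t_int_lin T) u0). Qed.

Let ip_rlim0 : ip Om y0 (rlim Om 0 (tau 0%N)) = 0.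
Proof.
have h := @rlim_linr R d Om oOm T N tau y0 0%N (N_gt0 T0 tau0 tauN) Ly0.
exact: (lin0 h pw0).
Qed.

Let mul0b : ((0 : 'cV[R]_k)^T *m b) ord0 ord0 = 0.
Proof. by rewrite trmx0 mul0mx mxE. Qed.

Lemma dderiv_dir_y y u p mup mum lam dy :
  adm (y, u, p, mup, mum, lam) -> pw dy ->
  dderiv Lt (y, u, p, mup, mum, lam) (dir_y k dy) =
  - yd_form Om T yd dy + L2L2_form Om T dy y - heat_form Om N tau dy p.
Proof.
move=> aX pdy; rewrite (dderiv_Lagr_t aX (admissible_dir_y pdy)).
have [/= py Lu pp Lp Lm] := aX.
have C : L2L2_form Om T y dy = L2L2_form Om T dy y.
  by apply: eq_Rintegral => t _; exact: (sipC (L2_semi_ip oOm)).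
have z1 := bl0r bI Lu u0; have z2 := bl0l bI u0 Lu.
have z3 := bl0r bI Lp u0; have z4 := bl0r bI Lm u0.
have z5 : heat_form Om N tau y 0 = 0 := bl0r bH py pw0.
have z6 : psi_form psi N tau u 0 = 0 := bl0r bP Lu pw0.
have z7 : psi_form psi N tau 0 p = 0 := bl0l bP u0 pp.
have z8 : Gform (@I) (@a) lam 0 = 0 := bl0r bG Logic.I u0.
have z9 : Gform (@I) (@a) 0 u = 0 := bl0l bG Logic.I Lu.
rewrite /lagr_lin /lagr_bil /= C z1 z2 z3 z4 z5 z6 z7 z8 z9 int10 ip_rlim0 mul0b.
by field.
Qed.

Lemma dderiv_dir_p y u p mup mum lam dp :
  adm (y, u, p, mup, mum, lam) -> pw dp ->
  dderiv Lt (y, u, p, mup, mum, lam) (dir_p k dp) =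
  - heat_form Om N tau y dp + psi_form psi N tau u dp + ip Om y0 (rlim Om dp (tau 0%N)).
Proof.
move=> aX pdp; rewrite (dderiv_Lagr_t aX (admissible_dir_p pdp)).
have [/= py Lu pp Lp Lm] := aX.
have z0 : yd_form Om T yd 0 = 0 := lin0 (yd_form_lin oOm Lyd) (pwL2 pw0).
have z1 := bl0r bI Lu u0; have z2 := bl0l bI u0 Lu.
have z3 := bl0r bI Lp u0; have z4 := bl0r bI Lm u0.
have z5 : heat_form Om N tau 0 p = 0 := bl0l bH pw0 pp.
have z7 : psi_form psi N tau 0 p = 0 := bl0l bP u0 pp.
have z8 : Gform (@I) (@a) lam 0 = 0 := bl0r bG Logic.I u0.
have z9 : Gform (@I) (@a) 0 u = 0 := bl0l bG Logic.I Lu.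
have z10 : L2L2_form Om T y 0 = 0 := bl0r bL (pwL2 py) (pwL2 pw0).
have z11 : L2L2_form Om T 0 y = 0 := bl0l bL (pwL2 pw0) (pwL2 py).
rewrite /lagr_lin /lagr_bil /= z0 z1 z2 z3 z4 z5 z7 z8 z9 z10 z11 int10 mul0b.
by field.
Qed.

(** The Lagrangian is affine in p, so its p-dependent part is its derivative in the direction [p]
    itself. Stationarity removes that part, and the state equation need not be unfolded. *)
Lemma Lagr_t_value y u p mup mum lam : adm (y, u, p, mup, mum, lam) ->
  Lt (y, u, p, mup, mum, lam) = J Om T yd alpha y u +
    dderiv Lt (y, u, p, mup, mum, lam) (dir_p k p) +
    multiplier_terms T G b u mup mum lam.
Proof.
move=> aX; have [/= py Lu pp Lp Lm] := aX.
apply: (etrans (LtE aX)).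
rewrite (dderiv_dir_p aX pp) (J_expand oOm alpha T0 Lyd (pwL2 py) Lu).
rewrite (multiplier_terms_expand (@I) a b lam Lu Lp Lm) /lagr_cst /lagr_lin /lagr_bil /=.
by field.
Qed.

End derivatives.

(** * Assembly of the error identity *)

Lemma pdpoint_sub (R : realType) (d k : nat)
    (y u p mup mum : _) (lam : 'cV[R]_k) yr ur pr mupr mumr lamr :
  ((y, u, p, mup, mum, lam) : pdpoint R d k) - (yr, ur, pr, mupr, mumr, lamr) =
  dir_y k (y - yr) + dir_u d k (u - ur) + dir_p k (p - pr) +
  dir_mup d k (mup - mupr) + dir_mum d k (mum - mumr) + dir_lam d (lam - lamr).
Proof.
transitivity ((y - yr + 0 + 0 + 0 + 0 + 0, 0 + (u - ur) + 0 + 0 + 0 + 0,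
  0 + 0 + (p - pr) + 0 + 0 + 0, 0 + 0 + 0 + (mup - mupr) + 0 + 0,
  0 + 0 + 0 + 0 + (mum - mumr) + 0, 0 + 0 + 0 + 0 + 0 + (lam - lamr)) : pdpoint R d k).
  by rewrite !addr0 !add0r.
by [].
Qed.

Lemma multiplier_terms_eq0 (R : realType) (k : nat) (T : R) (G : (R -> R) -> 'cV[R]_k)
    b u mup mum lam :
  {ae lebesgue_measure, forall t : R, 0 < t < T -> mup t * (u t - 1) = 0} ->
  {ae lebesgue_measure, forall t : R, 0 < t < T -> mum t * u t = 0} ->
  (lam^T *m (G u - b)) ord0 ord0 = 0 ->
  multiplier_terms T G b u mup mum lam = 0.
Proof.
move=> hp hm hG; rewrite /multiplier_terms hG addr0.
have z (f : R -> R) : {ae lebesgue_measure, forall t : R, 0 < t < T -> f t = 0} ->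
    \int[lebesgue_measure]_(t in `]0, T[) f t = 0.
  move=> h; rewrite (@ae_Rintegral _ _ _ lebesgue_measure _ f (fun=> 0 * 1) (mitv 0 T)).
    have i1 := sqint_aeint (mitv 0 T) (itv_finite 0 T)
      (sqint_cst (mitv 0 T) 1 (itv_finite 0 T)).
    by rewrite (aeRintegralZ (mitv 0 T) 0 i1) mul0r.
  apply: filterS h => t + tT; rewrite mul0r; apply.
  by move: tT; rewrite /= in_itv.
by rewrite (z _ hp) (z _ hm) subrr.
Qed.

(** W(0,T) is closed under sums and multiples, so the two Lagrangians agree along the whole line and
    the same real function is differentiated. *)
Lemma dderiv_Lagr_W (R : realType) (d k : nat) (Om : set 'rV[R]_d) (oOm : open Om)
    (bOm : bounded_set Om) (T : R) psi y0 yd alpha (G : (R -> R) -> 'cV[R]_k) b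
    (N : nat) (tau : nat -> R) (T0 : 0 < T) (Hpsi : Hm1 Om psi) (Ly0 : L2 Om y0)
    (tau0 : tau 0%N = 0) (tauN : tau N = T)
    (tauS : forall l, (l < N)%N -> tau l < tau l.+1)
    y u p mup mum lam dy du dp :
  W Om T y -> L2t 0 T u -> W Om T p -> W Om T dy -> L2t 0 T du -> W Om T dp ->
  dderiv (Lagr Om T psi y0 yd alpha G b) (y, u, p, mup, mum, lam) (dy, du, dp, 0, 0, 0) =
  dderiv (Lagr_t Om T psi y0 yd alpha G b N tau) (y, u, p, mup, mum, lam) (dy, du, dp, 0, 0, 0).
Proof.
move=> Wy Lu Wp Wdy Ldu Wdp; rewrite /dderiv; congr (derive1 _ 0).
apply/funext => s.
exact: (@Lagr_W R d Om oOm bOm T psi N tau T0 Hpsi tau0 tauN tauS k y0 yd alpha G b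
  (y + s *: dy) (u + s *: du) (p + s *: dp) (mup + s *: 0) (mum + s *: 0) (lam + s *: 0)
  Ly0 (WD oOm bOm Wy (WZ oOm bOm s Wdy)) (L2tD Lu (L2tZ s Ldu))
  (WD oOm bOm Wp (WZ oOm bOm s Wdp))).
Qed.

Lemma dir_yB (R : realType) (d k : nat) (y yr : R -> 'rV[R]_d -> R) :
  dir_y k (y - yr) = dir_y k y + (-1) *: dir_y k yr.
Proof.
transitivity ((y + (-1) *: yr, 0 + (-1) *: 0, 0 + (-1) *: 0, 0 + (-1) *: 0,
  0 + (-1) *: 0, 0 + (-1) *: 0) : pdpoint R d k).
  by rewrite !scaleN1r !oppr0 !addr0.
by [].
Qed.

Lemma dir_pB (R : realType) (d k : nat) (p pr : R -> 'rV[R]_d -> R) :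
  dir_p k (p - pr) = dir_p k p + (-1) *: dir_p k pr.
Proof.
transitivity ((0 + (-1) *: 0, 0 + (-1) *: 0, p + (-1) *: pr, 0 + (-1) *: 0,
  0 + (-1) *: 0, 0 + (-1) *: 0) : pdpoint R d k).
  by rewrite !scaleN1r !oppr0 !addr0.
by [].
Qed.

Unset Implicit Arguments. Set Strict Implicit. Set Printing Implicit Defensive.

Theorem theorem6p1 (R : realType) (d k : nat) (Om : set 'rV[R]_d) (T : R)
    (psi : ('rV[R]_d -> R) -> R) (y0 : 'rV[R]_d -> R)
    (yd : R * 'rV[R]_d -> R) (alpha : R)
    (m : 'I_k -> nat) (I : forall l : 'I_k, 'I_(m l) -> interval R)
    (a : forall l : 'I_k, 'cV[R]_(m l)) (b : 'cV[R]_k)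
    (N : nat) (tau : nat -> R) (mesh : nat -> set (set 'rV[R]_d))
    (y : R -> 'rV[R]_d -> R) (u : R -> R) (p : R -> 'rV[R]_d -> R)
    (mup mum : R -> R) (lam : 'cV[R]_k)
    (yr : R -> 'rV[R]_d -> R) (ur : R -> R) (pr : R -> 'rV[R]_d -> R)
    (mupr mumr : R -> R) (lamr : 'cV[R]_k) :
  let G := Gop I a in
  let L := Lagr Om T psi y0 yd alpha G b in
  let Lt := Lagr_t Om T psi y0 yd alpha G b N tau in
  let chi : pdpoint R d k := (y, u, p, mup, mum, lam) in
  let chir : pdpoint R d k := (yr, ur, pr, mupr, mumr, lamr) in
  (0 < d)%N -> 0 < T -> bounded_lipschitz_domain Om ->
  Hm1 Om psi -> L2 Om y0 -> L2Q Om T yd -> 0 <= alpha ->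
  (forall l i, ([set` I l i] `<=` `]0, T[%classic) /\ (0 < lebesgue_measure [set` I l i])%E) ->
  tau 0%N = 0 -> tau N = T -> (forall l, (l < N)%N -> tau l < tau l.+1) ->
  (forall l, (l < N)%N -> is_mesh Om (mesh l)) ->
  (* chi is in Y and satisfies the continuous optimality conditions *)
  W Om T y -> L2t 0 T u -> W Om T p -> L2t 0 T mup -> L2t 0 T mum ->
  (forall dy du dp, W Om T dy -> L2t 0 T du -> W Om T dp ->
     dderiv L chi (dy, du, dp, 0, 0, 0) = 0) ->
  {ae lebesgue_measure, forall t : R, 0 < t < T ->
     [/\ 0 <= mup t, mup t * (u t - 1) = 0 & u t <= 1]} ->
  {ae lebesgue_measure, forall t : R, 0 < t < T ->
     [/\ 0 <= mum t, mum t * u t = 0 & 0 <= u t]} ->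
  le_vec 0 lam -> (lam^T *m (G u - b)) ord0 ord0 = 0 -> le_vec (G u) b ->
  (* chir is in Y_rho and satisfies the discrete optimality conditions *)
  Xsh Om T N tau mesh yr -> Qrho T N tau ur -> Xsh Om T N tau mesh pr ->
  Qrho T N tau mupr -> Qrho T N tau mumr ->
  (forall dy du dp, Xsh Om T N tau mesh dy -> Qrho T N tau du ->
     Xsh Om T N tau mesh dp -> dderiv Lt chir (dy, du, dp, 0, 0, 0) = 0) ->
  (forall l, (l < N)%N -> forall t, cell tau l t ->
     [/\ 0 <= mupr t, mupr t * (ur t - 1) = 0 & ur t <= 1]) ->
  (forall l, (l < N)%N -> forall t, cell tau l t ->
     [/\ 0 <= mumr t, mumr t * ur t = 0 & 0 <= ur t]) ->
  le_vec 0 lamr -> (lamr^T *m (G ur - b)) ord0 ord0 = 0 -> le_vec (G ur) b ->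
  J Om T yd alpha y u - J Om T yd alpha yr ur =
    2^-1 * dderiv Lt chi (chi - chir) + 2^-1 * dderiv Lt chir (chi - chir)
  /\
  2^-1 * dderiv Lt chi (chi - chir) + 2^-1 * dderiv Lt chir (chi - chir) =
    2^-1 * (dderiv Lt chir (dir_y k (y - yr)) + dderiv Lt chir (dir_p k (p - pr))
            + dderiv Lt chir (dir_u d k (u - ur))
            + dderiv Lt chi (dir_mup d k (mup - mupr))
            + dderiv Lt chi (dir_mum d k (mum - mumr))
            + dderiv Lt chi (dir_lam d (lam - lamr))
            + dderiv Lt chir (dir_mup d k (mup - mupr))
            + dderiv Lt chir (dir_mum d k (mum - mumr))
            + dderiv Lt chir (dir_lam d (lam - lamr))).
Proof.
move=> G L Lt chi chir _ T0 [oOm _ _ bOm _] Hpsi Ly0 Lyd _ HI tau0 tauN tauS _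
  Wy Lu Wp Lmp Lmm optL cmp cmm _ cG _ Xyr Qur Xpr Qmpr Qmmr optr cmpr cmmr _ cGr _.
have ID l i : [set` I l i] `<=` (`]0, T[%classic : set R) by case: (HI l i).
have py := W_piecewise oOm bOm tau0 tauN tauS Wy.
have pp := W_piecewise oOm bOm tau0 tauN tauS Wp.
have pyr := Xsh_piecewise oOm bOm tauS Xyr.
have ppr := Xsh_piecewise oOm bOm tauS Xpr.
have [Lur _] := Qur; have [Lmpr _] := Qmpr; have [Lmmr _] := Qmmr.
have aX : admissible Om T N tau chi by split.
have aXr : admissible Om T N tau chir by split.
have W00 := W0 oOm bOm T0.
have u0 := @L2t0 R T.
pose dL X D : R := dderiv Lt X D.
have l1 : lin (admissible Om T N tau : pdpoint R d k -> Prop) (dL chi) :=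
  dderiv_Lagr_t_lin oOm bOm alpha a b T0 Hpsi Ly0 Lyd ID tau0 tauN tauS aX.
have l2 : lin (admissible Om T N tau : pdpoint R d k -> Prop) (dL chir) :=
  dderiv_Lagr_t_lin oOm bOm alpha a b T0 Hpsi Ly0 Lyd ID tau0 tauN tauS aXr.
have v1 := Lagr_t_value oOm bOm alpha a b T0 Hpsi Ly0 Lyd ID tau0 tauN tauS aX.
have v2 := Lagr_t_value oOm bOm alpha a b T0 Hpsi Ly0 Lyd ID tau0 tauN tauS aXr.
have fy dy : piecewise Om T N tau dy -> _ :=
  dderiv_dir_y oOm bOm alpha a b T0 Hpsi Ly0 Lyd ID tau0 tauN tauS aX.
have fp dp : piecewise Om T N tau dp -> _ :=
  dderiv_dir_p oOm bOm alpha a b T0 Hpsi Ly0 Lyd ID tau0 tauN tauS aX.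
have optW dy du dp : W Om T dy -> L2t 0 T du -> W Om T dp ->
    dL chi (dy, du, dp, 0, 0, 0) = 0.
  move=> Wdy Ldu Wdp; apply: etrans (optL dy du dp Wdy Ldu Wdp).
  exact: (esym (dderiv_Lagr_W oOm bOm yd alpha G b T0 Hpsi Ly0 tau0 tauN tauS
    mup mum lam Wy Lu Wp Wdy Ldu Wdp)).
have stateW w : W Om T w -> - heat_form Om N tau y w + psi_form psi N tau u w
    + ip Om y0 (rlim Om w (tau 0%N)) = 0.
  move=> Ww; have pw := W_piecewise oOm bOm tau0 tauN tauS Ww.
  exact: (etrans (esym (fp w pw)) (optW 0 0 w W00 u0 Ww)).
have adjointW w : W Om T w -> - yd_form Om T yd w + L2L2_form Om T w y
    - heat_form Om N tau w p = 0.
  move=> Ww; have pw := W_piecewise oOm bOm tau0 tauN tauS Ww.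
  exact: (etrans (esym (fy w pw)) (optW w 0 0 Ww u0 W00)).
have dyr0 : dL chi (dir_y k yr) = 0 := etrans (fy yr pyr)
  (adjoint_equation_Xsh oOm bOm T0 Lyd tau0 tauN tauS Wy Wp adjointW Xyr).
have dpr0 : dL chi (dir_p k pr) = 0 := etrans (fp pr ppr)
  (state_equation_Xsh oOm bOm T0 Hpsi Ly0 tau0 tauN tauS Wy Lu stateW Xpr).
have dy0 : dL chi (dir_y k y) = 0 := optW y 0 0 Wy u0 W00.
have dp0 : dL chi (dir_p k p) = 0 := optW 0 0 p W00 u0 Wp.
have Ldiff v w : L2t 0 T v -> L2t 0 T w -> L2t 0 T (v - w).
  by move=> Lv Lw; rewrite -scaleN1r; exact: (L2tD Lv (L2tZ (-1) Lw)).
(* Discrete controls lie in L^2(0,T), so the control direction is conforming and the continuous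
   optimality condition applies directly. *)
have du0 : dL chi (dir_u d k (u - ur)) = 0 := optW 0 (u - ur) 0 W00 (Ldiff u ur Lu Lur) W00.
have Xsh00 := Xsh0 oOm bOm T N tau mesh.
have Q0 : Qrho T N tau 0 by split=> [|l _]; [exact: u0|exists 0].
(* For the value of the Lagrangian at [chir], stationarity in the direction [pr] is enough. *)
have dpr1 : dL chir (dir_p k pr) = 0 := optr 0 0 pr Xsh00 Q0 Xpr.
have m1 : multiplier_terms T G b u mup mum lam = 0.
  apply: multiplier_terms_eq0 cG.
    by apply: filterS cmp => t h /h[].
  by apply: filterS cmm => t h /h[].
have inC t : 0 < t < T -> exists2 l, (l < N)%N & cell tau l t.
  move=> /andP[t0 tT]; have h := @cell_mem R N tau t.
  by rewrite tau0 tauN in h; apply: h; rewrite t0 ltW.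
have m2 : multiplier_terms T G b ur mupr mumr lamr = 0.
  apply: multiplier_terms_eq0 cGr.
    by apply: aeW => t /inC[l lN lt]; case: (cmpr l lN t lt).
  by apply: aeW => t /inC[l lN lt]; case: (cmmr l lN t lt).
have J1 : Lt chi = J Om T yd alpha y u.
  by apply: (etrans v1); rewrite m1 [dderiv _ _ _]dp0 !addr0.
have J2 : Lt chir = J Om T yd alpha yr ur.
  by apply: (etrans v2); rewrite m2 [dderiv _ _ _]dpr1 !addr0.
split.
  rewrite -J1 -J2.
  exact: (Lagr_t_trapezoid oOm bOm alpha a b T0 Hpsi Ly0 Lyd ID tau0 tauN tauS aX aXr).
have admD := @admissibleD R d k Om oOm bOm T N tau tau0 tauN tauS.
have admZ := @admissibleZ R d k Om oOm bOm T N tau tau0 tauN tauS.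
have ay z : piecewise Om T N tau z -> _ := @admissible_dir_y R d k Om oOm bOm T N tau tauS z.
have ap z : piecewise Om T N tau z -> _ := @admissible_dir_p R d k Om oOm bOm T N tau tauS z.
have pwB z z' : piecewise Om T N tau z -> piecewise Om T N tau z' ->
    piecewise Om T N tau (z - z').
  move=> pz pz'; rewrite -scaleN1r.
  exact: (piecewiseD oOm bOm tau0 tauN tauS pz (piecewiseZ oOm bOm tau0 tauN tauS (-1) pz')).
have dyB : dL chi (dir_y k (y - yr)) = 0.
  rewrite dir_yB (liD l1 (ay y py) (admZ (-1) _ (ay yr pyr))).
  by rewrite (liZ l1 (-1) (ay yr pyr)) dy0 dyr0 mulr0 addr0.
have dpB : dL chi (dir_p k (p - pr)) = 0.
  rewrite dir_pB (liD l1 (ap p pp) (admZ (-1) _ (ap pr ppr))).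
  by rewrite (liZ l1 (-1) (ap pr ppr)) dp0 dpr0 mulr0 addr0.
have A1 := ay _ (pwB _ _ py pyr).
have A2 := @admissible_dir_u R d k Om oOm bOm T N tau tauS _ (Ldiff u ur Lu Lur).
have A3 := ap _ (pwB _ _ pp ppr).
have A4 := @admissible_dir_mup R d k Om oOm bOm T N tau tauS _ (Ldiff mup mupr Lmp Lmpr).
have A5 := @admissible_dir_mum R d k Om oOm bOm T N tau tauS _ (Ldiff mum mumr Lmm Lmmr).
have A6 := @admissible_dir_lam R d k Om oOm bOm T N tau tauS (lam - lamr).
have dec (f : pdpoint R d k -> R) : lin (admissible Om T N tau : pdpoint R d k -> Prop) f ->
    f (chi - chir) = f (dir_y k (y - yr)) + f (dir_u d k (u - ur)) +
    f (dir_p k (p - pr)) + f (dir_mup d k (mup - mupr)) +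
    f (dir_mum d k (mum - mumr)) + f (dir_lam d (lam - lamr)).
  move=> lf; rewrite [chi - chir]pdpoint_sub.
  have A12 := admD _ _ A1 A2; have A123 := admD _ _ A12 A3.
  have A1234 := admD _ _ A123 A4; have A12345 := admD _ _ A1234 A5.
  rewrite (liD lf A12345 A6) (liD lf A1234 A5) (liD lf A123 A4) (liD lf A12 A3).
  by rewrite (liD lf A1 A2).
have e1 := dec _ l1; have e2 := dec _ l2.
(* At [chi] the directions of y, u and p drop out. At [chir] they stay, because [y], [u] and [p]
   need not be discrete functions. *)
rewrite dyB dpB du0 in e1; move: e1 e2; rewrite /dL => -> ->.
move: (dderiv Lt chi _) (dderiv Lt chi _) (dderiv Lt chi _) => x1 x2 x3.
do 6 (move: (dderiv Lt chir _) => ?).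
by ring.
Qed.
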